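(* Let $X:\Omega\to E$ be a Gaussian random variable, let $d_j\in\mathbb{N}$ for $j\in\mathbb{N}$, and let $(e_{j,m}')_{j\in\mathbb{N},\,1\le m\le d_j}\subset E'$. Suppose there exists a monotone decreasing sequence $(c_j)\in\ell^1(\mathbb{N})$ such that $$\Vert \mathrm{cov}(X)-\mathrm{cov}(X^{[n]})\Vert_{E'\to E}\le c_n\qquad\text{for all } n\in\mathbb{N}.$$ Then, for every monotone increasing sequence $(a_j)_{j\in\mathbb{N}}$ with $a_j>0$ satisfying $\sum_{j\ge1} d_j/a_j<\infty$, $\sum_{j\ge 2}a_j(c_{j-1}-c_j)<\infty$ and $a_jc_j\to 0$, and for all $n\in\mathbb{N}$ and $\tau>0$, we have $$\mu\left(\Vert X-X^{[n]}\Vert_E\le\sqrt{5\max\{1,\tau\}\left(\sum_{j=n+1}^\infty a_j(c_{j-1}-c_j)\right)\left(\sum_{j=n+1}^\infty\frac{d_j}{a_j}\right)}\right)>1-\mathrm{e}^{-\tau}.$$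
   Context: $(\Omega,\mathcal{A},\mu)$ is a probability space, $E$ is a separable real Banach space, $E'$ its dual, and $\mathbb{N}=\{1,2,\dots\}$. A real random variable is Gaussian if its characteristic function is $t\mapsto \mathrm{e}^{it m-\sigma^2t^2/2}$ for some $m,\sigma\in\mathbb{R}$ ($\sigma=0$, a Dirac measure, is allowed). A random variable $X:\Omega\to E$ is Gaussian if $e'(X)$ is a real Gaussian random variable for every $e'\in E'$; such an $X$ belongs to the Bochner space $L^p(\mu,E)$ for all $1\le p<\infty$, and $\mathbb{E}X$ denotes its Bochner expectation. The covariance operator $\mathrm{cov}(X):E'\to E$ is $$\mathrm{cov}(X)(e')=\int_\Omega e'(X-\mathbb{E}X)\,(X-\mathbb{E}X)\,\mathrm{d}\mu .$$ For functionals $(e_{j,m}')_{j\in\mathbb{N},1\le m\le d_j}\subset E'$, $$X^{[n]}:=\mathbb{E}\bigl(X\,\big|\,\sigma(e_{j,m}'(X):1\le j\le n,\ 1\le m\le d_j)\bigr)$$ is the ($E$-valued, Bochner) conditional expectation; it is again an $E$-valued Gaussian random variable. $\Vert\cdot\Vert_{E'\to E}$ is the operator norm. Monotone increasing/decreasing is meant in the non-strict sense. *)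

(* Defs.v *)
(* MathComp-Analysis; the real numbers are an arbitrary [R : realType]. *)
From HB Require Import structures.
From mathcomp Require Import all_boot all_order all_algebra.
From mathcomp Require Import all_classical all_reals all_analysis.
From mathcomp Require Import complex.

Set Implicit Arguments.
Unset Strict Implicit.
Unset Printing Implicit Defensive.

Import Order.TTheory GRing.Theory Num.Theory.
Import numFieldNormedType.Exports.
Local Open Scope classical_set_scope.
Local Open Scope ring_scope.

Definition separable (E : topologicalType) : Prop :=
  exists D : set E, countable D /\ dense D.

(** * Topological dual and operator norm *)

Record dual (R : realType) (E : normedModType R) := Dual {
  dual_fun :> {linear E -> R^o};
  dual_continuous : continuous (dual_fun : E -> R^o)
}.

(* The suprema are taken in [\bar R], so that an unbounded operator has norm
   [+oo]. *)
Definition dual_norm (R : realType) (E : normedModType R) (f : dual E)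
    : \bar R :=
  ereal_sup [set (`|f x : R|)%:E | x in [set x : E | `|x| <= 1]].

Definition opnorm (R : realType) (E : normedModType R) (T : dual E -> E)
    : \bar R :=
  ereal_sup [set (`|T f|)%:E | f in [set f : dual E | (dual_norm f <= 1)%E]].

(** * Measurability and Bochner integral *)

(* Borel measurability of [Y] with respect to a sigma-algebra [F] of subsets of
   [Omega]; over a separable Banach space this is strong measurability. *)
Definition borel_measurable (Omega : Type) (E : topologicalType)
    (F : set (set Omega)) (Y : Omega -> E) : Prop :=
  forall U : set E, open U -> F (Y @^-1` U).

Section Bochner.
Context {d : measure_display} {Omega : measurableType d} {R : realType}.
Context {E : completeNormedModType R}.
Variable mu : probability Omega R.

Definition vsimple (s : Omega -> E) : Prop :=
  finite_set (range s) /\ forall v : E, measurable (s @^-1` [set v]).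

Definition vsintegral (s : Omega -> E) : E :=
  \sum_(v \in range s) fine (mu (s @^-1` [set v])) *: v.

Definition bochner_approx (Y : Omega -> E) (s : nat -> Omega -> E) : Prop :=
  (forall n, vsimple (s n)) /\
  ((fun n => (\int[mu]_w (`|Y w - s n w|)%:E)%E) @ \oo --> 0%E).

Definition bochner_integrable (Y : Omega -> E) : Prop :=
  borel_measurable measurable Y /\ exists s, bochner_approx Y s.

Definition is_bochner_integral (Y : Omega -> E) (v : E) : Prop :=
  borel_measurable measurable Y /\
  exists2 s, bochner_approx Y s & (fun n => vsintegral (s n)) @ \oo --> v.

(* [0] when [Y] is not Bochner integrable. *)
Definition bochner (Y : Omega -> E) : E := xget 0 (is_bochner_integral Y).

(* [Y] is a version of the conditional expectation [E(X | F)], for a Bochner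
   integrable [X] and a sub-sigma-algebra [F]; versions are unique up to almost
   sure equality. *)
Definition is_cond_exp (F : set (set Omega)) (X Y : Omega -> E) : Prop :=
  [/\ borel_measurable F Y,
      bochner_integrable Y &
      forall A, F A ->
        bochner (fun w => \1_A w *: Y w) = bochner (fun w => \1_A w *: X w)].

Definition cov (X : Omega -> E) (f : dual E) : E :=
  bochner (fun w => (f (X w - bochner X) : R) *: (X w - bochner X)).

End Bochner.

(** * Gaussian random variables *)

Definition cexp (R : realType) (z : R[i]) : R[i] :=
  let: (a +i* b)%C := z in ((expR a * cos b)%R +i* (expR a * sin b)%R)%C.

(* The expectation of [exp (i t Y)]. *)
Definition char_fun (d : measure_display) (Omega : measurableType d)
    (R : realType) (mu : probability Omega R) (Y : Omega -> R) (t : R) : R[i] :=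
  (Rintegral mu setT (fun w => cos (t * Y w)) +i*
   Rintegral mu setT (fun w => sin (t * Y w)))%C.

Definition real_gaussian (d : measure_display) (Omega : measurableType d)
    (R : realType) (mu : probability Omega R) (Y : Omega -> R) : Prop :=
  measurable_fun setT Y /\
  exists m sigma : R, forall t : R,
    char_fun mu Y t =
    cexp ('i%C * (t * m)%:C%C - (sigma ^+ 2 * t ^+ 2 / 2)%:C%C).

Definition gaussian (d : measure_display) (Omega : measurableType d)
    (R : realType) (E : completeNormedModType R) (mu : probability Omega R)
    (X : Omega -> E) : Prop :=
  borel_measurable measurable X /\
  forall f : dual E, real_gaussian mu (fun w => f (X w)).

(* The sigma-algebra generated by the [e j m (X)] with [1 <= j <= n]; for each
   [j] the second index ranges over the [dim j] elements of ['I_(dim j)]. *)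
Definition sigma_obs (Omega : Type) (R : realType) (E : normedModType R)
    (X : Omega -> E) (dim : nat -> nat) (e : forall j, 'I_(dim j) -> dual E)
    (n : nat) : set (set Omega) :=
  <<s \bigcup_(j in [set j | (1 <= j <= n)%N]) \bigcup_(m in [set: 'I_(dim j)])
        preimage_set_system setT (fun w => e j m (X w) : R) measurable >>.

(** * Real series indexed from [k] *)

Definition summable_from (R : realType) (k : nat) (u : nat -> R) : Prop :=
  cvgn (fun N => \sum_(k <= j < N) u j).

Definition sum_from (R : realType) (k : nat) (u : nat -> R) : R :=
  limn (fun N => \sum_(k <= j < N) u j).

(* Main.v *)
(* Put [Z = X - E X]. Gram-Schmidt in the Gaussian space [{f(Z)}] turns the
   observations into orthogonal Gaussians [h], [d_j] of them for each block [j];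
   since orthogonality means independence there, [f(X - X^[n])] is the residual
   of the projection of [f(Z)] on the first [n] blocks, and its variance is at
   most [c_n]. As [c_N -> 0], [f(X - X^[n])] is a limit in probability of
   [sum_{n < j <= N} sum_h (B(f(Z), h) / B(h, h)) h]. By Cauchy-Schwarz with
   weights [a_j] the square of this sum is at most
   [sum_j a_j sum_h B(f(Z), h)^2 / B(h, h)], which Abel summation bounds by
   [sum_{j > n} a_j (c_{j-1} - c_j)], times [Q = sum_j sum_h h^2 / (a_j B(h, h))],
   which does not depend on [f]. Jensen's inequality for the weights [1 / a_j] and
   [E exp(2/5 g^2) = sqrt 5 < e] for a standard Gaussian [g] give the tail of [Q],
   and a countable norming family of functionals gives the norm.

   Laws are identified by characteristic functions without Fourier inversion:
   the smallest class of functions containing [cos u] and [sin u], for [u] in a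
   vector space, and closed under linear combinations and bounded pointwise
   limits, already contains the indicators of the generated sigma-algebra. *)
Require Import Defs.
From HB Require Import structures.
From mathcomp Require Import all_boot all_order all_algebra finmap.
From mathcomp Require Import all_classical all_reals all_analysis.
From mathcomp Require Import measurable_realfun complex.
From mathcomp Require Import ring lra.

Set Implicit Arguments.
Unset Strict Implicit.
Unset Printing Implicit Defensive.

Import Order.TTheory GRing.Theory Num.Theory.
Import numFieldNormedType.Exports.
Local Open Scope classical_set_scope.
Local Open Scope ring_scope.

(** * Functions generated by sines and cosines *)

(** Being Gaussian prescribes only the characteristic functions of the single variables [f (X w)].
    Integrability of the norm of [X] has to be derived from them: otherwise [bochner] might return
    its default value, and the covariance hypothesis could not be tested with functionals. The
    difference of two independent copies of [X] removes the unknown mean, Fernique's rotation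
    argument then yields a second moment, and [f (cov mu X f - cov mu Xn f)] becomes the residual
    variance of a scalar projection.

    Passing to the norm costs no union bound over the main term, since the rare event for [Q] is
    common to all functionals. Only the residual at level [N] depends on [f]; for finitely many
    functionals its contribution disappears as [N] grows, and only afterwards does their number
    grow.

    Variables are treated as functions, not as classes modulo null sets, so Gram-Schmidt may produce
    vectors of variance zero. They stay in the lists, each quotient by their variance being [0], so
    that a block always has exactly [dim j] members. *)

Section TrigClosure.
Variables (R : realType) (T : Type) (G : set (T -> R)).

(** The members of [G] may be unbounded, so only their sines and cosines enter. The uniform bound
    [M] in [TrigLim] is what lets integrals pass to the limit by dominated convergence. *)
Inductive trig_closure : (T -> R) -> Prop :=
| TrigCos u : G u -> trig_closure (fun x => cos (u x))
| TrigSin u : G u -> trig_closure (fun x => sin (u x))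
| TrigAdd f g : trig_closure f -> trig_closure g ->
    trig_closure (fun x => f x + g x)
| TrigScale c f : trig_closure f -> trig_closure (fun x => c * f x)
| TrigLim (f_ : nat -> T -> R) f M : (forall n, trig_closure (f_ n)) ->
    (forall n x, `|f_ n x| <= M) -> (forall x, f_ ^~ x @ \oo --> f x) ->
    trig_closure f.

Lemma trig_closure_bounded f : trig_closure f -> exists M, forall x, `|f x| <= M.
Proof.
elim=> [u _|u _|{}f g _ [M fM] _ [N gN]|c {}f _ [M fM]|f_ {}f M _ _ fM ff].
- by exists 1 => x; rewrite ler_norml cos_geN1 cos_le1.
- by exists 1 => x; rewrite ler_norml sin_geN1 sin_le1.
- by exists (M + N) => x; rewrite (le_trans (ler_normD _ _))// lerD.
- by exists (`|c| * M) => x; rewrite normrM ler_wpM2l.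
- exists M => x.
  have /cvg_norm fx := ff x.
  apply: (cvgr_to_le fx).
  by near=> n; exact: fM.
Unshelve. all: by end_near. Qed.

Hypothesis G0 : G (fun=> 0).
Hypothesis GB : forall u v, G u -> G v -> G (fun x => u x - v x).
Hypothesis GZ : forall c u, G u -> G (fun x => c * u x).

Lemma trig_closure1 : trig_closure (fun=> 1).
Proof. by have := TrigCos G0; rewrite cos0. Qed.

Lemma trig_closure_cst c : trig_closure (fun=> c).
Proof. by have := TrigScale c trig_closure1; under eq_fun do rewrite mulr1. Qed.

Lemma trig_closureB f g : trig_closure f -> trig_closure g ->
  trig_closure (fun x => f x - g x).
Proof.
move=> tf /(TrigScale (-1)) /(TrigAdd tf).
by under eq_fun do rewrite mulN1r.
Qed.

Let GD u v : G u -> G v -> G (fun x => u x + v x).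
Proof.
move=> Gu /(GZ (-1)) /(GB Gu).
by under eq_fun do rewrite mulN1r opprK.
Qed.

(** For two generators the product-to-sum formulas apply, because [u - v] and [u + v] remain in [G].
    [base] fixes a generator on the left and inducts on the right factor; the outer induction then
    runs over the left factor. Limits are harmless since every member is bounded. *)
Lemma trig_closureM f g : trig_closure f -> trig_closure g ->
  trig_closure (fun x => f x * g x).
Proof.
have lim (f1 g1 f2 : T -> R) (f_ : nat -> T -> R) M :
    trig_closure g1 ->
    (forall n, trig_closure (fun x => f_ n x * g1 x)) ->
    (forall n x, `|f_ n x| <= M) -> (forall x, f_ ^~ x @ \oo --> f1 x) ->
    trig_closure (fun x => f1 x * g1 x).
  move=> tg tfg fM ff; have [N gN] := trig_closure_bounded tg.
  apply: (TrigLim (M := M * N) tfg) => [n x|x].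
    by rewrite normrM ler_pM.
  by apply: cvgMl; exact: ff.
have base u (b : bool) g1 : G u -> trig_closure g1 ->
    trig_closure (fun x => (if b then cos (u x) else sin (u x)) * g1 x).
  move=> Gu; elim=> [v Gv|v Gv|{}f {}g _ IHf _ IHg|c {}f _ IHf|f_ {}f M tf_ IHf fM ff].
  - case: b.
      have -> : (fun x => cos (u x) * cos (v x)) =
          fun x => 2^-1 * (cos (u x - v x) + cos (u x + v x)).
        by apply/funext => x; rewrite cosB cosD; field.
      by apply/TrigScale/TrigAdd; apply: TrigCos; [exact: GB|exact: GD].
    have -> : (fun x => sin (u x) * cos (v x)) =
        fun x => 2^-1 * (sin (u x - v x) + sin (u x + v x)).
      by apply/funext => x; rewrite sinB sinD; field.
    by apply/TrigScale/TrigAdd; apply: TrigSin; [exact: GB|exact: GD].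
  - case: b.
      have -> : (fun x => cos (u x) * sin (v x)) =
          fun x => 2^-1 * (sin (u x + v x) - sin (u x - v x)).
        by apply/funext => x; rewrite sinB sinD; field.
      by apply/TrigScale/trig_closureB; apply: TrigSin; [exact: GD|exact: GB].
    have -> : (fun x => sin (u x) * sin (v x)) =
        fun x => 2^-1 * (cos (u x - v x) - cos (u x + v x)).
      by apply/funext => x; rewrite cosB cosD; field.
    by apply/TrigScale/trig_closureB; apply: TrigCos; [exact: GB|exact: GD].
  - by under eq_fun do rewrite mulrDr; exact: TrigAdd.
  - by under eq_fun do rewrite mulrCA; exact: TrigScale.
  - under eq_fun do rewrite mulrC.
    apply: (@lim f _ f f_ M) => //.
      by case: (b); [exact: TrigCos|exact: TrigSin].
    by move=> n; under eq_fun do rewrite mulrC; exact: IHf.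
move=> + tg; elim=> [u Gu|u Gu|f1 f2 _ IH1 _ IH2|c {}f _ IH|f_ {}f M _ IH fM ff].
- exact: (base u true).
- exact: (base u false).
- by under eq_fun do rewrite mulrDl; exact: TrigAdd.
- by under eq_fun do rewrite -mulrA; exact: TrigScale.
- exact: (@lim f g f f_ M).
Qed.

(** The Newton-Schulz polynomial for the sign function: it fixes [-1], [0] and [1], and its iterates
    on [[-1, 1]] converge pointwise to the sign. A polynomial keeps the iterates inside an algebra
    of functions. *)
Let p (x : R) := (3 * x - x ^+ 3) / 2.

Let p_pos (x : R) n : 0 < x <= 1 ->
  [/\ x <= iter n p x, iter n p x <= 1 & 1 - iter n p x <= (1 - x / 2) ^+ n].
Proof.
move=> /andP[x0 x1]; elim: n => [|n [xy y1 IH]] /=; first by rewrite expr0; split; lra.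
set y := iter n p x in xy y1 IH *.
have pE : 1 - p y = (1 - y) * (1 - (y + y ^+ 2) / 2) by rewrite /p; field.
have y0 : 0 < y by exact: lt_le_trans xy.
have yy : y ^+ 2 <= 1 by rewrite expr_le1// ltW.
split.
- have : 0 <= y * (1 - y ^+ 2) by apply: mulr_ge0; lra.
  suff -> : y * (1 - y ^+ 2) = (p y - y) * 2 by lra.
  by rewrite /p; field.
- by rewrite -subr_ge0 pE mulr_ge0//; lra.
(* Since [x <= y], the factor [1 - (y + y ^+ 2) / 2] is at most [1 - x / 2], which gives the
   geometric rate. *)
- rewrite pE [leRHS]exprSr ler_pM//; try lra.
  have : 0 <= y ^+ 2 by exact: sqr_ge0.
  lra.
Qed.

Let cvg_iter_p (x : R) : `|x| <= 1 -> (fun n => iter n p x) @ \oo --> Num.sg x.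
Proof.
have pos (y : R) : 0 < y <= 1 -> (fun n => iter n p y) @ \oo --> (1 : R).
  move=> y01; have /andP[y0 y1] := y01.
  have c0 : (fun n => (1 - y / 2) ^+ n) @ \oo --> (0 : R).
    by apply: cvg_expr; rewrite ger0_norm; lra.
  have c1 : (fun n => 1 - (1 - y / 2) ^+ n) @ \oo --> (1 - 0 : R).
    by apply: cvgB c0; exact: cvg_cst.
  rewrite subr0 in c1.
  apply: (squeeze_cvgr _ c1); last exact: (@cvg_cst _ (1 : R)).
  near=> n; have [_ -> /=] := p_pos n y01; lra.
have pN n (y : R) : iter n p (- y) = - iter n p y.
  by elim: n => //= n ->; rewrite /p; field.
case: (ltrgt0P x) => [x0 x1|x0 x1|-> _].
- by rewrite gtr0_sg//; apply: pos; rewrite x0.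
- rewrite ltr0_sg//; rewrite -[x]opprK.
  under eq_fun do rewrite pN.
  by apply: cvgN; apply: pos; rewrite oppr_gt0 x0.
- rewrite sgr0.
  suff -> : (fun n => iter n p 0) = fun=> 0 :> R by exact: cvg_cst.
  by apply/funext => n; elim: n => //= n ->; rewrite /p; field.
Unshelve. all: by end_near. Qed.

Let iter_p_le1 n (x : R) : `|x| <= 1 -> `|iter n p x| <= 1.
Proof.
move=> x1; elim: n => // n; rewrite iterS; set y := iter n p x => y1.
have : y ^+ 2 <= 1 by rewrite -real_normK ?num_real// expr_le1.
have yy : 0 <= y ^+ 2 by exact: sqr_ge0.
move: y1; rewrite !ler_norml => /andP[y1 y2] y3; apply/andP; split.
  rewrite -subr_ge0 [leRHS](_ : _ = (1 + y) ^+ 2 * (2 - y) / 2); last by rewrite /p; field.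
  by rewrite divr_ge0 ?mulr_ge0 ?sqr_ge0//; lra.
rewrite -subr_ge0 [leRHS](_ : _ = (1 - y) ^+ 2 * (2 + y) / 2); last by rewrite /p; field.
by rewrite divr_ge0 ?mulr_ge0 ?sqr_ge0//; lra.
Qed.

Lemma trig_closure_sg f : trig_closure f -> (forall x, `|f x| <= 1) ->
  trig_closure (fun x => Num.sg (f x)).
Proof.
move=> tf f1.
apply: (@TrigLim (fun n x => iter n p (f x)) _ 1) => [n|n x|x]; last 2 first.
- exact: iter_p_le1.
- exact: cvg_iter_p.
elim: n => //= n IH.
rewrite (_ : (fun x => _) = fun x => 2^-1 *
    (3 * iter n p (f x) - iter n p (f x) * (iter n p (f x) * iter n p (f x)))).
  by apply/TrigScale/trig_closureB; [exact: TrigScale|do 2 apply: trig_closureM => //].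
by apply/funext => x; rewrite /p; field.
Qed.

(** The function [u - b] need not be in the class, but [sin ((u - b) / (n + 1))] is, and at each
    point it has the sign of [u - b] as soon as [n + 1] exceeds [|u - b| / pi]. *)
Lemma trig_closure_sg_sub u b : G u -> trig_closure (fun x => Num.sg (u x - b)).
Proof.
move=> Gu.
have tsin n : trig_closure (fun x => sin (n.+1%:R^-1 * (u x - b))).
  under eq_fun do rewrite mulrBr sinB.
  apply: trig_closureB; apply: trig_closureM; try exact: trig_closure_cst.
    by apply: TrigSin; exact: GZ.
  by apply: TrigCos; exact: GZ.
have sin_small (y : R) : \forall n \near \oo, Num.sg (sin (n.+1%:R^-1 * y)) = Num.sg y.
  have pos (z : R) : 0 < z -> \forall n \near \oo, Num.sg (sin (n.+1%:R^-1 * z)) = 1.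
    move=> z0; near=> n; rewrite gtr0_sg// sin_gt0_pi//.
    rewrite mulr_gt0 ?invr_gt0//=.
    rewrite mulrC ltr_pdivrMr ?ltr0n// mulrC -ltr_pdivrMr ?pi_gt0//.
    apply: (@lt_trans _ _ n%:R); last by rewrite ltr_nat.
    near: n; exact: nbhs_infty_gtr.
  case: (ltrgt0P y) => [y0|y0|->].
  - by rewrite (gtr0_sg y0); exact: pos.
  - rewrite (ltr0_sg y0); near=> n; rewrite -[y]opprK mulrN sinN sgrN.
    by congr (- _); near: n; apply: pos; rewrite oppr_gt0.
  - by near=> n; rewrite mulr0 sin0.
apply: (@TrigLim (fun n x => Num.sg (sin (n.+1%:R^-1 * (u x - b)))) _ 1).
- move=> n; apply: trig_closure_sg => // x.
  by rewrite ler_norml sin_geN1 sin_le1.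
- by move=> n x; rewrite normr_sg; case: (_ != _).
- move=> x; apply/cvgrPdist_lt => e e0.
  near=> n.
  rewrite (_ : Num.sg (sin _) = Num.sg (u x - b)) ?subrr ?normr0//.
  by near: n; exact: sin_small.
Unshelve. all: by end_near. Qed.

(** Products of indicators give finite intersections of complements, and bounded pointwise limits
    give the countable ones. *)
Lemma sigma_algebra_trig_closure :
  sigma_algebra setT [set A | trig_closure (\1_A : T -> R)].
Proof.
split => /=.
- by rewrite indic0; exact: trig_closure_cst.
- move=> A tA; rewrite setTD.
  rewrite (_ : \1_(~` A) = fun x => 1 - (\1_A x : R)).
    by apply: trig_closureB => //; exact: trig_closure1.
  by apply/funext => x; rewrite !indicE in_setC; case: (x \in A) => /=; lra.
move=> F tF.
pose g n : T -> R := \prod_(i < n) (fun x => 1 - \1_(F i) x).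
have gE n x : g n x = \1_(~` \big[setU/set0]_(i < n) F i) x.
  elim: n => [|n IH]; first by rewrite /g !big_ord0 setC0 indicT.
  rewrite /g !big_ord_recr/= -/(g n) fctE IH !indicE in_setC setCU in_setI !in_setC.
  by case: (x \in F n); case: (x \in \big[setU/set0]_(i < n) F i) => /=; lra.
have tg n : trig_closure (g n).
  elim: n => [|n IH]; first by rewrite /g big_ord0; exact: trig_closure1.
  rewrite /g big_ord_recr/= -/(g n).
  by apply: trig_closureM => //; apply: trig_closureB => //; exact: trig_closure1.
rewrite (_ : \1_ _ = fun x => 1 - \1_(~` \bigcup_k F k) x); last first.
  by apply/funext => x; rewrite !indicE in_setC; case: (x \in _) => /=; lra.
apply: trig_closureB; first exact: trig_closure1.
apply: (@TrigLim g _ 1) => // [n x|x].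
  by rewrite gE indicE; case: (_ \in _); rewrite ?normr0 ?normr1.
apply/cvgrPdist_lt => e e0.
suff : \forall n \near \oo,
    ((\bigcup_k F k) x <-> (\big[setU/set0]_(i < n) F i) x).
  apply: filterS => n Fn.
  rewrite gE !indicE !in_setC (_ : (x \in _) = (x \in \big[setU/set0]_(i < n) F i)).
    by rewrite subrr normr0.
  by apply/idP/idP; rewrite !inE => /Fn.
have [[k _ Fk]|nF] := pselect ((\bigcup_k F k) x).
  near=> n; split=> _; last by exists k.
  rewrite -bigcup_mkord; exists k => //=.
  by near: n; exact: nbhs_infty_gt.
by apply: nearW => n; split => // Fx; case: nF; move: Fx;
  rewrite -bigcup_mkord => -[k _ Fk]; exists k.
Unshelve. all: by end_near. Qed.

(* Since [sgn (u - (b - 1/n)) --> 1_{u >= b} - 1_{u < b}]. *)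
Lemma trig_closure_ge u b : G u -> trig_closure (\1_[set x | b <= u x] : T -> R).
Proof.
move=> Gu.
rewrite (_ : \1_ _ = fun x => 2^-1 * (1 + (if b <= u x then 1 else -1))); last first.
  apply/funext => x; rewrite indicE; case: ifPn => [bu|bu].
    by rewrite mem_set//=; field.
  rewrite memNset/=; last exact/negP.
  by rewrite subrr mulr0.
apply/TrigScale/TrigAdd; first exact: trig_closure1.
apply: (@TrigLim (fun n x => Num.sg (u x - (b - n.+1%:R^-1))) _ 1).
- by move=> n; exact: trig_closure_sg_sub.
- by move=> n x; rewrite normr_sg; case: (_ != _).
move=> x; apply/cvgrPdist_lt => e e0.
suff : \forall n \near \oo,
    Num.sg (u x - (b - n.+1%:R^-1)) = if b <= u x then 1 else -1.
  by apply: filterS => n ->; rewrite subrr normr0.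
case: (leP b (u x)) => bu; near=> n.
  by rewrite gtr0_sg// opprB addrCA addrC ltr_wpDl ?subr_ge0 ?invr_gt0.
rewrite ltr0_sg// subr_lt0 ltrBrDr -ltrBrDl.
near: n; have bu0 : 0 < b - u x by rewrite subr_gt0.
exact: (near_infty_natSinv_lt (PosNum bu0)).
Unshelve. all: by end_near. Qed.

Definition sigma_of : set (set T) :=
  <<s \bigcup_(u in G) preimage_set_system setT u measurable >>.

Lemma trig_closure_sigma_of A : sigma_of A -> trig_closure (\1_A : T -> R).
Proof.
suff : sigma_of `<=` [set A | trig_closure (\1_A : T -> R)] by apply.
apply: smallest_sub; first exact: sigma_algebra_trig_closure.
move=> _ [u Gu [B mB <-]]; rewrite setTI /=.
pose S := [set B : set R | trig_closure (\1_(u @^-1` B) : T -> R)].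
have sS : sigma_algebra setT S.
  have [s0 sC sU] := sigma_algebra_trig_closure; split => /=.
  - by rewrite /S /= preimage_set0.
  - by move=> C; rewrite /S /= => /sC /=; rewrite !setTD preimage_setC.
  - by move=> F; rewrite /S /= => /sU; rewrite preimage_bigcup.
suff : measurable `<=` S by apply.
rewrite [X in X `<=` _]RGenCInfty.measurableE.
apply: smallest_sub => // _ [b ->] /=; rewrite /S /=.
rewrite (_ : _ @^-1` _ = [set x | b <= u x]); first exact: trig_closure_ge.
by apply/seteqP; split => x /=; rewrite in_itv/= andbT.
Qed.

End TrigClosure.

Lemma measurable_cos (R : realType) : measurable_fun setT (@cos R).
Proof. by apply: continuous_measurable_fun; exact: continuous_cos. Qed.

Lemma measurable_sin (R : realType) : measurable_fun setT (@sin R).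
Proof. by apply: continuous_measurable_fun; exact: continuous_sin. Qed.

Lemma Rdominated_cvg d (T : measurableType d) (R : realType)
    (mu : {measure set T -> \bar R}) (f_ : nat -> T -> R) (f g : T -> R) :
  (forall n, measurable_fun setT (f_ n)) ->
  (forall x, f_ ^~ x @ \oo --> f x) ->
  mu.-integrable setT (EFin \o g) ->
  (forall n x, `|f_ n x| <= g x) ->
  (fun n => \int[mu]_x f_ n x) @ \oo --> \int[mu]_x f x.
Proof.
move=> mf ff ig fg.
have mlim : measurable_fun setT f by exact: measurable_fun_cvg mf (fun x _ => ff x).
apply: fine_cvg; rewrite /Rintegral fineK; last first.
  apply: integrable_fin_num => //; apply: le_integrable ig => //.
    exact/measurable_EFinP.
  move=> x _; rewrite /= lee_fin (le_trans _ (ler_norm _))//.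
  have /cvg_norm fx := ff x.
  by apply: (cvgr_to_le fx); near=> n; exact: fg.
apply: (@dominated_cvg _ _ _ mu setT _ (fun n x => (f_ n x)%:E) _ (EFin \o g)) => //.
- by move=> n; exact/measurable_EFinP.
- by move=> x _; apply: cvg_EFin; [exact: nearW|exact: ff].
- by move=> n x _; rewrite lee_fin.
Unshelve. all: by end_near. Qed.

Lemma integrable_bounded_mul d (T : measurableType d) (R : realType)
    (mu : {measure set T -> \bar R}) (f h : T -> R) M :
  measurable_fun setT f -> (forall x, `|f x| <= M) ->
  mu.-integrable setT (EFin \o h) ->
  mu.-integrable setT (EFin \o (fun x => f x * h x)).
Proof.
move=> mf fM ih; have /integrableP[/measurable_EFinP mh _] := ih.
apply: (le_integrable measurableT (g := fun x => (M%:E * (h x)%:E)%E)).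
- by apply/measurable_EFinP; exact: measurable_funM.
- move=> x _; rewrite /= lee_fin !normrM ler_wpM2r//.
  exact: le_trans (fM x) (ler_norm _).
- exact: integrableZl.
Qed.

(** * Integrals determined by sine and cosine transforms *)

Section TrigUniqueness.
Variables (R : realType) (T : Type) (G : set (T -> R)).
Variables (d1 d2 : measure_display) (Omega1 : measurableType d1)
  (Omega2 : measurableType d2).
Variables (mu1 : {measure set Omega1 -> \bar R})
  (mu2 : {measure set Omega2 -> \bar R}).
Variables (phi1 : Omega1 -> T) (phi2 : Omega2 -> T).
Variables (h1 : Omega1 -> R) (h2 : Omega2 -> R).
Hypothesis mphi1 : forall u, G u -> measurable_fun setT (fun w => u (phi1 w)).
Hypothesis mphi2 : forall u, G u -> measurable_fun setT (fun w => u (phi2 w)).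
Hypothesis ih1 : mu1.-integrable setT (EFin \o h1).
Hypothesis ih2 : mu2.-integrable setT (EFin \o h2).
Hypothesis eq_cos : forall u, G u ->
  \int[mu1]_w (cos (u (phi1 w)) * h1 w) = \int[mu2]_w (cos (u (phi2 w)) * h2 w).
Hypothesis eq_sin : forall u, G u ->
  \int[mu1]_w (sin (u (phi1 w)) * h1 w) = \int[mu2]_w (sin (u (phi2 w)) * h2 w).

(** The weights let one induction serve three comparisons: weight [1] against the normal density
    identifies one-dimensional laws, weight [1] on both sides gives rotation invariance, and a
    weight [u] against [0] shows that [u] has vanishing integral over events generated by variables
    orthogonal to it. *)
Lemma trig_closure_unique f : trig_closure G f ->
  [/\ measurable_fun setT (fun w => f (phi1 w)),
      measurable_fun setT (fun w => f (phi2 w)) &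
      \int[mu1]_w (f (phi1 w) * h1 w) = \int[mu2]_w (f (phi2 w) * h2 w)].
Proof.
have ib d (Om : measurableType d) (mu : {measure set Om -> \bar R})
    (phi : Om -> T) h g : trig_closure G g ->
    measurable_fun setT (fun w => g (phi w)) ->
    mu.-integrable setT (EFin \o h) ->
    mu.-integrable setT (EFin \o (fun w => g (phi w) * h w)).
  move=> /trig_closure_bounded[M gM] mg ih.
  exact: (integrable_bounded_mul mg (fun w => gM (phi w)) ih).
elim=> [u Gu|u Gu|{}f g tf [mf1 mf2 ef] tg [mg1 mg2 eg]|c {}f tf [mf1 mf2 ef]
       |f_ {}f M tf /all_and3[mf1 mf2 ef] fM ff].
- split; last exact: eq_cos.
  + by apply: measurableT_comp; [exact: measurable_cos|exact: mphi1].
  + by apply: measurableT_comp; [exact: measurable_cos|exact: mphi2].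
- split; last exact: eq_sin.
  + by apply: measurableT_comp; [exact: measurable_sin|exact: mphi1].
  + by apply: measurableT_comp; [exact: measurable_sin|exact: mphi2].
- split; [exact: measurable_funD|exact: measurable_funD|].
  under eq_Rintegral do rewrite mulrDl.
  under [RHS]eq_Rintegral do rewrite mulrDl.
  by rewrite !RintegralD ?ef ?eg//; exact: ib.
- split; [exact: measurable_funM|exact: measurable_funM|].
  under eq_Rintegral do rewrite -mulrA.
  under [RHS]eq_Rintegral do rewrite -mulrA.
  by rewrite !RintegralZl ?ef//; exact: ib.
- have mh1 : measurable_fun setT h1 by apply/measurable_EFinP; case/integrableP: ih1.
  have mh2 : measurable_fun setT h2 by apply/measurable_EFinP; case/integrableP: ih2.
  have lim d (Om : measurableType d) (mu : {measure set Om -> \bar R})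
    (phi : Om -> T) h : (forall n, measurable_fun setT (fun w => f_ n (phi w))) ->
      measurable_fun setT h -> mu.-integrable setT (EFin \o h) ->
      (fun n => \int[mu]_w (f_ n (phi w) * h w)) @ \oo -->
      \int[mu]_w (f (phi w) * h w).
    move=> mf mh ih.
    apply: (@Rdominated_cvg _ _ _ mu _ _ (fun w => M * `|h w|)).
    + by move=> n; exact: measurable_funM.
    + by move=> w; apply: cvgMl; exact: ff.
    + under [X in _.-integrable _ X]eq_fun do rewrite /= EFinM.
      by apply: integrableZl => //; exact: integrable_norm.
    + by move=> n w; rewrite normrM ler_wpM2r.
  split.
  + exact: (measurable_fun_cvg mf1 (fun x _ => ff (phi1 x))).
  + exact: (measurable_fun_cvg mf2 (fun x _ => ff (phi2 x))).
  + have l2 := lim _ _ mu2 phi2 h2 mf2 mh2 ih2.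
    have := lim _ _ mu1 phi1 h1 mf1 mh1 ih1.
    rewrite (funext ef) => l1.
    exact: (cvg_unique (@Rhausdorff R) l1 l2).
Qed.

End TrigUniqueness.

(** * The standard normal distribution *)

Section StandardNormal.
Variable R : realType.
Local Notation leb := (@lebesgue_measure R).
Local Notation w := (normal_pdf (0 : R) 1).
Implicit Types t x : R.

Let k : R := normal_peak 1.
Let k0 : 0 < k. Proof. exact: normal_peak_gt0. Qed.

Lemma std_normal_pdfE x : w x = k * expR (- (x ^+ 2 / 2)).
Proof.
rewrite normal_pdfE ?oner_neq0// /normal_fun subr0 expr1n.
by congr (_ * expR _); rewrite mulNr.
Qed.

Lemma std_normal_pdf_ge0 x : 0 <= w x.
Proof. exact: normal_pdf_ge0. Qed.

Lemma measurable_std_normal_pdf : measurable_fun setT w.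
Proof. exact: measurable_normal_pdf. Qed.

Lemma is_derive_std_normal_pdf x : is_derive x 1 (w : R -> R) (- x * w x).
Proof.
rewrite std_normal_pdfE; have -> : w = k *: (expR \o (fun y => - (y ^+ 2 / 2))).
  by apply/funext => y; rewrite std_normal_pdfE.
apply: is_derive_eq.
by rewrite /GRing.scale /=; field.
Qed.

(** Half of the Gaussian exponent absorbs the factor [2 + x ^+ 2], because [6 (1 + x^2 / 4)]
    dominates it; the other half is a multiple of the normal density of variance [2], hence
    integrable. *)
Let bound x := 6 * k * expR (- (x ^+ 2 / 4)).

Let quadratic_normal_bound x : (2 + x ^+ 2) * w x <= bound x.
Proof.
rewrite std_normal_pdfE /bound.
have -> : - (x ^+ 2 / 2) = - (x ^+ 2 / 4) + - (x ^+ 2 / 4) by field.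
rewrite expRD; set a := expR _.
have a6 : (2 + x ^+ 2) * a <= 6.
  rewrite /a expRN ler_pdivrMr ?expR_gt0//.
  have := expR_ge1Dx (x ^+ 2 / 4); have := sqr_ge0 x; lra.
rewrite (_ : _ * _ = k * a * ((2 + x ^+ 2) * a)); last by ring.
rewrite (_ : 6 * k * a = k * a * 6); last by ring.
by rewrite ler_wpM2l// mulr_ge0 ?expR_ge0// ltW.
Qed.

Let integrable_bound : leb.-integrable setT (EFin \o bound).
Proof.
have s2 : Num.sqrt 2 != 0 :> R by rewrite sqrtr_eq0 -ltNge.
have := @integrable_normal_pdf R 0 (Num.sqrt 2).
move/(integrableZl measurableT (6 * k / normal_peak (Num.sqrt 2))).
apply: eq_integrable => // x _; rewrite /= -EFinM; congr EFin.
rewrite normal_pdfE// /bound mulrA divfK ?gt_eqF ?normal_peak_gt0//.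
rewrite /normal_fun subr0 sqr_sqrtr//; congr (_ * expR _).
by rewrite mulNr; congr (- _); field.
Qed.

Lemma integrable_quadratic_normal (f : R -> R) C : measurable_fun setT f ->
  (forall x, `|f x| <= C * (2 + x ^+ 2)) ->
  leb.-integrable setT (EFin \o (fun x => f x * w x)).
Proof.
move=> mf fC.
apply: (@le_integrable _ _ _ leb setT measurableT _
  (fun x => (C%:E * (bound x)%:E)%E)).
- apply/measurable_EFinP/measurable_funM => //; exact: measurable_std_normal_pdf.
- move=> x _; rewrite /= lee_fin normrM (ger0_norm (std_normal_pdf_ge0 x)).
  have C0 : 0 <= C.
    have := le_trans (normr_ge0 (f 0)) (fC 0).
    by rewrite expr0n/= addr0 pmulr_lge0.
  rewrite [leRHS]ger0_norm ?mulr_ge0 ?expR_ge0 ?(ltW k0)//.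
  apply: (@le_trans _ _ (C * (2 + x ^+ 2) * w x)).
    by rewrite ler_wpM2r ?std_normal_pdf_ge0 ?fC.
  by rewrite -mulrA ler_wpM2l.
- exact: integrableZl.
Qed.

Let cvg_normal_tail : (fun n => (2 + n%:R ^+ 2) * w n%:R) @ \oo --> (0 : R).
Proof.
apply: (@squeeze_cvgr _ _ _ _ (fun=> 0) (fun n => 24 * k / n%:R)); last 2 first.
- exact: cvg_cst.
- rewrite -[X in _ --> X](mulr0 (24 * k)); apply: cvgMr.
  apply/gtr0_cvgV0; last exact: cvgr_idn.
  by near=> n; rewrite ltr0n; near: n; exact: nbhs_infty_gt.
near=> n; apply/andP; split.
  by rewrite mulr_ge0 ?std_normal_pdf_ge0// addr_ge0// sqr_ge0.
apply: (le_trans (quadratic_normal_bound _)).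
have n0 : (0 < n)%N by near: n; exact: nbhs_infty_gt.
have nR1 : 1 <= n%:R :> R by rewrite ler1n.
have nE : n%:R <= 4 * expR (n%:R ^+ 2 / 4) :> R.
  have := expR_ge1Dx (n%:R ^+ 2 / 4 : R).
  have : n%:R <= n%:R ^+ 2 :> R by rewrite expr2 ler_peMl.
  lra.
rewrite /bound expRN ler_pdivlMr ?ltr0n// mulrAC ler_pdivrMr ?expR_gt0//.
have := ler_wpM2l (ltW k0) nE; lra.
Unshelve. all: by end_near. Qed.

(** Integration by parts: [g w - x f w] is the derivative of [f w], and the boundary values at [n]
    and [-n] vanish in the limit because [f] grows at most linearly. It yields both the differential
    equation of the characteristic function and the second moment. *)
Lemma stein (f g : R -> R) C : (forall x, is_derive x 1 f (g x)) ->
  continuous g -> (forall x, `|f x| <= C * (1 + `|x|)) ->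
  (forall x, `|g x| <= C) ->
  \int[leb]_x (g x * w x) = \int[leb]_x (x * f x * w x).
Proof.
move=> df cg fC gC.
have C0 : 0 <= C by exact: le_trans (normr_ge0 _) (gC 0).
have cf : continuous f.
  move=> x; apply: differentiable_continuous; apply/derivable1_diffP.
  by have := df x => ?; exact: ex_derive.
have xx x : `|x| <= 1 + x ^+ 2.
  rewrite -[x ^+ 2]real_normK ?num_real//.
  have := sqr_ge0 (`|x| - 1); have := normr_ge0 x; nra.
have mf : measurable_fun setT f by exact: continuous_measurable_fun.
have mg : measurable_fun setT g by exact: continuous_measurable_fun.
have ig : leb.-integrable setT (EFin \o (fun x => g x * w x)).
  apply: (integrable_quadratic_normal (C := C)) => // x.
  apply: (le_trans (gC x)); have := sqr_ge0 x; nra.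
have mxf : measurable_fun setT (fun x => x * f x) by exact: measurable_funM.
have ixf : leb.-integrable setT (EFin \o (fun x => x * f x * w x)).
  apply: (integrable_quadratic_normal (C := 2 * C)) => // x.
  rewrite normrM; apply: (@le_trans _ _ (`|x| * (C * (1 + `|x|)))).
    by rewrite ler_wpM2l.
  have := xx x; have := real_normK (num_real x); have := normr_ge0 x; nra.
apply/eqP; rewrite -subr_eq0 -RintegralB//; apply/eqP.
set h := fun x => g x * w x - x * f x * w x.
have cw : continuous (w : R -> R) by apply: continuous_normal_pdf; exact: oner_neq0.
have ch : continuous h.
  move=> x; apply: cvgB; apply: cvgM; try exact: cw.
    exact: cg.
  by apply: cvgM; [exact: cvg_id|exact: cf].
have ih : leb.-integrable setT (EFin \o h).
  have := integrableB measurableT ig ixf.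
  by apply: eq_integrable.
have mh : measurable_fun setT h by exact: continuous_measurable_fun.
have dh x : is_derive x 1 (fun y => f y * w y) (h x).
  have ? := df x; have ? := is_derive_std_normal_pdf x.
  apply: (@is_derive_eq _ _ _ (f * (w : R -> R))).
  by rewrite /h /GRing.scale /=; ring.
have lim1 : (fun n => \int[leb]_x (\1_`[- n%:R, n%:R] x * h x)) @ \oo -->
    \int[leb]_x h x.
  apply: (@Rdominated_cvg _ _ _ leb _ _ (fun x => `|h x|)).
  - by move=> n; apply: measurable_funM => //; exact: measurable_indic.
  - move=> x; apply: cvg_near_cst; near=> n.
    rewrite indicE mem_set ?mul1r//= in_itv/= -ler_norml.
    by near: n; exact: nbhs_infty_ger.
  - exact: integrable_norm.
  - move=> n x; rewrite indicE.
    by case: (_ \in _); rewrite ?mul1r ?mul0r// normr0.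
have lim0 : (fun n => \int[leb]_x (\1_`[- n%:R, n%:R] x * h x)) @ \oo --> (0 : R).
  have E n : (0 < n)%N -> \int[leb]_x (\1_`[- n%:R, n%:R] x * h x) =
      f n%:R * w n%:R - f (- n%:R) * w (- n%:R).
    move=> n0.
    have -> : \int[leb]_x (\1_`[- n%:R, n%:R] x * h x) =
        \int[leb]_(x in `[- n%:R, n%:R]) h x.
      rewrite [RHS]Rintegral_mkcond; apply: eq_Rintegral => x _.
      by rewrite patchE indicE; case: (_ \in _); rewrite ?mul1r ?mul0r.
    rewrite /Rintegral (@continuous_FTC2 _ h (fun y => f y * w y)) //=.
    - by rewrite (lt_trans (y := 0))// ?oppr_lt0 ltr0n.
    - exact: continuous_subspaceT.
    - split.
      + by move=> x _; have ? := dh x; exact: ex_derive.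
      + by apply: cvg_at_right_filter; apply: cvgM; [exact: cf|exact: cw].
      + by apply: cvg_at_left_filter; apply: cvgM; [exact: cf|exact: cw].
    - by move=> x _; rewrite derive1E; have ? := dh x; rewrite derive_val.
  apply/cvgrPdist_le => e e0.
  have t0 : (fun n => 2 * C * ((2 + n%:R ^+ 2) * w n%:R)) @ \oo --> (2 * C * 0 : R).
    by apply: cvgMr; exact: cvg_normal_tail.
  rewrite mulr0 in t0.
  move/cvgrPdist_le : t0 => /(_ _ e0) t0.
  near=> n.
  rewrite E; last by near: n; exact: nbhs_infty_gt.
  have : `|0 - 2 * C * ((2 + n%:R ^+ 2) * w n%:R)| <= e by near: n.
  apply: le_trans; rewrite !sub0r !normrN.
  have wN : w (- n%:R) = w n%:R by rewrite !std_normal_pdfE sqrrN.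
  rewrite wN -mulrBl !normrM (ger0_norm (std_normal_pdf_ge0 _)) mulrA.
  rewrite ler_wpM2r ?std_normal_pdf_ge0//.
  apply: (le_trans (ler_normB _ _)).
  have := fC n%:R; have := fC (- n%:R); rewrite normrN !normr_nat => f1 f2.
  have n2 : 0 <= 2 + n%:R ^+ 2 :> R by rewrite addr_ge0 ?sqr_ge0.
  rewrite (ger0_norm n2) (ger0_norm C0).
  have nn := xx n%:R; rewrite normr_nat in nn.
  have := ler_wpM2l C0 nn; lra.
exact: (cvg_unique (@Rhausdorff R) lim1 lim0).
Unshelve. all: by end_near. Qed.

End StandardNormal.

Section StandardNormalMoments.
Variable R : realType.
Local Notation leb := (@lebesgue_measure R).
Local Notation w := (normal_pdf (0 : R) 1).
Implicit Types t x : R.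

Lemma Rintegral_std_normal_pdf : \int[leb]_x w x = 1.
Proof. by rewrite /Rintegral integral_normal_pdf. Qed.

(** As a function of [t] the integral [F] satisfies [F' = - t F], by differentiation under the
    integral and Stein's identity for the sine; hence [F t * expR (t ^+ 2 / 2)] is constant. The
    phase [th] handles cosine and sine together, the latter through [th = - pi / 2]. *)
Lemma normal_cos_shift t th :
  \int[leb]_x (cos (t * x + th) * w x) = cos th * expR (- (t ^+ 2 / 2)).
Proof.
pose F t := \int[leb]_x (cos (t * x + th) * w x).
have icos s : leb.-integrable setT (EFin \o (fun x => cos (s * x + th) * w x)).
  apply: (@integrable_quadratic_normal _ _ 1) => [|x].
    apply: measurableT_comp; first exact: measurable_cos.
    by apply: measurable_funD => //; exact: mulrl_measurable.
  have : `|cos (s * x + th)| <= 1 by rewrite ler_norml cos_geN1 cos_le1.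
  have := sqr_ge0 x; lra.
pose f t x := cos (t * x + th) * w x.
have df (s x : R) : is_derive s (1 : R) (f ^~ x : R -> R) (- (x * sin (s * x + th) * w x)).
  apply: (@is_derive_eq _ _ _ (fun t : R => cos (t * x + th) * w x : R)).
  by rewrite /GRing.scale /=; ring.
have F'E (s : R) : derivable (F : R -> R^o) s 1 /\ derive1 F s = - s * F s.
  have I : `]s - 1, s + 1[%classic s by rewrite /= in_itv/=; apply/andP; split; lra.
  have der (x y : R) : `]s - 1, s + 1[%classic x -> setT y -> derivable (f ^~ y) x 1.
    by move=> _ _; have ? := df x y; exact: ex_derive.
  have iG : leb.-integrable setT (EFin \o (fun x => `|x| * w x)).
    apply: (@integrable_quadratic_normal _ _ 1) => [|x].
      exact: normr_measurable.
    rewrite normr_id -[x ^+ 2]real_normK ?num_real//.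
    have := sqr_ge0 (`|x| - 1); have := normr_ge0 x; lra.
  have G0 y : 0 <= `|y| * w y by rewrite mulr_ge0// std_normal_pdf_ge0.
  have Gub (x y : R) : `]s - 1, s + 1[%classic x -> setT y ->
      `|partial1of2 f x y| <= `|y| * w y.
    move=> _ _; rewrite partial1of2E; have ? := df x y; rewrite derive_val.
    rewrite normrN !normrM (ger0_norm (std_normal_pdf_ge0 y)).
    rewrite ler_wpM2r ?std_normal_pdf_ge0// ler_piMr//.
    by rewrite ler_norml sin_geN1 sin_le1.
  split.
    exact: (derivable_under_integral measurableT I (fun x _ => icos x) der G0 iG Gub).
  rewrite (differentiation_under_integral measurableT I (fun x _ => icos x) der G0 iG Gub).
  have -> : \int[leb]_y partial1of2 f s y = - (\int[leb]_x (x * sin (s * x + th) * w x)).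
    have isin : leb.-integrable setT (EFin \o (fun x => x * sin (s * x + th) * w x)).
      apply: le_integrable iG => //.
        apply/measurable_EFinP/measurable_funM; last exact: measurable_std_normal_pdf.
        apply: measurable_funM => //.
        apply: measurableT_comp; first exact: measurable_sin.
        by apply: measurable_funD => //; exact: mulrl_measurable.
      move=> x _; rewrite /= lee_fin [leRHS]ger0_norm//.
      rewrite !normrM (ger0_norm (std_normal_pdf_ge0 x)).
      rewrite ler_wpM2r ?std_normal_pdf_ge0// ler_piMr//.
      by rewrite ler_norml sin_geN1 sin_le1.
    rewrite -mulN1r -RintegralZl//; apply: eq_Rintegral => x _.
    by rewrite partial1of2E; have ? := df s x; rewrite derive_val mulN1r.
  rewrite mulNr -RintegralZl//; congr (- _).
  under [RHS]eq_Rintegral do rewrite mulrA.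
  symmetry; apply: (@stein _ (fun x => sin (s * x + th)) _ (1 + `|s|)).
  - move=> x; apply: is_derive_eq.
    by rewrite /GRing.scale /=; ring.
  - move=> x; apply: cvgM; first exact: cvg_cst.
    apply: continuous_comp; last exact: continuous_cos.
    by apply: cvgD; [apply: cvgM; [exact: cvg_cst|exact: cvg_id]|exact: cvg_cst].
  - move=> x; have : `|sin (s * x + th)| <= 1 by rewrite ler_norml sin_geN1 sin_le1.
    have := normr_ge0 s; have := normr_ge0 x => x0 s0.
    have := mulr_ge0 s0 x0; lra.
  - move=> x; rewrite normrM.
    have c1 : `|cos (s * x + th)| <= 1 by rewrite ler_norml cos_geN1 cos_le1.
    have := ler_wpM2l (normr_ge0 s) c1; lra.
have cst0 (s : R) : is_derive s (1 : R) (fun t : R => F t * expR (t ^+ 2 / 2) : R) 0.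
  have [dF FE] := F'E s.
  have ? : is_derive s 1 F (- s * F s).
    by apply: DeriveDef => //; rewrite -FE derive1E.
  apply: is_derive_eq.
  by rewrite /GRing.scale /=; field.
have F0 : F 0 = cos th.
  rewrite -[RHS]mulr1 -Rintegral_std_normal_pdf -RintegralZl//; last first.
    exact: integrable_normal_pdf.
  by apply: eq_Rintegral => x _; rewrite mul0r add0r.
have := @is_derive_0_is_cst R _ t 0 cst0.
rewrite F0 expr0n/= mul0r expR0 mulr1 expRN => <-.
by rewrite mulfK// gt_eqF// expR_gt0.
Qed.

Lemma normal_cos t : \int[leb]_x (cos (t * x) * w x) = expR (- (t ^+ 2 / 2)).
Proof.
have := normal_cos_shift t 0; rewrite cos0 mul1r => <-.
by apply: eq_Rintegral => x _; rewrite addr0.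
Qed.

Lemma normal_sin t : \int[leb]_x (sin (t * x) * w x) = 0.
Proof.
have := normal_cos_shift t (- (pi / 2)).
rewrite cosN cos_pihalf mul0r => E; rewrite -[RHS]E; apply: eq_Rintegral => x _.
by rewrite cosD cosN sinN cos_pihalf sin_pihalf mulr0 add0r mulrN opprK mulr1.
Qed.

Lemma normal_sqr : \int[leb]_x (x ^+ 2 * w x) = 1.
Proof.
transitivity (\int[leb]_x (1 * w x)); last first.
  by under eq_Rintegral do rewrite mul1r; exact: Rintegral_std_normal_pdf.
rewrite (@stein R (fun x => x) (fun=> 1) 1).
- by apply: eq_Rintegral => x _; rewrite expr2.
- by move=> x; exact: cvg_cst.
- by move=> x; rewrite mul1r lerDr.
- by move=> x; rewrite normr1.
Qed.

(** The Radon-Nikodym derivative of [normal_prob] and the explicit density have equal integrals over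
    all measurable sets, so they agree almost everywhere. *)
Lemma integral_normal_prob (f : R -> R) : measurable_fun setT f ->
  (forall x, 0 <= f x) ->
  (\int[normal_prob (0 : R) 1]_x (f x)%:E = \int[leb]_x (f x * w x)%:E)%E.
Proof.
move=> mf f0.
have dom := @normal_prob_dominates R 0 1.
rewrite -(Radon_Nikodym_SigmaFinite.change_of_variables dom (f := EFin \o f))//;
  last exact/measurable_EFinP.
have mw : measurable_fun setT (fun x => (w x)%:E).
  by apply/measurable_EFinP; exact: measurable_std_normal_pdf.
have iR := Radon_Nikodym_SigmaFinite.f_integrable dom.
have mR := measurable_int _ iR.
apply: ae_eq_integral => //.
- by apply: emeasurable_funM => //; exact/measurable_EFinP.
- apply/measurable_EFinP/measurable_funM => //; exact: measurable_std_normal_pdf.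
- under [X in ae_eq _ _ _ X]eq_fun do rewrite EFinM.
  apply: ae_eqe_mul2l; apply: integral_ae_eq => // A _ mA.
  by rewrite -Radon_Nikodym_SigmaFinite.f_integral.
Qed.

Lemma normal_prob_sqr : (\int[normal_prob (0 : R) 1]_x (x ^+ 2)%:E = 1)%E.
Proof.
rewrite integral_normal_prob//; last by move=> x; exact: sqr_ge0.
transitivity (\int[leb]_x (x ^+ 2 * w x))%:E; last by rewrite normal_sqr.
rewrite /Rintegral fineK//.
apply: integrable_fin_num => //.
apply: (@integrable_quadratic_normal _ _ 1) => // x.
by rewrite ger0_norm ?sqr_ge0// mul1r lerDr.
Qed.

(** Since [1/2 - 2/5 = 1/10], the tilted integrand is [Num.sqrt 5] times the normal density of
    variance [5]. *)
Lemma normal_prob_expR_sqr :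
  (\int[normal_prob (0 : R) 1]_x (expR (2 / 5 * x ^+ 2))%:E = (Num.sqrt 5)%:E)%E.
Proof.
have s5 : Num.sqrt 5 != 0 :> R by rewrite sqrtr_eq0 -ltNge.
rewrite integral_normal_prob//; last first.
  by apply: measurableT_comp => //; apply: measurable_funM.
have E x : expR (2 / 5 * x ^+ 2) * w x = Num.sqrt 5 * normal_pdf 0 (Num.sqrt 5) x.
  rewrite std_normal_pdfE normal_pdfE// /normal_fun subr0 sqr_sqrtr//.
  rewrite mulrCA -expRD [RHS]mulrA; congr (_ * expR _); last by field.
  rewrite /normal_peak expr1n sqr_sqrtr// mul1r -mulrnAr sqrtrM//.
  by rewrite invfM mulrA divff// mul1r.
under eq_integral do rewrite E EFinM.
rewrite integralZl//; last exact: integrable_normal_pdf.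
by rewrite integral_normal_pdf mule1.
Qed.

End StandardNormalMoments.

(** * Centred Gaussian variables *)

Section CentredGaussian.
Context {d : measure_display} {Omega : measurableType d} {R : realType}.
Variable mu : probability Omega R.
Implicit Types (Z : Omega -> R) (v : R).

(** The characteristic function is split into real and imaginary parts so that it is exactly the
    data on which [trig_closure_unique] operates. *)
Definition centred_gaussian Z v : Prop :=
  [/\ measurable_fun setT Z, 0 <= v &
      forall t : R, \int[mu]_w cos (t * Z w) = expR (- (v * t ^+ 2 / 2)) /\
                    \int[mu]_w sin (t * Z w) = 0].

Lemma integrable_bounded_prob (f : Omega -> R) M : measurable_fun setT f ->
  (forall x, `|f x| <= M) -> mu.-integrable setT (EFin \o f).
Proof.
move=> mf fM; apply: (@le_integrable _ _ _ mu setT measurableT _ (cst M%:E)).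
- exact/measurable_EFinP.
- by move=> x _; rewrite /= lee_fin (le_trans (fM x))// ler_norm.
- exact: finite_measure_integrable_cst.
Qed.

(** The shift [m] is read off the characteristic function; that it is the expectation follows only
    later, from [centred_gaussian_mean]. *)
Lemma real_gaussian_centred (Y : Omega -> R) : real_gaussian mu Y ->
  exists m v : R, centred_gaussian (fun w => Y w - m) v.
Proof.
move=> [mY [m [s chY]]]; exists m, (s ^+ 2).
have C t : \int[mu]_w cos (t * Y w) = expR (- (s ^+ 2 * t ^+ 2 / 2)) * cos (t * m) /\
    \int[mu]_w sin (t * Y w) = expR (- (s ^+ 2 * t ^+ 2 / 2)) * sin (t * m).
  have := chY t; rewrite /char_fun /cexp.
  have -> : ('i%C * (t * m)%:C%C - (s ^+ 2 * t ^+ 2 / 2)%:C%C =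
      (- (s ^+ 2 * t ^+ 2 / 2)) +i* (t * m))%C.
    by apply/eqP; rewrite eq_complex /= !(mul0r, mul1r, mulr0, subr0, sub0r, addr0, add0r, oppr0) !eqxx.
  by case=> -> ->.
have mt t : measurable_fun setT (fun w => t * Y w).
  by apply: measurableT_comp => //; exact: mulrl_measurable.
have mc t : measurable_fun setT (fun w => cos (t * Y w)).
  by apply: measurableT_comp; [exact: measurable_cos|exact: mt].
have ms t : measurable_fun setT (fun w => sin (t * Y w)).
  by apply: measurableT_comp; [exact: measurable_sin|exact: mt].
have ic t c : mu.-integrable setT (EFin \o (fun w => c * cos (t * Y w))).
  apply: (integrable_bounded_prob (M := `|c|)) => [|w]; first exact: measurable_funM.
  by rewrite normrM ler_piMr// ler_norml cos_geN1 cos_le1.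
have isn t c : mu.-integrable setT (EFin \o (fun w => c * sin (t * Y w))).
  apply: (integrable_bounded_prob (M := `|c|)) => [|w]; first exact: measurable_funM.
  by rewrite normrM ler_piMr// ler_norml sin_geN1 sin_le1.
have ic1 t : mu.-integrable setT (EFin \o (fun w => cos (t * Y w))).
  by have := ic t 1; under eq_fun do rewrite mul1r.
have isn1 t : mu.-integrable setT (EFin \o (fun w => sin (t * Y w))).
  by have := isn t 1; under eq_fun do rewrite mul1r.
split; [exact: measurable_funB|exact: sqr_ge0|move=> t; split].
  transitivity (\int[mu]_w (cos (t * m) * cos (t * Y w) + sin (t * m) * sin (t * Y w))).
    by apply: eq_Rintegral => w _; rewrite mulrBr cosB; ring.
  rewrite RintegralD ?RintegralZl//.
  have [-> ->] := C t; rewrite -[RHS]mulr1 -(cos2Dsin2 (t * m)); ring.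
transitivity (\int[mu]_w (cos (t * m) * sin (t * Y w) - sin (t * m) * cos (t * Y w))).
  by apply: eq_Rintegral => w _; rewrite mulrBr sinB; ring.
rewrite RintegralB ?RintegralZl//.
by have [-> ->] := C t; ring.
Qed.

Section Law.
Variables (Z : Omega -> R) (v : R).
Hypothesis Zv : centred_gaussian Z v.

Let mZ : measurable_fun setT Z. Proof. by case: Zv. Qed.
Let v0 : 0 <= v. Proof. by case: Zv. Qed.

(** The law of [Z] is compared with that of [Num.sqrt v] times a standard normal, with the linear
    forms on the line as class [G]. This form includes [v = 0], where a density would not exist. *)
Lemma centred_gaussian_set (A : set R) : measurable A ->
  mu (Z @^-1` A) = normal_prob (0 : R) 1 ((fun x => Num.sqrt v * x) @^-1` A).
Proof.
move=> mA.
pose G : set (R -> R) := [set (fun x => t * x) | t in setT].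
have G0 : G (fun=> 0) by exists 0 => //; apply/funext => x; rewrite mul0r.
have GB u1 u2 : G u1 -> G u2 -> G (fun x => u1 x - u2 x).
  by move=> [s _ <-] [t _ <-]; exists (s - t) => //; apply/funext => x; rewrite mulrBl.
have GZ c u : G u -> G (fun x => c * u x).
  by move=> [s _ <-]; exists (c * s) => //; apply/funext => x; rewrite mulrA.
have tA : trig_closure G (\1_A : R -> R).
  apply: trig_closure_sigma_of => //; apply: sub_sigma_algebra.
  exists (fun x => x); first by exists 1 => //; apply/funext => x; rewrite mul1r.
  by exists A => //; rewrite setTI.
have i1 : mu.-integrable setT (EFin \o (fun=> 1)).
  exact: finite_measure_integrable_cst.
have iw := @integrable_normal_pdf R 0 1.
have := @trig_closure_unique R R G _ _ Omega _ mu (@lebesgue_measure R)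
  Z (fun x => Num.sqrt v * x) (fun=> 1) (normal_pdf 0 1) _ _ i1 iw _ _ _ tA.
case.
- by move=> _ [t _ <-]; exact: measurable_funM.
- by move=> _ [t _ <-]; exact: measurable_funM.
- move=> _ [t _ <-]; under eq_Rintegral do rewrite mulr1.
  under [RHS]eq_Rintegral do rewrite mulrA.
  rewrite normal_cos; have [_ _ /(_ t)[-> _]] := Zv.
  by rewrite exprMn sqr_sqrtr// (mulrC v).
- move=> _ [t _ <-]; under eq_Rintegral do rewrite mulr1.
  under [RHS]eq_Rintegral do rewrite mulrA.
  by rewrite normal_sin; have [_ _ /(_ t)[_ ->]] := Zv.
move=> _ _.
have mZA : measurable (Z @^-1` A) by rewrite -[X in measurable X]setTI; exact: mZ.
have msA : measurable ((fun x => Num.sqrt v * x) @^-1` A).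
  by rewrite -[X in measurable X]setTI; apply: mulrl_measurable.
under eq_Rintegral do rewrite mulr1.
rewrite (_ : \int[mu]_w _ = fine (mu (Z @^-1` A))); last first.
  rewrite /Rintegral; congr fine; rewrite -[in RHS](setIT (Z @^-1` A)) -integral_indic//.
rewrite (_ : \int[lebesgue_measure]_w _ =
    fine (normal_prob 0 1 ((fun x => Num.sqrt v * x) @^-1` A))); last first.
  rewrite /Rintegral /normal_prob; congr fine; rewrite [RHS]integral_mkcond.
  apply: eq_integral => x _; rewrite patchE indicE /=.
  rewrite (_ : (x \in _) = (Num.sqrt v * x \in A)); last first.
    by apply/idP/idP; rewrite !inE.
  by case: ifP => _; rewrite ?mul1r ?mul0r.
move=> E.
rewrite -[LHS]fineK ?fin_num_measure// -[RHS]fineK ?fin_num_measure//.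
by rewrite E.
Qed.

Lemma centred_gaussian_integral (k : R -> R) : measurable_fun setT k ->
  (forall x, 0 <= k x) ->
  (\int[mu]_w (k (Z w))%:E = \int[normal_prob (0 : R) 1]_x (k (Num.sqrt v * x))%:E)%E.
Proof.
move=> mk k0.
have ms : measurable_fun [set: measurableTypeR R] (fun x => Num.sqrt v * x).
  exact: mulrl_measurable.
have mk' : measurable_fun setT (EFin \o k) by exact/measurable_EFinP.
have k0' : {in setT, forall y, 0 <= (EFin \o k) y}%E by move=> y _; rewrite lee_fin.
transitivity (\int[pushforward mu Z]_y (EFin \o k) y)%E.
  by rewrite (ge0_integral_pushforward mZ).
rewrite -[RHS](ge0_integral_pushforward ms (normal_prob (0 : R) 1) measurableT mk' k0').
apply: eq_measure_integral => A mA _.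
exact: centred_gaussian_set.
Qed.

Lemma centred_gaussian_sqr : (\int[mu]_w (Z w ^+ 2)%:E = v%:E)%E.
Proof.
rewrite (@centred_gaussian_integral (fun x => x ^+ 2))//; last by move=> x; exact: sqr_ge0.
under eq_integral do rewrite exprMn sqr_sqrtr// EFinM.
rewrite ge0_integralZl//= ?normal_prob_sqr ?mule1//.
- by apply/measurable_EFinP; exact: measurable_funX.
- by move=> x _; rewrite lee_fin sqr_ge0.
Qed.

Lemma integrable_centred_gaussian_sqr :
  mu.-integrable setT (EFin \o (fun w => Z w ^+ 2)).
Proof.
apply/integrableP; split; first by apply/measurable_EFinP; exact: measurable_funX.
under eq_integral do rewrite /= ger0_norm ?sqr_ge0//.
by rewrite centred_gaussian_sqr ltry.
Qed.

Lemma integrable_centred_gaussian : mu.-integrable setT (EFin \o Z).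
Proof.
apply: (@le_integrable _ _ _ mu setT measurableT _
  (fun w => 1%:E + (Z w ^+ 2)%:E)%E).
- exact/measurable_EFinP.
- move=> w _; rewrite /= lee_fin [leRHS]ger0_norm ?addr_ge0 ?sqr_ge0//.
  rewrite -[_ ^+ 2]real_normK ?num_real//.
  have := sqr_ge0 (`|Z w| - 1); have := normr_ge0 (Z w); nra.
- apply: integrableD => //; first exact: finite_measure_integrable_cst.
  exact: integrable_centred_gaussian_sqr.
Qed.

Lemma centred_gaussian_opp : centred_gaussian (fun w => - Z w) v.
Proof.
split=> //; first exact: measurable_funN.
move=> t; have [_ _ /(_ (- t))[c s]] := Zv.
rewrite sqrrN in c.
by split; [rewrite -[RHS]c|rewrite -[RHS]s]; apply: eq_Rintegral => w _;
  rewrite mulrN mulNr.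
Qed.

End Law.

(** [Z] and [- Z] have the same law, so their positive parts have equal integrals. Positive parts
    are used because [centred_gaussian_integral] is about nonnegative functions. *)
Lemma centred_gaussian_mean Z v : centred_gaussian Z v -> \int[mu]_w Z w = 0.
Proof.
move=> Zv; have [mZ _ _] := Zv.
pose k (x : R) := Num.max x 0.
have mk : measurable_fun setT k by apply: measurable_maxr => //; exact: measurable_id.
have k0 x : 0 <= k x by rewrite le_max lexx orbT.
have := centred_gaussian_integral Zv mk k0.
rewrite -(centred_gaussian_integral (centred_gaussian_opp Zv) mk k0) => E.
have ik (Z' : Omega -> R) : centred_gaussian Z' v ->
    mu.-integrable setT (EFin \o (fun w => k (Z' w))).
  move=> Zv'; have iZ := integrable_centred_gaussian Zv'.
  apply: le_integrable iZ => //.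
    by apply/measurable_EFinP; apply: measurableT_comp => //; case: Zv'.
  move=> w _; rewrite /= lee_fin ger0_norm// /k ge_max ler_norm/=.
  exact: normr_ge0.
transitivity (\int[mu]_w (k (Z w) - k (- Z w))).
  apply: eq_Rintegral => w _; rewrite /k.
  by case: (leP 0 (Z w)) => z0; rewrite /Num.max/=; do 2 case: ltP => //=; lra.
rewrite RintegralB//; [|exact: ik|exact/ik/centred_gaussian_opp].
by rewrite /Rintegral E subrr.
Qed.

Lemma centred_gaussian_expR_sqr Z : centred_gaussian Z 1 ->
  (\int[mu]_w (expR (2 / 5 * Z w ^+ 2))%:E = (Num.sqrt 5)%:E)%E.
Proof.
move=> Zv; rewrite -normal_prob_expR_sqr.
rewrite (centred_gaussian_integral Zv (k := fun x => expR (2 / 5 * x ^+ 2))).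
- by apply: eq_integral => x _; rewrite sqrtr1 mul1r.
- by apply: measurableT_comp => //; apply: measurable_funM.
- by move=> x; exact: expR_ge0.
Qed.

End CentredGaussian.

(** * Norming functionals *)

Section HahnBanach.
Context {R : realType} {E : normedModType R}.
Implicit Types (p q : E -> R) (x y : E).

Definition sublinear p : Prop :=
  (forall x y, p (x + y) <= p x + p y) /\
  (forall (t : R) x, 0 <= t -> p (t *: x) <= t * p x).

Section SublinearTheory.
Variable p : E -> R.
Hypothesis sp : sublinear p.

Lemma sublinear0 : p 0 = 0.
Proof.
have [pD pZ] := sp; apply/eqP; rewrite eq_le; apply/andP; split.
  by have := pZ 0 0 (lexx _); rewrite scale0r mul0r.
by have := pD 0 0; rewrite addr0; lra.
Qed.

Lemma sublinearZ (t : R) x : 0 <= t -> p (t *: x) = t * p x.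
Proof.
have [pD pZ] := sp; rewrite le_eqVlt => /predU1P[<-|t0].
  by rewrite scale0r mul0r sublinear0.
apply/eqP; rewrite eq_le pZ ?(ltW t0)//=.
have t1 : 0 <= t^-1 by rewrite invr_ge0 ltW.
have := pZ t^-1 (t *: x) t1.
by rewrite scalerA mulVf ?gt_eqF// scale1r ler_pdivlMl.
Qed.

Lemma sublinearN x : - p (- x) <= p x.
Proof. by have [pD _] := sp; have := pD x (- x); rewrite subrr sublinear0; lra. Qed.

(* [sublinear_cut y] is a sublinear functional below [p] which is additionally
   at most [- p y] at [- y]; hence a minimal [p] is odd. *)
Definition sublinear_cut y x : R :=
  inf [set p (x + t *: y) - t * p y | t in [set t | 0 <= t]].

Let lb y x : lbound [set p (x + t *: y) - t * p y | t in [set t | 0 <= t]] (- p (- x)).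
Proof.
move=> _ [t t0 <-]; have [pD _] := sp.
have := pD (x + t *: y) (- x).
rewrite addrAC subrr add0r sublinearZ//; lra.
Qed.

Lemma sublinear_cut_le y x (t : R) : 0 <= t ->
  sublinear_cut y x <= p (x + t *: y) - t * p y.
Proof. by move=> t0; apply: ge_inf; [exists (- p (- x)); exact: lb|exists t]. Qed.

Lemma sublinear_cut_ge y x (c : R) :
  (forall t, 0 <= t -> c <= p (x + t *: y) - t * p y) -> c <= sublinear_cut y x.
Proof.
move=> H; apply: lb_le_inf; first by exists (p (x + 0 *: y) - 0 * p y); exists 0 => /=.
by move=> _ [t t0 <-]; exact: H.
Qed.

Lemma sublinear_cut_le0 y x : sublinear_cut y x <= p x.
Proof. by have := @sublinear_cut_le y x 0 (lexx _); rewrite scale0r addr0 mul0r subr0. Qed.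

Lemma sublinear_cutN y : sublinear_cut y (- y) <= - p y.
Proof. by have := @sublinear_cut_le y (- y) 1 ler01; rewrite scale1r addNr sublinear0 mul1r sub0r. Qed.

Lemma sublinear_cut_sublinear y : sublinear (sublinear_cut y).
Proof.
have [pD pZ] := sp; split=> [x x'|c x c0].
  rewrite -lerBlDr; apply: sublinear_cut_ge => t t0.
  rewrite lerBlDr [leRHS]addrC -lerBlDr; apply: sublinear_cut_ge => s s0.
  rewrite lerBlDr; apply: (le_trans (sublinear_cut_le _ _ (addr_ge0 t0 s0))).
  rewrite scalerDl addrACA; have := pD (x + t *: y) (x' + s *: y).
  lra.
move: c0; rewrite le_eqVlt => /predU1P[<-|c0].
  by rewrite scale0r mul0r (le_trans (sublinear_cut_le0 _ _))// sublinear0.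
rewrite -ler_pdivrMl//; apply: sublinear_cut_ge => t t0.
rewrite ler_pdivrMl//.
apply: (le_trans (sublinear_cut_le _ _ (mulr_ge0 (ltW c0) t0))).
by rewrite -scalerA -scalerDr sublinearZ ?(ltW c0)// -mulrA -mulrBr.
Qed.

End SublinearTheory.

(** A minimal sublinear functional below [p] is linear: it coincides with each of its cuts, hence is
    odd, and subadditivity at opposite points turns into additivity. Minimality comes from Zorn's
    lemma, a chain being bounded by its pointwise infimum. *)
Lemma hahn_banach p : sublinear p -> exists f : E -> R,
  linear (f : E -> R^o) /\ forall x, f x <= p x.
Proof.
move=> sp.
pose T := {q : E -> R | sublinear q /\ forall x, q x <= p x}.
(* The order is reversed, so that the maximal element given by Zorn's lemma is a minimal
   functional. *)
pose rT (q q' : T) := `[< forall x, sval q' x <= sval q x >].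
have [||||[f [sf fp]] fmin] := @Zorn T rT.
- by move=> q; apply/asboolP.
- move=> q1 q2 q3 /asboolP h12 /asboolP h23; apply/asboolP => x.
  exact: le_trans (h23 x) (h12 x).
- move=> [q1 h1] [q2 h2] /asboolP /= h12 /asboolP /= h21; apply: eq_exist.
  by apply/funext => x; apply/eqP; rewrite eq_le h12 h21.
- move=> A Atot.
  have [A0|/set0P[q0 Aq0]] := eqVneq A set0.
    by exists (exist _ p (conj sp (fun x => lexx (p x)))) => s; rewrite A0.
  pose r x := inf [set sval q x | q in A].
  have rlb x : lbound [set sval q x | q in A] (- p (- x)).
    move=> _ [[q [sq qp]] _ <-] /=.
    by apply: le_trans (sublinearN sq x); rewrite lerN2.
  have rle (q : T) x : A q -> r x <= sval q x.
    by move=> Aq; apply: ge_inf; [exists (- p (- x))|exists q].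
  have rge c x : (forall q : T, A q -> c <= sval q x) -> c <= r x.
    move=> H; apply: lb_le_inf; first by exists (sval q0 x); exists q0.
    by move=> _ [q Aq <-]; exact: H.
  have sr : sublinear r.
    split=> [x y|t x t0].
      rewrite -lerBlDr; apply: (rge _ _) => q1 Aq1.
      rewrite lerBlDr [leRHS]addrC -lerBlDr; apply: (rge _ _) => q2 Aq2.
      rewrite lerBlDr.
      (* Subadditivity of the smaller of the two members of the chain gives a bound by the sum of
         both. *)
      have [/asboolP q12|/asboolP q12] := Atot _ _ Aq1 Aq2.
        apply: (le_trans (rle _ _ Aq2)); case: (svalP q2) => -[qD _] _.
        by apply: (le_trans (qD x y)); rewrite addrC lerD2l.
      apply: (le_trans (rle _ _ Aq1)); case: (svalP q1) => -[qD _] _.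
      by apply: (le_trans (qD x y)); rewrite addrC lerD2r.
    move: t0; rewrite le_eqVlt => /predU1P[<-|t0].
      rewrite scale0r mul0r; apply: (le_trans (rle _ _ Aq0)).
      by case: (svalP q0) => sq0 _; rewrite sublinear0.
    rewrite -ler_pdivrMl//; apply: (rge _ _) => q Aq.
    rewrite ler_pdivrMl//; apply: (le_trans (rle _ _ Aq)).
    by case: (svalP q) => -[_ qZ] _; exact/qZ/ltW.
  have rp x : r x <= p x.
    by apply: (le_trans (rle _ _ Aq0)); case: (svalP q0).
  exists (exist _ r (conj sr rp)) => q Aq; apply/asboolP => x /=; exact: rle.
have fodd y : f (- y) = - f y.
  have sq := sublinear_cut_sublinear sf y.
  have qp x : sublinear_cut f y x <= p x.
    exact: le_trans (sublinear_cut_le0 sf y x) (fp x).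
  have /(congr1 sval)/= cutE : exist _ _ (conj sq qp) = exist _ f (conj sf fp) :> T.
    by apply: fmin; apply/asboolP => x /=; exact: sublinear_cut_le0.
  apply/eqP; rewrite eq_le; apply/andP; split.
    by rewrite -[in leLHS]cutE; exact: sublinear_cutN.
  by rewrite lerNl; exact: sublinearN.
have [fD fZ] := sf.
exists f; split=> // a x y.
have fA u v : f (u + v) = f u + f v.
  apply/eqP; rewrite eq_le fD/= -lerN2 opprD -!fodd opprD; exact: fD.
rewrite fA; congr (_ + _).
have [a0|a0] := leP 0 a; first by rewrite (sublinearZ sf).
have -> : a *: x = - ((- a) *: x) by rewrite scaleNr opprK.
by rewrite fodd (sublinearZ sf) ?oppr_ge0 ?(ltW a0)// mulNr opprK.
Qed.

Definition mk_dual (h : E -> R^o) (lin : linear h) (ch : continuous h) : dual E :=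
  Dual (dual_fun := HB.pack h (GRing.isLinear.Build R E R^o *:%R h lin)) ch.

(** Hahn-Banach is applied to the cut of the norm at [x] instead of the norm itself: being below the
    cut forces [f (- x) <= - |x|], so the value at [x] is prescribed without extending from a
    line. *)
Lemma norming_functional x : exists f : dual E,
  (forall y, `|f y : R| <= `|y|) /\ f x = `|x|.
Proof.
pose p (y : E) : R := `|y|.
have sp : sublinear p.
  by split=> [u v|t u t0]; [exact: ler_normD|rewrite /p normrZ ger0_norm].
have [f [lf fp]] := hahn_banach (sublinear_cut_sublinear sp x).
have fle y : f y <= `|y| by exact: le_trans (fp y) (sublinear_cut_le0 sp x y).
pose F : {linear E -> R^o} := HB.pack f (GRing.isLinear.Build R E R^o *:%R f lf).
have fN y : f (- y) = - f y := linearN F y.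
have fB u v : f (u - v) = f u - f v := linearB F u v.
have fnorm y : `|f y| <= `|y|.
  rewrite ler_norml fle andbT lerNl -fN; apply: (le_trans (fle _)).
  by rewrite normrN.
have cf : continuous (f : E -> R^o).
  move=> y; apply/cvgrPdist_lt => e e0; near=> z.
  rewrite -fB; apply: (le_lt_trans (fnorm _)).
  by near: z; exact: cvgr_dist_lt.
exists (mk_dual lf cf); split=> //=.
apply/eqP; rewrite eq_le fle -[leRHS]opprK -fN lerNr /=.
exact: le_trans (fp _) (sublinear_cutN sp x).
Unshelve. all: by end_near. Qed.

Lemma dual_normP (f : dual E) : (dual_norm f <= 1)%E ->
  forall x, `|f x : R| <= `|x|.
Proof.
move=> f1 x; have [->|x0] := eqVneq x 0; first by rewrite linear0 normr0.
have nx : 0 < `|x| by rewrite normr_gt0.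
have : ((`|f (`|x|^-1 *: x) : R|)%:E <= dual_norm f)%E.
  apply: ereal_sup_ubound; exists (`|x|^-1 *: x) => //=.
  by rewrite normrZ normfV normr_id mulVf// gt_eqF.
move=> /le_trans/(_ f1); rewrite lee_fin linearZ/= normrZ normfV normr_id.
by rewrite ler_pdivrMl// mulr1.
Qed.

Lemma dual_norm_le1 (f : dual E) : (forall x, `|f x : R| <= `|x|) ->
  (dual_norm f <= 1)%E.
Proof.
move=> f1; apply: ge_ereal_sup => _ [x /= x1 <-].
by rewrite lee_fin (le_trans (f1 x)).
Qed.

Lemma dual_bounded (f : dual E) : exists C : R, forall x, `|f x : R| <= C * `|x|.
Proof.
have /continuous_linear_bounded/linear_boundedP := @dual_continuous _ _ f 0.
by move=> [M [_ MP]]; exists (M + 1) => x; apply: MP; rewrite ltrDl.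
Qed.

Lemma dense_sequence : separable E -> exists g : nat -> E,
  forall x (r : R), 0 < r -> exists k, `|x - g k| < r.
Proof.
move=> [D [/countable_injP[f finj] dD]].
(* Indices that are not attained by the injection [f] get the default value [0]. *)
exists (fun k => xget 0 [set x | D x /\ f x = k]) => x r r0.
have [| |y [xy Dy]] := dD (ball x r); [by exists x; exact: ballxx|exact: ball_open|].
exists (f y); rewrite (_ : xget _ _ = y); first by rewrite -ball_normE in xy.
case: xgetP => [z -> [Dz fz]|/(_ y) []//].
by apply: finj; rewrite ?inE.
Qed.

Lemma norming_sequence : separable E -> exists F : nat -> dual E,
  (forall k x, `|F k x : R| <= `|x|) /\
  (forall x (r : R), r < `|x| -> exists k, r < F k x).
Proof.
move=> /dense_sequence[g gP].
have [F FP] := choice (fun k => norming_functional (g k)).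
exists F; split=> [k x|x r rx]; first by have [] := FP k.
(* Half of the gap, because replacing [x] by [g k] costs this error twice: once in the norm and once
   in the functional. *)
have e0 : 0 < (`|x| - r) / 2 by lra.
have [k xgk] := gP x _ e0; exists k.
have [Fk1 Fk2] := FP k.
have -> : x = g k + (x - g k) by rewrite addrC subrK.
rewrite linearD Fk2.
have : `|F k (x - g k) : R| <= `|x - g k| by exact: Fk1.
rewrite ler_norml => /andP[h _].
have := ler_normD (g k) (x - g k); rewrite addrC subrK.
lra.
Qed.

End HahnBanach.

(** * Bochner integrals and functionals *)

Section WeakMeasurability.
Context {d : measure_display} {T : measurableType d} {R : realType}.
Context {E : normedModType R}.
Implicit Types Y : T -> E.

Lemma borel_measurable_continuous Y (g : E -> R) :
  borel_measurable measurable Y -> continuous g ->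
  measurable_fun setT (fun w => g (Y w)).
Proof.
move=> mY cg; apply: (measurability _ (RGenOInfty.measurableE R)).
move=> _ [_ [a ->] <-]; rewrite setTI.
have oU : open (g @^-1` `]a, +oo[%classic).
  by apply: open_comp => [x _|]; [exact: cg|exact: interval_open].
exact: mY oU.
Qed.

Lemma borel_measurable_dual Y (f : dual E) : borel_measurable measurable Y ->
  measurable_fun setT (fun w => f (Y w) : R).
Proof. by move=> mY; apply: borel_measurable_continuous mY _; exact: dual_continuous. Qed.

Lemma borel_measurable_normB Y (x : E) : borel_measurable measurable Y ->
  measurable_fun setT (fun w => `|Y w - x|).
Proof.
move=> mY; apply: (@borel_measurable_continuous _ (fun y => `|y - x|)) => //.
move=> y; apply: cvg_norm; apply: cvgB; [exact: cvg_id|exact: cvg_cst].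
Qed.

Lemma borel_measurable_norm Y : borel_measurable measurable Y ->
  measurable_fun setT (fun w => `|Y w|).
Proof.
by move=> mY; apply: (borel_measurable_continuous mY); exact: norm_continuous.
Qed.

Hypothesis sepE : separable E.

(** The argument of Pettis: a closed ball is a countable intersection of half-spaces given by a
    norming sequence, and an open set is a countable union of closed balls with centres in a dense
    sequence and radii [1 / (m + 1)]. *)
Lemma weakly_measurable_borel Y :
  (forall f : dual E, measurable_fun setT (fun w => f (Y w) : R)) ->
  borel_measurable measurable Y.
Proof.
move=> mY U oU.
have [F [F1 FP]] := norming_sequence sepE.
have [g gP] := dense_sequence sepE.
have mB x (r : R) : measurable (Y @^-1` [set y | `|y - x| <= r]).
  rewrite (_ : _ @^-1` _ = \bigcap_k [set w | F k (Y w) <= r + F k x]).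
    apply: bigcapT_measurable => k.
    rewrite (_ : mkset _ = (fun w => F k (Y w)) @^-1` `]-oo, r + F k x]%classic).
      by rewrite -[X in measurable X]setTI; exact: mY.
    by apply/seteqP; split => w /=; rewrite in_itv.
  apply/seteqP; split => [w /= wr k _ /=|w /= wr].
    rewrite -lerBlDr -linearB; apply: le_trans wr.
    exact: le_trans (ler_norm _) (F1 k _).
  rewrite leNgt; apply/negP => /FP[k]; rewrite linearB/=.
  by have := wr k Logic.I; rewrite /=; lra.
pose P := [set p : nat * nat | [set y | `|y - g p.1| <= p.2.+1%:R^-1] `<=` U].
rewrite (_ : Y @^-1` U = \bigcup_(p in P) (Y @^-1` [set y | `|y - g p.1| <= p.2.+1%:R^-1])).
  rewrite bigcup_mkcond; apply: countable_bigcupT_measurable => // p.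
  by case: ifP => _; [exact: mB|exact: measurable0].
apply/seteqP; split => [w /= Uw|w [p /= Pp]]; last exact: Pp.
have /nbhs_ballP[r /= r0 rU] : nbhs (Y w) U by exact: open_nbhs_nbhs.
have r2 : 0 < r / 2 by rewrite divr_gt0.
have [m _ mr] := near_infty_natSinv_lt (PosNum r2).
have {}mr : m.+1%:R^-1 < r / 2 by have := mr m (leqnn _).
have m0 : 0 < m.+1%:R^-1 :> R by rewrite invr_gt0 ltr0n.
have [k gk] := gP (Y w) _ m0.
exists (k, m) => /=; last exact: ltW.
move=> y /= yg; apply: rU; rewrite -ball_normE /=.
have := ler_normD (Y w - g k) (g k - y); rewrite addrA subrK (distrC (g k) y).
move=> /le_lt_trans; apply; rewrite (splitr r) ltrD//.
  exact: lt_trans gk mr.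
exact: le_lt_trans yg mr.
Qed.

End WeakMeasurability.

Section BochnerTheory.
Context {d : measure_display} {Omega : measurableType d} {R : realType}.
Context {E : completeNormedModType R}.
Variable mu : probability Omega R.
Hypothesis sepE : separable E.
Implicit Types (Y s : Omega -> E).

Lemma vsimple_dual s (f : dual E) : vsimple s ->
  [/\ measurable_fun setT (fun w => f (s w) : R),
      mu.-integrable setT (EFin \o (fun w => f (s w) : R)) &
      f (vsintegral mu s) = \int[mu]_w (f (s w) : R)].
Proof.
move=> [fs ms].
pose r : seq E := fset_set (range s).
pose h v w : R := f v * \1_(s @^-1` [set v]) w.
have fE w : f (s w) = \sum_(v <- r) h v w :> R.
  have sr : s w \in r.
    by rewrite -[_ \in r]/(s w \in fset_set (range s)) in_fset_set// mem_set//; exists w.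
  rewrite (big_rem (s w))//= big_seq big1 ?addr0; last first.
    move=> v; rewrite mem_rem_uniq ?fset_uniq// => /andP[/= /eqP vs _].
    by rewrite /h indicE memNset ?mulr0//=; exact: nesym.
  by rewrite /h indicE mem_set ?mulr1.
have mh v : measurable_fun setT (h v).
  by apply: measurable_funM => //; exact: measurable_indic.
have ih v : mu.-integrable setT (EFin \o h v).
  apply: (@integrable_bounded_prob _ _ _ mu _ `|f v|) => // w.
  rewrite /h normrM ler_piMr// indicE.
  by case: (_ \in _); rewrite ?normr1 ?normr0.
have mf : measurable_fun setT (fun w => f (s w) : R).
  by under eq_fun do rewrite fE; exact: measurable_sum.
split => //.
  apply: (@eq_integrable _ _ _ mu setT measurableT (fun w => \sum_(v <- r) (h v w)%:E)%E).
    by move=> w _; rewrite /= fE sumEFin.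
  apply: (@integrable_sum _ _ _ mu setT measurableT _ r xpredT (fun v w => (h v w)%:E)) => v _; exact: ih.
rewrite /vsintegral fsbig_finite//= linear_sum /=.
rewrite /Rintegral; under eq_integral do rewrite fE -sumEFin.
rewrite integral_sum// -sum_fine; last first.
  by move=> v _; exact: (integrable_fin_num _ (ih v)).
apply: eq_bigr => v _; rewrite linearZ /=.
rewrite /h; under eq_integral do rewrite EFinM.
rewrite integralZl//; last first.
  by apply: integrable_indic.
by rewrite integral_indic// setIT fineM ?fin_num_measure//= mulrC.
Qed.

Lemma vsimple_borel s : vsimple s -> borel_measurable measurable s.
Proof.
by move=> ss; apply: (weakly_measurable_borel sepE) => f; case: (vsimple_dual f ss).
Qed.

Lemma borel_measurableB Y1 Y2 : borel_measurable measurable Y1 ->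
  borel_measurable measurable Y2 ->
  borel_measurable measurable (fun w => Y1 w - Y2 w).
Proof.
move=> m1 m2; apply: (weakly_measurable_borel sepE) => f.
by under eq_fun do rewrite linearB; apply: measurable_funB; exact: borel_measurable_dual.
Qed.

Lemma vsimple_integrable_norm s : vsimple s ->
  mu.-integrable setT (fun w => `|s w|%:E).
Proof.
move=> ss; have [fs _] := ss.
pose M := \sum_(v <- fset_set (range s)) `|v|.
apply: (@integrable_bounded_prob _ _ _ mu _ M).
  exact/borel_measurable_norm/vsimple_borel.
move=> w; rewrite normr_id /M.
have sr : s w \in fset_set (range s) by rewrite in_fset_set// mem_set//; exists w.
by rewrite (big_rem (s w))//= lerDl sumr_ge0.
Qed.

Lemma bochner_integrable_norm Y : bochner_integrable mu Y ->
  borel_measurable measurable Y /\ mu.-integrable setT (fun w => `|Y w|%:E).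
Proof.
move=> [mY [s [ss s0]]]; split=> //.
have [N sN] : exists N, (\int[mu]_w (`|Y w - s N w|)%:E < +oo)%E.
  have /fine_cvgP[[N _ /(_ N (leqnn N)) sN] _] := s0.
  by exists N; move: sN; rewrite fin_numElt => /andP[].
have mN : measurable_fun setT (fun w => `|Y w - s N w|).
  exact/borel_measurable_norm/borel_measurableB/vsimple_borel.
apply: (@le_integrable _ _ _ mu setT measurableT _
   ((fun w => `|Y w - s N w|%:E) \+ (fun w => `|s N w|%:E))%E).
- by apply/measurable_EFinP; exact: borel_measurable_norm.
- move=> w _; rewrite /= lee_fin normr_id ger0_norm ?addr_ge0//.
  by rewrite -{1}[Y w](subrK (s N w)) ler_normD.
- apply: integrableD => //; last exact: vsimple_integrable_norm.
  apply/integrableP; split; first exact/measurable_EFinP.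
  by under eq_integral do rewrite /= normr_id.
Qed.

Lemma integrable_dual Y (f : dual E) : borel_measurable measurable Y ->
  mu.-integrable setT (fun w => `|Y w|%:E) ->
  mu.-integrable setT (EFin \o (fun w => f (Y w) : R)).
Proof.
move=> mY iY; have [C fC] := dual_bounded f.
apply: (@le_integrable _ _ _ mu setT measurableT _ (fun w => C%:E * `|Y w|%:E)%E).
- by apply/measurable_EFinP; exact: borel_measurable_dual.
- by move=> w _; rewrite /= lee_fin (le_trans (fC _))// ler_norm.
- exact: integrableZl.
Qed.

(** [s n w] is a point nearest to [Y w] among [0] and the first [n] terms of a dense sequence.
    Starting from [0] ensures [|Y w - s n w| <= |Y w|], the domination needed for convergence of the
    integrals. *)
Lemma bochner_approx_exists Y : borel_measurable measurable Y ->
  mu.-integrable setT (fun w => `|Y w|%:E) -> exists a, bochner_approx mu Y a.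
Proof.
move=> mY iY; have [g gP] := dense_sequence sepE.
pose s := fix s n (w : Omega) : E := if n is n'.+1 then
  if `|Y w - g n'| < `|Y w - s n' w| then g n' else s n' w else 0 : E.
have sS n w : `|Y w - s n.+1 w| = Num.min `|Y w - g n| `|Y w - s n w|.
  by rewrite /Order.min /=; case: ifP.
have mn n : measurable_fun setT (fun w => `|Y w - s n w|).
  elim: n => [|n IH]; first exact: (borel_measurable_normB 0 mY).
  under eq_fun do rewrite sS.
  by apply: measurable_minr => //; exact: borel_measurable_normB.
have ss n : vsimple (s n).
  elim: n => [|n [fn msn]].
    split; first by apply: (@sub_finite_set _ _ [set 0]) => // _ [w _ <-].
    move=> v; have [->|v0] := eqVneq v 0.
      by rewrite (_ : _ @^-1` _ = setT)//; apply/seteqP; split.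
    rewrite (_ : _ @^-1` _ = set0)//; apply/seteqP; split => // w /= v00.
    by rewrite v00 eqxx in v0.
  pose A := [set w | `|Y w - g n| < `|Y w - s n w|].
  have mA : measurable A.
    rewrite -[A]setTI; apply: measurable_fun_ltr => //.
    exact: borel_measurable_normB.
  split.
    apply: (@sub_finite_set _ _ ([set g n] `|` range (s n))).
      by move=> _ [w _ <-] /=; case: ifP => _; [left|right; exists w].
    by rewrite finite_setU.
  move=> v.
  have -> : s n.+1 @^-1` [set v] = (A `&` [set w | g n = v]) `|` (~` A `&` s n @^-1` [set v]).
    apply/seteqP; split => w /=; rewrite /A /=.
      by case: ifP => h <-; [left|right].
    by case=> -[h <-]; [rewrite h|move/negP: h => /negbTE ->].
  apply: measurableU; apply: measurableI => //; last exact: measurableC.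
  have [->|gv] := eqVneq (g n) v.
    by rewrite (_ : mkset _ = setT)//; apply/seteqP; split.
  rewrite (_ : mkset _ = set0)//; apply/seteqP; split => // w /= h.
  by rewrite h eqxx in gv.
have sle n w : `|Y w - s n w| <= `|Y w|.
  elim: n => [|n IH]; first by rewrite subr0.
  by rewrite sS ge_min IH orbT.
have sdec w k m : (k < m)%N -> `|Y w - s m w| <= `|Y w - g k|.
  elim: m => // m IH; rewrite ltnS leq_eqVlt => /predU1P[->|km].
    by rewrite sS ge_min lexx.
  by rewrite sS ge_min IH ?orbT.
exists s; split => //.
rewrite -[X in _ --> X](integral0 mu setT).
apply: (@dominated_cvg _ _ _ mu setT _ (fun n w => `|Y w - s n w|%:E) _
  (fun w => `|Y w|%:E)) => //.
- by move=> n; exact/measurable_EFinP.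
- move=> w _; apply: cvg_EFin; first exact: nearW.
  apply/cvgrPdist_lt => e e0; have [k gk] := gP (Y w) e e0.
  near=> n; rewrite sub0r normrN /= normr_id (le_lt_trans _ gk)// sdec//.
  by near: n; exact: nbhs_infty_gt.
- by move=> n w _; rewrite /= lee_fin normr_id.
Unshelve. all: by end_near. Qed.

Section Approximation.
Variables (Y : Omega -> E) (s : nat -> Omega -> E).
Hypothesis mY : borel_measurable measurable Y.
Hypothesis iY : mu.-integrable setT (fun w => `|Y w|%:E).
Hypothesis sY : bochner_approx mu Y s.

Lemma dual_vsintegral_dist (f : dual E) C n : (forall x, `|f x : R| <= C * `|x|) ->
  `|\int[mu]_w (f (Y w) : R) - f (vsintegral mu (s n)) : R| <=
    C * \int[mu]_w `|Y w - s n w|.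
Proof.
move=> fC; have [ss _] := sY.
have mn : measurable_fun setT (fun w => `|Y w - s n w|).
  exact/borel_measurable_norm/borel_measurableB/vsimple_borel.
have iYs : mu.-integrable setT (fun w => `|Y w - s n w|%:E).
  apply: (@le_integrable _ _ _ mu setT measurableT _
     ((fun w => `|Y w|%:E) \+ (fun w => `|s n w|%:E))%E).
  - exact/measurable_EFinP.
  - by move=> w _; rewrite /= lee_fin normr_id [leRHS]ger0_norm ?addr_ge0// ler_normB.
  - by apply: integrableD => //; exact: vsimple_integrable_norm.
have [mf If ->] := vsimple_dual f (ss n).
rewrite -RintegralB//; last exact: integrable_dual.
have iB : mu.-integrable setT (EFin \o (fun w => f (Y w - s n w) : R)).
  by apply: integrable_dual => //; exact/borel_measurableB/vsimple_borel.
under eq_Rintegral do rewrite -linearB.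
apply: (le_trans (le_normr_Rintegral _ iB)) => //.
rewrite -RintegralZl//; apply: le_Rintegral => //.
- exact: integrable_norm.
- under [X in _.-integrable _ X]eq_fun do rewrite /= EFinM.
  exact: integrableZl.
Qed.

Let cvg0 : (fun n => \int[mu]_w `|Y w - s n w|) @ \oo --> (0 : R).
Proof. by have [_ s0] := sY; exact: (fine_cvg s0). Qed.

Lemma dual_bochner_approx (f : dual E) :
  (fun n => f (vsintegral mu (s n)) : R) @ \oo --> \int[mu]_w (f (Y w) : R).
Proof.
have [C fC] := dual_bounded f.
have c0 : (fun n => C * \int[mu]_w `|Y w - s n w|) @ \oo --> (0 : R).
  by rewrite -[X in _ --> X](mulr0 C); apply: cvgMr.
apply/cvgrPdist_le => e e0.
move/cvgrPdist_le : c0 => /(_ e e0); apply: filterS => n.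
rewrite sub0r normrN => h; apply: (le_trans (dual_vsintegral_dist n fC)).
exact: le_trans (ler_norm _) h.
Qed.

(** Testing with a functional that norms the difference of two of these integrals reduces the Cauchy
    property to scalar estimates. *)
Lemma cvg_vsintegral : cvgn (fun n => vsintegral mu (s n)).
Proof.
apply/cauchy_cvgP/cauchyP => e e0.
have e2 : 0 < e / 2 by rewrite divr_gt0.
move/cvgrPdist_lt : cvg0 => /(_ _ e2)[N _ sN].
exists (vsintegral mu (s N)); exists N => // n /= Nn.
have small m : (N <= m)%N -> \int[mu]_w `|Y w - s m w| < e / 2.
  by move=> /sN /=; rewrite sub0r normrN; apply: le_lt_trans; exact: ler_norm.
rewrite -ball_normE /=.
have [f [f1 <-]] := norming_functional (vsintegral mu (s N) - vsintegral mu (s n)).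
have f1' x : `|f x : R| <= 1 * `|x| by rewrite mul1r.
have := dual_vsintegral_dist N f1'; have := dual_vsintegral_dist n f1'.
rewrite linearB !mul1r !ler_norml => /andP[h1 h2] /andP[h3 h4].
have := small N (leqnn N); have := small n Nn; rewrite /=; lra.
Qed.

End Approximation.

Lemma is_bochner_integral_exists Y : borel_measurable measurable Y ->
  mu.-integrable setT (fun w => `|Y w|%:E) ->
  exists v, is_bochner_integral mu Y v.
Proof.
move=> mY iY; have [s sY] := bochner_approx_exists mY iY.
have /cvg_ex[v sv] := cvg_vsintegral mY iY sY.
by exists v; split=> //; exists s.
Qed.

Lemma dual_bochner Y (f : dual E) : borel_measurable measurable Y ->
  mu.-integrable setT (fun w => `|Y w|%:E) ->
  f (bochner mu Y) = \int[mu]_w (f (Y w) : R) :> R.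
Proof.
(* Whatever value [xget] selects, its image under [f] is a limit of scalar integrals that converge
   to the right-hand side; the default case contradicts existence. *)
move=> mY iY; rewrite /bochner; case: xgetP => [v _ [_ [s sY sv]]|noint].
  have l1 := dual_bochner_approx mY iY sY (f := f).
  have l2 : (fun n => f (vsintegral mu (s n)) : R) @ \oo --> (f v : R).
    by apply: (cvg_comp _ _ sv); exact: dual_continuous.
  exact: (cvg_unique (@Rhausdorff R) l2 l1).
by have [v /noint] := is_bochner_integral_exists mY iY.
Qed.

End BochnerTheory.

(** * Square integrability of Gaussian vectors *)

Section Product.
Context {d1 d2 : measure_display} {T1 : measurableType d1} {T2 : measurableType d2}.
Context {R : realType}.
Variables (mu1 : probability T1 R) (mu2 : probability T2 R).

Lemma Rfubini (f : T1 * T2 -> R) M : measurable_fun setT f ->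
  (forall z, `|f z| <= M) ->
  \int[(mu1 \x mu2)%E]_z f z = \int[mu1]_x \int[mu2]_y f (x, y).
Proof.
move=> mf fM.
have If : (mu1 \x mu2)%E.-integrable setT (EFin \o f).
  exact: (@integrable_bounded_prob _ _ _ (mu1 \x mu2)%E _ M).
rewrite /Rintegral -integral12_prod_meas1//; congr fine.
apply: eq_integral => x _; rewrite /fubini_F /= fineK//.
apply: integrable_fin_num => //.
apply: (@integrable_bounded_prob _ _ _ mu2 (fun y => f (x, y)) M) => //.
exact: measurableT_comp.
Qed.

Lemma centred_gaussian_prod (X1 : T1 -> R) (X2 : T2 -> R) v1 v2 :
  centred_gaussian mu1 X1 v1 -> centred_gaussian mu2 X2 v2 ->
  centred_gaussian (mu1 \x mu2)%E (fun w => X1 w.1 + X2 w.2) (v1 + v2).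
Proof.
move=> [m1 v10 c1] [m2 v20 c2].
have m12 : measurable_fun setT (fun w : T1 * T2 => X1 w.1 + X2 w.2).
  by apply: measurable_funD; exact: measurableT_comp.
split=> // [|t]; first exact: addr_ge0.
have mt : measurable_fun setT (fun w : T1 * T2 => t * (X1 w.1 + X2 w.2)).
  exact: measurable_funM.
have mtr d (T : measurableType d) (X : T -> R) : measurable_fun setT X ->
    measurable_fun setT (fun x => cos (t * X x)) /\
    measurable_fun setT (fun x => sin (t * X x)).
  move=> mX; split.
    by apply: measurableT_comp; [exact: measurable_cos|exact: measurable_funM].
  by apply: measurableT_comp; [exact: measurable_sin|exact: measurable_funM].
have itr d (T : measurableType d) (mu : probability T R) (X : T -> R) c :
    measurable_fun setT X ->
    mu.-integrable setT (EFin \o (fun x => c * cos (t * X x))) /\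
    mu.-integrable setT (EFin \o (fun x => c * sin (t * X x))).
  move=> /mtr[mc ms].
  split; apply: (@integrable_bounded_prob _ _ _ mu _ `|c|) => [|x].
  - exact: measurable_funM.
  - by rewrite normrM ler_piMr// ler_norml cos_geN1 cos_le1.
  - exact: measurable_funM.
  - by rewrite normrM ler_piMr// ler_norml sin_geN1 sin_le1.
have i1 d (T : measurableType d) (mu : probability T R) (X : T -> R) :
    measurable_fun setT X ->
    mu.-integrable setT (EFin \o (fun x => cos (t * X x))) /\
    mu.-integrable setT (EFin \o (fun x => sin (t * X x))).
  move=> /(@itr _ _ mu _ 1)[]; split.
    by under eq_fun do rewrite -[cos _]mul1r.
  by under eq_fun do rewrite -[sin _]mul1r.
have [ic2 is2] := i1 _ _ mu2 _ m2; have [ic1 is1] := i1 _ _ mu1 _ m1.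
have [C1 S1] := c1 t; have [C2 S2] := c2 t.
split.
  rewrite (@Rfubini _ 1); last 2 first.
  - by apply: measurableT_comp; [exact: measurable_cos|].
  - by move=> z; rewrite ler_norml cos_geN1 cos_le1.
  transitivity (\int[mu1]_x (cos (t * X1 x) * expR (- (v2 * t ^+ 2 / 2)))).
    apply: eq_Rintegral => x _ /=.
    transitivity (\int[mu2]_y (cos (t * X1 x) * cos (t * X2 y) -
                               sin (t * X1 x) * sin (t * X2 y))).
      by apply: eq_Rintegral => y _; rewrite mulrDr cosD.
    rewrite RintegralB//; [|by case: (itr _ _ mu2 _ (cos (t * X1 x)) m2)
                           |by case: (itr _ _ mu2 _ (sin (t * X1 x)) m2)].
    by rewrite !RintegralZl// C2 S2 mulr0 subr0.
  rewrite RintegralZr// C1 -expRD; congr expR; lra.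
rewrite (@Rfubini _ 1); last 2 first.
- by apply: measurableT_comp; [exact: measurable_sin|].
- by move=> z; rewrite ler_norml sin_geN1 sin_le1.
transitivity (\int[mu1]_x (sin (t * X1 x) * expR (- (v2 * t ^+ 2 / 2)))).
  apply: eq_Rintegral => x _ /=.
  transitivity (\int[mu2]_y (sin (t * X1 x) * cos (t * X2 y) +
                             cos (t * X1 x) * sin (t * X2 y))).
    by apply: eq_Rintegral => y _; rewrite mulrDr sinD.
  rewrite RintegralD//; [|by case: (itr _ _ mu2 _ (sin (t * X1 x)) m2)
                         |by case: (itr _ _ mu2 _ (cos (t * X1 x)) m2)].
  by rewrite !RintegralZl// C2 S2 mulr0 addr0.
by rewrite RintegralZr// S1 mul0r.
Qed.

End Product.

Section DualOperations.
Context {R : realType} {E : normedModType R}.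

Lemma dual_comb (a b : R) (f g : dual E) :
  exists h : dual E, forall x, h x = a * f x + b * g x :> R.
Proof.
pose k (x : E) : R^o := a * f x + b * g x.
have lk : linear k.
  have lP (h : dual E) c x y : h (c *: x + y) = c * h x + h y :> R by rewrite linearP.
  move=> c x y; rewrite /k !lP -[RHS]/(c * (a * f x + b * g x) + (a * f y + b * g y) : R).
  ring.
have ck : continuous k.
  by move=> x; apply: cvgD; apply: cvgMr; exact: dual_continuous.
by exists (mk_dual lk ck).
Qed.

Lemma dual0 : exists h : dual E, forall x, h x = 0 :> R.
Proof.
pose k (x : E) : R^o := 0.
have lk : linear k by move=> c x y; rewrite /k scaler0 addr0.
have ck : continuous k by move=> x; exact: cvg_cst.
by exists (mk_dual lk ck).
Qed.

End DualOperations.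

(** The continuous functionals on the product space, in coordinates. *)
Definition dual_sums (R : realType) (E : normedModType R) : set (E * E -> R) :=
  [set u | exists f g : dual E, u = fun z => (f z.1 : R) + g z.2].

(** * Rotation invariance of two independent centred copies *)

Section Rotation.
Context {d : measure_display} {Omega : measurableType d} {R : realType}.
Context {E : completeNormedModType R}.
Variable mu : probability Omega R.
Variable Z : Omega -> E.
Hypothesis mZ : borel_measurable measurable Z.
Hypothesis gZ : forall f : dual E, exists v, centred_gaussian mu (fun w => f (Z w) : R) v.

Let P : probability (Omega * Omega)%type R := (mu \x mu)%E.
Let c : R := (Num.sqrt 2)^-1.
Let cc : c * c = 2^-1.
Proof. by rewrite /c -invfM -expr2 sqr_sqrtr. Qed.

Let phi1 (w : Omega * Omega) : E * E := (Z w.1, Z w.2).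
Let phi2 (w : Omega * Omega) : E * E :=
  (c *: (Z w.1 - Z w.2), c *: (Z w.1 + Z w.2)).

Local Notation G := (@dual_sums R E).

Let G0 : G (fun=> 0).
Proof. by have [h h0] := @dual0 R E; exists h, h; apply/funext => z; rewrite !h0 addr0. Qed.

Let GB u1 u2 : G u1 -> G u2 -> G (fun x => u1 x - u2 x).
Proof.
move=> [f1 [g1 ->]] [f2 [g2 ->]].
have [f fE] := dual_comb 1 (-1) f1 f2; have [g gE] := dual_comb 1 (-1) g1 g2.
by exists f, g; apply/funext => z; rewrite fE gE; ring.
Qed.

Let GZ t u : G u -> G (fun x => t * u x).
Proof.
move=> [f1 [g1 ->]].
have [f fE] := dual_comb t 0 f1 f1; have [g gE] := dual_comb t 0 g1 g1.
by exists f, g; apply/funext => z; rewrite fE gE; ring.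
Qed.

Let mfst (f : dual E) : measurable_fun setT (fun w : Omega * Omega => f (Z w.1) : R).
Proof.
by apply: (@measurableT_comp _ _ _ _ _ _ (fun x => f (Z x) : R) _ fst) => //;
  exact: borel_measurable_dual.
Qed.

Let msnd (f : dual E) : measurable_fun setT (fun w : Omega * Omega => f (Z w.2) : R).
Proof.
by apply: (@measurableT_comp _ _ _ _ _ _ (fun x => f (Z x) : R) _ snd) => //;
  exact: borel_measurable_dual.
Qed.

Let mphi1 u : G u -> measurable_fun setT (fun w => u (phi1 w)).
Proof. by move=> [f [g ->]]; apply: measurable_funD. Qed.

Let phi2E (f g : dual E) : exists f' g' : dual E,
  (forall w, (f (phi2 w).1 : R) + g (phi2 w).2 = (f' (Z w.1) : R) + g' (Z w.2)) /\
  (forall x, (f' x : R) ^+ 2 + (g' x : R) ^+ 2 = (f x : R) ^+ 2 + (g x : R) ^+ 2).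
Proof.
have [f' fE] := dual_comb c c f g; have [g' gE] := dual_comb (- c) c f g.
exists f', g'; split=> [w|x].
  by rewrite /phi2 /= !linearZ/= linearB linearD/= fE gE /GRing.scale/=; ring.
rewrite fE gE (_ : _ + _ = (c * c) * 2 * ((f x : R) ^+ 2 + (g x : R) ^+ 2)).
  by rewrite cc mulVf// mul1r.
ring.
Qed.

Let mphi2 u : G u -> measurable_fun setT (fun w => u (phi2 w)).
Proof.
move=> [f [g ->]]; have [f' [g' [E1 _]]] := phi2E f g.
by under eq_fun do rewrite E1; apply: measurable_funD.
Qed.

(** The transform of [f (Z w.1) + g (Z w.2)] depends only on the sum of the variances of [f (Z)] and
    [g (Z)]. Rotation replaces [f], [g] by [f'], [g'] with the same pointwise sum of squares, so
    integrating that identity shows that the variance sum is preserved. *)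
Lemma rotation_invariance (A : set (E * E)) : sigma_of G A ->
  [/\ measurable (phi1 @^-1` A), measurable (phi2 @^-1` A) &
    P (phi1 @^-1` A) = P (phi2 @^-1` A)].
Proof.
move=> /(trig_closure_sigma_of G0 GB GZ) tA.
have i1 : P.-integrable setT (EFin \o (fun=> 1)).
  exact: finite_measure_integrable_cst.
have char u : G u -> \int[P]_w cos (u (phi1 w)) = \int[P]_w cos (u (phi2 w)) /\
    \int[P]_w sin (u (phi1 w)) = \int[P]_w sin (u (phi2 w)).
  move=> [f [g ->]]; have [f' [g' [E1 E2]]] := phi2E f g.
  have [v1 c1] := gZ f; have [v2 c2] := gZ g.
  have [v1' c1'] := gZ f'; have [v2' c2'] := gZ g'.
  have vE : v1' + v2' = v1 + v2.
    have sqrE (h : dual E) v : centred_gaussian mu (fun w => h (Z w) : R) v ->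
        mu.-integrable setT (EFin \o (fun w => (h (Z w) : R) ^+ 2)) /\
        v = \int[mu]_w ((h (Z w) : R) ^+ 2).
      move=> ch; split; first exact: integrable_centred_gaussian_sqr ch.
      by rewrite /Rintegral (centred_gaussian_sqr ch).
    have [I1 ->] := sqrE _ _ c1; have [I2 ->] := sqrE _ _ c2.
    have [I1' ->] := sqrE _ _ c1'; have [I2' ->] := sqrE _ _ c2'.
    rewrite -!RintegralD//; apply: eq_Rintegral => w _; exact: E2.
  have [_ _ /(_ 1)[C S]] := centred_gaussian_prod c1 c2.
  have [_ _ /(_ 1)[C' S']] := centred_gaussian_prod c1' c2'.
  split.
    under [RHS]eq_Rintegral do rewrite E1.
    under eq_Rintegral do rewrite -[_ + _]mul1r.
    by under [RHS]eq_Rintegral do rewrite -[_ + _]mul1r; rewrite C C' vE.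
  under [RHS]eq_Rintegral do rewrite E1.
  under eq_Rintegral do rewrite -[_ + _]mul1r.
  by under [RHS]eq_Rintegral do rewrite -[_ + _]mul1r; rewrite S S'.
have := @trig_closure_unique R _ G _ _ _ _ P P phi1 phi2 (fun=> 1) (fun=> 1)
  mphi1 mphi2 i1 i1 _ _ _ tA.
case.
- by move=> u /char[+ _]; under eq_Rintegral do rewrite -[cos _]mulr1;
    under [X in _ = X -> _]eq_Rintegral do rewrite -[cos _]mulr1.
- by move=> u /char[_ +]; under eq_Rintegral do rewrite -[sin _]mulr1;
    under [X in _ = X -> _]eq_Rintegral do rewrite -[sin _]mulr1.
have mI (phi : Omega * Omega -> E * E) :
    measurable_fun setT (fun w => \1_A (phi w) : R) -> measurable (phi @^-1` A).
  move=> mA; have := mA measurableT [set 1] (measurable_set1 _); rewrite setTI.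
  congr measurable; apply/seteqP; split=> w /=; rewrite indicE.
    by case: (boolP (_ \in A)) => [/set_mem//|_ /= /eqP]; rewrite eq_sym oner_eq0.
  by move=> Aw; rewrite mem_set.
have iE (phi : Omega * Omega -> E * E) : measurable (phi @^-1` A) ->
    \int[P]_w (\1_A (phi w) * 1) = fine (P (phi @^-1` A)).
  move=> mA; rewrite /Rintegral -[X in P X]setIT -integral_indic//; congr fine.
  by apply: eq_integral => w _; rewrite mulr1.
move=> /mI m1 /mI m2; rewrite !iE// => E1; split=> //.
by rewrite -[LHS]fineK ?fin_num_measure// -[RHS]fineK ?fin_num_measure// E1.
Qed.

End Rotation.

(** * Square integrability by Fernique's argument *)

Section Fernique.
Context {R : realType} {E : completeNormedModType R}.
Hypothesis sepE : separable E.

(** Rotation invariance covers only events generated by functionals; a norming sequence brings norm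
    events among them. The zero functional [h] fills the coordinate that is absent. *)
Lemma sigma_of_dual_sums_norm (s t : R) :
  sigma_of (@dual_sums R E) [set z | `|z.1| <= s /\ t < `|z.2|].
Proof.
have [F [F1 FP]] := norming_sequence sepE.
have [h h0] := @dual0 R E.
pose Gen := \bigcup_(u in @dual_sums R E) preimage_set_system setT u measurable.
have mle (u : E * E -> R) r : dual_sums u -> <<s Gen >> [set z | u z <= r].
  move=> Gu; apply: sub_sigma_algebra; exists u => //.
  exists `]-oo, r]%classic => //; rewrite setTI.
  by apply/seteqP; split=> z /=; rewrite in_itv.
have bigcap_sig (A : nat -> set (E * E)) : (forall k, <<s Gen >> (A k)) ->
    <<s Gen >> (\bigcap_k A k).
  by move=> mA; exact: (@bigcapT_measurable _ (g_sigma_algebraType Gen) A mA).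
have normE (z : E) r : (`|z| <= r) <-> (forall k, (F k z : R) <= r).
  split=> [zr k|zr]; first exact: le_trans (le_trans (ler_norm _) (F1 k z)) zr.
  by rewrite leNgt; apply/negP => /FP[k]; rewrite ltNge zr.
have S1 : <<s Gen >> [set z | `|z.1| <= s].
  rewrite (_ : mkset _ = \bigcap_k [set z | F k z.1 + h z.2 <= s]).
    by apply: bigcap_sig => k; apply: mle; exists (F k), h.
  apply/seteqP; split=> z /=; first by move/normE => H k _ /=; rewrite h0 addr0.
  by move=> H; apply/normE => k; have := H k Logic.I; rewrite /= h0 addr0.
have S2 : <<s Gen >> [set z | `|z.2| <= t].
  rewrite (_ : mkset _ = \bigcap_k [set z | h z.1 + F k z.2 <= t]).
    by apply: bigcap_sig => k; apply: mle; exists h, (F k).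
  apply/seteqP; split=> z /=; first by move/normE => H k _ /=; rewrite h0 add0r.
  by move=> H; apply/normE => k; have := H k Logic.I; rewrite /= h0 add0r.
rewrite /sigma_of -/Gen.
rewrite (_ : mkset _ = [set z | `|z.1| <= s] `&` ~` [set z | `|z.2| <= t]).
  apply: (@measurableI _ (g_sigma_algebraType Gen)) => //.
  exact: (@measurableC _ (g_sigma_algebraType Gen)).
by apply/seteqP; split=> z /= [z1 z2]; split=> //; move: z2;
  [rewrite ltNge => /negP|move/negP; rewrite -ltNge].
Qed.

Section CentredCase.
Context {d : measure_display} {Omega : measurableType d}.
Variable mu : probability Omega R.
Variable Z : Omega -> E.
Hypothesis mZ : borel_measurable measurable Z.
Hypothesis gZ : forall f : dual E, exists v, centred_gaussian mu (fun w => f (Z w) : R) v.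

Let p (t : R) : R := fine (mu [set w | t < `|Z w|]).

Let mtail t : measurable [set w | t < `|Z w|].
Proof.
rewrite (_ : mkset _ = (fun w => `|Z w|) @^-1` `]t, +oo[%classic).
  by rewrite -[X in measurable X]setTI; exact: (borel_measurable_norm mZ).
by apply/seteqP; split=> w /=; rewrite in_itv/= andbT.
Qed.

Let p_ge0 t : 0 <= p t. Proof. exact: fine_ge0. Qed.

Let pE t : (p t)%:E = mu [set w | t < `|Z w|].
Proof. by rewrite /p fineK// fin_num_measure. Qed.

(* [Z] and an independent copy are rotated by 45 degrees. *)
Let p_rec s t : (1 - p s) * p t <= p ((t - s) / Num.sqrt 2) ^+ 2.
Proof.
set c := (Num.sqrt 2)^-1.
have c0 : 0 < c by rewrite invr_gt0 sqrtr_gt0.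
pose B : set (E * E) := [set z | `|z.1| <= s /\ t < `|z.2|].
have [m1 m2 PE] := rotation_invariance mZ gZ (sigma_of_dual_sums_norm s t).
have sC : [set w | `|Z w| <= s] = ~` [set w | s < `|Z w|].
  by apply/seteqP; split=> w /=; rewrite leNgt => /negP.
have B1 : (mu \x mu)%E ((fun w => (Z w.1, Z w.2)) @^-1` B) = ((1 - p s) * p t)%:E.
  rewrite (_ : _ @^-1` _ = [set w | `|Z w| <= s] `*` [set w | t < `|Z w|])//.
  have muC : mu [set w | `|Z w| <= s] = (1 - p s)%:E.
    by rewrite sC probability_setC// -pE -EFinB.
  rewrite product_measure1E//; last by rewrite sC; exact: measurableC.
  by rewrite EFinM pE -muC.
rewrite -lee_fin -B1 PE.
set u := (t - s) / _.
have -> : (p u ^+ 2)%:E = (mu \x mu)%E ([set w | u < `|Z w|] `*` [set w | u < `|Z w|]).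
  by rewrite product_measure1E// expr2 EFinM pE.
apply: le_measure; [exact: mem_set|exact: (mem_set (measurableX (mtail u) (mtail u)))|].
move=> [w1 w2] /=; rewrite !normrZ gtr0_norm// => -[h1 h2].
have cc : 2 * (c * c) = 1 by rewrite /c -invfM -expr2 sqr_sqrtr// divff.
have key (a b : E) : c * `|a - b| <= s -> t < c * `|a + b| -> u < `|b|.
  move=> ab1 ab2.
  have ab3 : `|a + b| <= `|a - b| + 2 * `|b|.
    have -> : 2 * `|b| = `|(2 : R) *: b| by rewrite normrZ normr_nat.
    rewrite scaler_nat mulr2n.
    by apply: le_trans (ler_normD (a - b) (b + b)); rewrite addrA subrK.
  have ab4 := ler_wpM2l (ltW c0) ab3.
  have : t - s < 2 * c * `|b| by lra.
  rewrite -(ltr_pM2l c0).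
  rewrite (_ : c * (2 * c * `|b|) = `|b|); last first.
    by rewrite mulrA (mulrCA c 2) cc mul1r.
  by rewrite /u -/c mulrC.
split; last exact: key h1 h2.
by apply: (key (Z w2) (Z w1)); [rewrite distrC|rewrite addrC].
Qed.

Let p_anti s t : s <= t -> p t <= p s.
Proof.
move=> st; rewrite -lee_fin !pE.
apply: le_measure; [exact: (mem_set (mtail t))|exact: (mem_set (mtail s))|].
by move=> w /=; exact: le_lt_trans.
Qed.

Let p_small e : 0 < e -> exists2 s, 1 <= s & p s <= e.
Proof.
move=> e0.
have : (mu \o (fun n : nat => [set w | n%:R < `|Z w|])) @ \oo -->
    mu (\bigcap_(n : nat) [set w | n%:R < `|Z w|]).
  apply: nonincreasing_cvg_mu => //.
  - by rewrite (le_lt_trans (probability_le1 _ _)) ?ltry.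
  - exact: bigcapT_measurable.
  - move=> n m nm; apply/subsetPset => w /=; apply: le_lt_trans.
    by rewrite ler_nat.
rewrite (_ : \bigcap_n _ = set0); last first.
  apply/seteqP; split=> // w /= H.
  have [n _ /(_ n (leqnn n))/=] := nbhs_infty_gtr `|Z w|.
  by move=> /ltW; rewrite leNgt (H n).
rewrite measure0 => /fine_cvgP[_ /cvgrPdist_le/(_ e e0)[N _ pN]].
exists N.+1%:R; first by rewrite ler1n.
have := pN N.+1 (leqnSn _); rewrite sub0r normrN /= => h.
exact: le_trans (ler_norm _) h.
Qed.

(** For [t >= s] one has [(3 t - s) / sqrt 2 >= t] and [1 - p s >= 1/2], so the rotation inequality
    becomes [p (3 t) <= 2 p(t)^2]. Iterating along [3 ^+ k * s] makes the tail decay faster than the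
    squares of the levels grow. *)
Lemma centred_fernique : mu.-integrable setT (EFin \o (fun w => `|Z w| ^+ 2)).
Proof.
have [s s1 ps] : exists2 s, 1 <= s & p s <= 36^-1 by apply: p_small; rewrite invr_gt0.
have s0 : 0 < s by lra.
(* Each step multiplies the squared level by [9], and [9 * rho = 1/2] leaves a geometric series. The
   threshold [36^-1] is [rho / 2], the value at [k = 0] of the bound that follows. *)
pose rho : R := 18^-1.
have p3 t : s <= t -> p (3 * t) <= 2 * p t ^+ 2.
  move=> st; have := p_rec s (3 * t).
  have : p ((3 * t - s) / Num.sqrt 2) <= p t.
    apply: p_anti; rewrite ler_pdivlMr ?sqrtr_gt0//.
    have : Num.sqrt 2 <= 2 :> R.
      have := @sqr_sqrtr R 2 (ler0n _ 2); have := sqrtr_ge0 (2 : R); nra.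
    move=> h; have t0 : 0 <= t by lra.
    have := ler_wpM2l t0 h; lra.
  have := p_ge0 ((3 * t - s) / Num.sqrt 2); have := p_ge0 (3 * t).
  have := p_ge0 t.
  set a := p t; set b := p (3 * t); set e := p (_ / _) => a0 b0 e0 ea h.
  have : e ^+ 2 <= a ^+ 2 by rewrite ler_sqr ?nnegrE.
  have : (1 - p s) * b >= 2^-1 * b by rewrite ler_wpM2r//; lra.
  lra.
have pk k : p (3 ^+ k * s) <= 2^-1 * rho ^+ k.+1.
  elim: k => [|k IH]; first by rewrite expr0 mul1r expr1 (le_trans ps)// /rho; lra.
  rewrite exprS -mulrA; apply: le_trans (p3 _ _) _.
    by rewrite ler_peMl ?(ltW s0)// exprn_ege1//; lra.
  have r0 : 0 < rho ^+ k.+1 by rewrite exprn_gt0// invr_gt0.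
  have : p (3 ^+ k * s) ^+ 2 <= (2^-1 * rho ^+ k.+1) ^+ 2.
    by rewrite ler_sqr ?nnegrE ?p_ge0// mulr_ge0 ?ltW// invr_ge0.
  have : rho ^+ k.+1 <= rho by rewrite exprS ger_pMr ?exprn_ile1 /rho; lra.
  rewrite [rho ^+ k.+2]exprS expr2; set x := rho ^+ k.+1 in r0 *; nra.
(* Truncation at level [3 ^+ n * s]: passing from [n] to [n + 1] adds at most the new squared level
   on the event [3 ^+ n * s < |Z|], so the integrals stay below [2 s^2], and monotone convergence
   concludes. *)
pose g n w : R := Num.min `|Z w| (3 ^+ n * s) ^+ 2.
have mg n : measurable_fun setT (g n).
  apply: measurable_funX; apply: measurable_minr => //.
  exact: borel_measurable_norm.
have g0 n w : 0 <= g n w by exact: sqr_ge0.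
have s3 n : 0 <= 3 ^+ n * s by rewrite mulr_ge0 ?(ltW s0)// exprn_ge0.
have gS n w : g n.+1 w <= g n w + (3 ^+ n.+1 * s) ^+ 2 * \1_[set w | 3 ^+ n * s < `|Z w|] w.
  rewrite indicE; case: (boolP (w \in _)) => [/set_mem/= h|].
    rewrite mulr1 (le_trans (y := (3 ^+ n.+1 * s) ^+ 2))//; last by rewrite lerDr.
    by rewrite /g ler_sqr ?nnegrE ?ge_min ?lexx ?orbT// le_min normr_ge0 s3.
  rewrite notin_setE /= => /negP; rewrite -leNgt => h.
  rewrite mulr0 addr0 /g !min_l//.
  by rewrite (le_trans h)// ler_wpM2r ?(ltW s0)// ler_eXn2l//; lra.
have int_g n : (\int[mu]_w (g n w)%:E <= (s ^+ 2 * (2 - 2^-1 ^+ n))%:E)%E.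
  elim: n => [|n IH].
    rewrite expr0 (_ : 2 - 1 = 1) ?mulr1; last by lra.
    rewrite -[leRHS]mule1 -(probability_setT mu) -integral_cst//.
    apply: ge0_le_integral => //=.
    - by move=> w _; rewrite lee_fin.
    - exact/measurable_EFinP.
    - move=> w _; rewrite lee_fin /g ler_sqr ?nnegrE ?ge_min ?expr0 ?mul1r ?lexx ?orbT//.
        by rewrite le_min normr_ge0 ltW.
      exact: ltW.
  apply: (@le_trans _ _ (\int[mu]_w ((g n w)%:E +
     ((3 ^+ n.+1 * s) ^+ 2)%:E * (\1_[set w | (3 ^+ n * s < `|Z w|)%R] w)%:E))%E).
    apply: ge0_le_integral => //=.
    - by move=> w _; rewrite lee_fin.
    - exact/measurable_EFinP.
    - apply: emeasurable_funD; first exact/measurable_EFinP.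
      by apply/measurable_EFinP/measurable_funM => //; exact: measurable_indic.
    - by move=> w _; rewrite -EFinM -EFinD lee_fin.
  rewrite ge0_integralD//=; last 4 first.
  - by move=> w _; rewrite lee_fin.
  - exact/measurable_EFinP.
  - by move=> w _; rewrite -EFinM lee_fin mulr_ge0 ?sqr_ge0.
  - by apply/measurable_EFinP/measurable_funM => //; exact: measurable_indic.
  rewrite ge0_integralZl//=; last 2 first.
  - by apply/measurable_EFinP; exact: measurable_indic.
  - by rewrite lee_fin sqr_ge0.
  have -> : (\int[mu]_w (\1_[set w | (3 ^+ n * s < `|Z w|)%R] w)%:E =
      (p (3 ^+ n * s))%:E)%E.
    by rewrite integral_indic// setIT pE.
  rewrite -EFinM.
  apply: le_trans (leeD2r _ IH) _; rewrite -EFinD lee_fin.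
  have := ler_wpM2l (sqr_ge0 (3 ^+ n.+1 * s)) (pk n).
  rewrite (_ : (3 ^+ n.+1 * s) ^+ 2 * (2^-1 * rho ^+ n.+1) = s ^+ 2 * (2^-1 * 2^-1 ^+ n.+1)).
    rewrite [2^-1 ^+ n.+1]exprS; have := sqr_ge0 s => s20.
    have : 0 <= s ^+ 2 * 2^-1 ^+ n by rewrite mulr_ge0// exprn_ge0// invr_ge0.
    lra.
  have e2 : 2^-1 ^+ n.+1 = (3 ^+ n.+1) ^+ 2 * rho ^+ n.+1 :> R.
    rewrite -exprM mulnC exprM -exprMn; congr (_ ^+ _); rewrite /rho; lra.
  rewrite e2; ring.
have lim_g w : limn (fun n => (g n w)%:E) = (`|Z w| ^+ 2)%:E.
  apply/cvg_lim => //; apply: cvg_near_cst.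
  have [N _ NZ] := nbhs_infty_gtr `|Z w|.
  exists N => // n /= Nn; congr EFin; rewrite /g min_l//.
  have ns : n%:R <= 3 ^+ n :> R by rewrite -natrX ler_nat ltnW// ltn_expl.
  apply: (le_trans (ltW (NZ n Nn))); apply: (le_trans ns).
  by rewrite ler_peMr// exprn_ge0.
apply/integrableP; split.
  by apply/measurable_EFinP/measurable_funX; exact: borel_measurable_norm.
have nd w : {homo (fun n => (g n w)%:E) : n m / (n <= m)%N >-> (n <= m)%E}.
  move=> n m nm; rewrite lee_fin /g ler_sqr ?nnegrE ?le_min ?normr_ge0 ?s3//.
  rewrite ge_min lexx/= ge_min; apply/orP; right.
  by rewrite ler_wpM2r ?(ltW s0)// ler_eXn2l//; lra.
have := @cvg_monotone_convergence _ _ _ mu setT measurableT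
  (fun n w => (g n w)%:E) (fun n => (measurable_EFinP _ _).2 (mg n))
  (fun n w _ => g0 n w) (fun w _ => nd w).
under [X in _ --> X]eq_integral do rewrite lim_g.
move=> cv; apply: (@le_lt_trans _ _ (s ^+ 2 * 2)%:E); last by rewrite ltry.
under eq_integral do rewrite gee0_abs ?lee_fin ?sqr_ge0//.
have <- := cvg_lim _ cv; last by [].
apply: lime_le; first by apply/cvg_ex; eexists; exact: cv.
apply: nearW => n; apply: (le_trans (int_g n)); rewrite lee_fin ler_wpM2l ?sqr_ge0//.
by rewrite lerBlDr lerDl exprn_ge0// invr_ge0.
Qed.

End CentredCase.
Lemma gaussian_integrable_sqr d (Omega : measurableType d) (mu : probability Omega R)
    (X : Omega -> E) : gaussian mu X ->
  mu.-integrable setT (EFin \o (fun w => `|X w| ^+ 2)).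
Proof.
move=> [mX gX].
pose W (w : Omega * Omega) : E := X w.1 - X w.2.
have WE (f : dual E) (m : R) w : f (W w) = (f (X w.1) - m) + - (f (X w.2) - m) :> R.
  by rewrite linearB/=; ring.
have gW (f : dual E) : exists v,
    centred_gaussian (mu \x mu)%E (fun w => f (W w) : R) v.
  have [m [v mv]] := real_gaussian_centred (gX f).
  exists (v + v); under eq_fun do rewrite (WE f m).
  exact: (centred_gaussian_prod mv (centred_gaussian_opp mv)).
have mW : borel_measurable measurable W.
  apply: (weakly_measurable_borel sepE) => f; under eq_fun do rewrite (WE f 0) !subr0.
  have mf := borel_measurable_dual f mX.
  by apply: measurable_funB;
    [exact: (measurableT_comp mf measurable_fst)|exact: (measurableT_comp mf measurable_snd)].
have /integrableP[/measurable_EFinP mW2 +] := centred_fernique mW gW.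
rewrite fubini_tonelli1//; last by apply: measurableT_comp => //; exact/measurable_EFinP.
move=> fin.
have [x xfin] : exists x, (\int[mu]_y (`|X x - X y| ^+ 2)%:E < +oo)%E.
  apply: contrapT => /forallNP inf; move: fin.
  rewrite (eq_integral (fun=> +oo%E)); last first.
    move=> x _; apply: contrapT => xfin; apply: (inf x); rewrite ltey.
    apply/eqP; move: xfin; rewrite /fubini_F /=.
    by under eq_integral do rewrite ger0_norm ?sqr_ge0//.
  by rewrite integral_cst// [X in (_ * X)%E](probability_setT mu) mule1 ltxx.
have mN : measurable_fun setT (fun y => `|X x - X y| ^+ 2).
  by apply: measurable_funX; under eq_fun do rewrite distrC; exact: borel_measurable_normB.
apply: (@le_integrable _ _ _ mu setT measurableT _
  ((fun y => 2%:E * (`|X x - X y| ^+ 2)%:E) \+ (fun=> (2 * `|X x| ^+ 2)%:E))%E).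
- by apply/measurable_EFinP/measurable_funX; exact: borel_measurable_norm.
- move=> y _; rewrite /= lee_fin ger0_norm ?sqr_ge0// ger0_norm; last first.
    by rewrite addr_ge0// mulr_ge0// sqr_ge0.
  have := ler_normB (X x) (X x - X y); rewrite subKr.
  have := normr_ge0 (X y); have := normr_ge0 (X x); have := normr_ge0 (X x - X y).
  set a := `|X x - X y|; set b := `|X x|; set c := `|X y| => a0 b0 c0 h.
  have : c ^+ 2 <= (b + a) ^+ 2 by rewrite ler_sqr ?nnegrE// addr_ge0.
  have := sqr_ge0 (a - b); nra.
- apply: integrableD => //; last exact: finite_measure_integrable_cst.
  apply: integrableZl => //; apply/integrableP; split; first exact/measurable_EFinP.
  by under eq_integral do rewrite /= ger0_norm ?sqr_ge0//.
Qed.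

Lemma gaussian_integrable_norm d (Omega : measurableType d) (mu : probability Omega R)
    (X : Omega -> E) : gaussian mu X -> mu.-integrable setT (fun w => `|X w|%:E).
Proof.
move=> gX; have [mX _] := gX.
apply: (@le_integrable _ _ _ mu setT measurableT _
  (fun w => 1%:E + (`|X w| ^+ 2)%:E)%E).
- by apply/measurable_EFinP; exact: borel_measurable_norm.
- move=> w _; rewrite /= lee_fin normr_id ger0_norm ?addr_ge0 ?sqr_ge0//.
  have := sqr_ge0 (`|X w| - 1); have := normr_ge0 (X w); nra.
- apply: integrableD => //; first exact: finite_measure_integrable_cst.
  exact: gaussian_integrable_sqr.
Qed.

End Fernique.

(** * Gram-Schmidt and conditioning in a Gaussian space *)

Definition subspace_pred (R : realType) (T : Type) (V : set (T -> R)) : Prop :=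
  [/\ V (fun=> 0), (forall u v, V u -> V v -> V (fun x => u x - v x)) &
      (forall c u, V u -> V (fun x => c * u x))].

Section SubspacePred.
Context {R : realType} {T : Type} {V : set (T -> R)}.
Hypothesis sV : subspace_pred V.

Lemma subspace_predD u v : V u -> V v -> V (fun x => u x + v x).
Proof.
have [_ VB VZ] := sV; move=> Vu /(VZ (-1)) /(VB _ _ Vu).
by under eq_fun do rewrite mulN1r opprK.
Qed.

Lemma subspace_pred_sum (I : eqType) (s : seq I) (c : I -> R) (h : I -> T -> R) :
  {in s, forall i, V (h i)} -> V (fun x => \sum_(i <- s) c i * h i x).
Proof.
have [V0 _ VZ] := sV; elim: s => [_|i s IH Vs].
  by under eq_fun do rewrite big_nil.
under eq_fun do rewrite big_cons.
apply: subspace_predD; first by apply: VZ; apply: Vs; rewrite mem_head.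
by apply: IH => j js; apply: Vs; rewrite in_cons js orbT.
Qed.

End SubspacePred.

Lemma sin_mvt (R : realType) (y : R) : exists c, `|c| <= `|y| /\ sin y = cos c * y.
Proof.
have pos (z : R) : 0 <= z -> exists c, `|c| <= `|z| /\ sin z = cos c * z.
  move=> z0.
  have ds (x : R) : x \in `]0, z[ -> is_derive x 1 sin (cos x) by move=> _; exact: is_derive_sin.
  have cs : {within `[0, z], continuous (@sin R)}.
    by apply: continuous_subspaceT; exact: continuous_sin.
  have [c] := MVT_segment z0 ds cs; rewrite in_itv/= sin0 !subr0 => /andP[c0 cz] E; exists c.
  by rewrite !ger0_norm.
have [/pos//|y0] := leP 0 y.
have [|c [cy E]] := pos (- y); first by rewrite oppr_ge0 ltW.
exists c; rewrite normrN in cy; split=> //.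
by rewrite -[in LHS](opprK y) sinN E mulrN opprK.
Qed.

Lemma sin_scaled_le (R : realType) (n : nat) (x : R) :
  `|n.+1%:R * sin (n.+1%:R^-1 * x)| <= `|x|.
Proof.
have [c [_ ->]] := sin_mvt (n.+1%:R^-1 * x).
by rewrite mulrCA mulVKf// normrM ler_piMl// ler_norml cos_geN1 cos_le1.
Qed.

Lemma cvg_sin_scaled (R : realType) (x : R) :
  (fun n => n.+1%:R * sin (n.+1%:R^-1 * x)) @ \oo --> x.
Proof.
have [c cP] := choice (fun n : nat => sin_mvt (n.+1%:R^-1 * x)).
have E n : n.+1%:R * sin (n.+1%:R^-1 * x) = cos (c n) * x.
  by have [_ ->] := cP n; rewrite mulrCA mulVKf.
rewrite (funext E) -[X in _ --> X]mul1r -(@cos0 R).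
apply: cvgMl; apply: (cvg_comp c cos); last exact: continuous_cos.
have c0 : (fun n => n.+1%:R^-1 * `|x|) @ \oo --> (0 : R).
  by rewrite -[X in _ --> X](mul0r `|x|); apply: cvgMl; exact: cvg_harmonic.
apply/cvgrPdist_le => e e0; move/cvgrPdist_le : c0 => /(_ e e0).
apply: filterS => n; rewrite !sub0r !normrN => h.
have [cn _] := cP n; apply: (le_trans cn).
by rewrite normrM ger0_norm ?invr_ge0// (le_trans (ler_norm _) h).
Qed.

Section GaussianSpace.
Context {d : measure_display} {Omega : measurableType d} {R : realType}.
Variable mu : probability Omega R.
Variable H : set (Omega -> R).
Hypothesis sH : subspace_pred H.
Hypothesis gH : forall u, H u -> exists v, centred_gaussian mu u v.
Implicit Types (u v : Omega -> R) (s l : seq (Omega -> R)).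

Definition inner u v : R := \int[mu]_w (u w * v w).
Local Notation B := inner.

Lemma gspace_measurable u : H u -> measurable_fun setT u.
Proof. by move=> /gH[v []]. Qed.

Lemma gspace_sqr u : H u -> mu.-integrable setT (EFin \o (fun w => u w ^+ 2)).
Proof. by move=> /gH[v cv]; exact: integrable_centred_gaussian_sqr cv. Qed.

Lemma gspace_integrable u : H u -> mu.-integrable setT (EFin \o u).
Proof. by move=> /gH[v cv]; exact: integrable_centred_gaussian cv. Qed.

Lemma gspace_mul u v : H u -> H v ->
  mu.-integrable setT (EFin \o (fun w => u w * v w)).
Proof.
move=> Hu Hv.
apply: (@le_integrable _ _ _ mu setT measurableT _
  ((fun w => (u w ^+ 2)%:E) \+ (fun w => (v w ^+ 2)%:E))%E).
- by apply/measurable_EFinP/measurable_funM; exact: gspace_measurable.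
- move=> w _; rewrite /= lee_fin [leRHS]ger0_norm ?addr_ge0 ?sqr_ge0//.
  rewrite ler_norml; have := sqr_ge0 (u w - v w); have := sqr_ge0 (u w + v w).
  have := sqr_ge0 (u w); have := sqr_ge0 (v w) => ? ? ? ?.
  by apply/andP; split; nra.
- by apply: integrableD => //; exact: gspace_sqr.
Qed.

Lemma innerC u v : B u v = B v u.
Proof. by apply: eq_Rintegral => w _; rewrite mulrC. Qed.

Lemma innerBl u v x : H u -> H v -> H x -> B (fun w => u w - v w) x = B u x - B v x.
Proof.
move=> Hu Hv Hx; rewrite /B -RintegralB//; try exact: gspace_mul.
by apply: eq_Rintegral => w _; rewrite mulrBl.
Qed.

Lemma innerZl c u x : H u -> H x -> B (fun w => c * u w) x = c * B u x.
Proof.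
move=> Hu Hx; rewrite /B -RintegralZl//; last exact: gspace_mul.
by apply: eq_Rintegral => w _; rewrite mulrA.
Qed.

Lemma innerBr u v x : H u -> H v -> H x -> B x (fun w => u w - v w) = B x u - B x v.
Proof. by move=> *; rewrite innerC innerBl// innerC (innerC v). Qed.

Lemma innerZr c u x : H u -> H x -> B x (fun w => c * u w) = c * B x u.
Proof. by move=> *; rewrite innerC innerZl// innerC. Qed.

Lemma inner_sqr_sub c u v : H u -> H v ->
  B (fun w => u w - c * v w) (fun w => u w - c * v w) =
  B u u - 2 * (c * B u v) + c * (c * B v v).
Proof.
move=> Hu Hv; have [_ HB HZ] := sH.
have Hcv := HZ c v Hv; have Hd := HB _ _ Hu Hcv.
rewrite innerBl// !innerBr// innerZl// !innerZr// (innerC v u) innerZl//.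
ring.
Qed.

Lemma inner0l x : B (fun=> 0) x = 0.
Proof.
rewrite /B; under eq_Rintegral do rewrite mul0r.
by rewrite /Rintegral integral0.
Qed.

Lemma inner_ge0 u : 0 <= B u u.
Proof. by apply: Rintegral_ge0 => w _; rewrite -expr2 sqr_ge0. Qed.

Lemma gspace_gaussian u : H u -> centred_gaussian mu u (B u u).
Proof.
move=> /gH[v cv]; rewrite (_ : B u u = v)// /B /Rintegral.
under eq_integral do rewrite -expr2.
by rewrite (centred_gaussian_sqr cv).
Qed.

(** The degenerate case of Cauchy-Schwarz, which makes division by a zero variance harmless in
    projections. *)
Lemma inner_null u v : H u -> H v -> B u u = 0 -> B v u = 0.
Proof.
move=> Hu Hv u0; have [_ HB HZ] := sH.
have [//|b0] := eqVneq (B v u) 0.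
(* With [B u u = 0] the square of [v - t u] is affine in [t], and this [t] gives it the value
   [-1]. *)
pose t := (B v v + 1) / (2 * B v u).
have := inner_ge0 (fun w => v w - t * u w).
have Htu : H (fun w => t * u w) by exact: HZ.
rewrite innerBl ?innerBr// ?innerZl ?innerZr//; try exact: HB.
rewrite u0 (innerC u v) !mulr0 subr0.
have -> : t * B v u = (B v v + 1) / 2 by rewrite /t; field.
lra.
Qed.

Lemma orthogonal_subspace u : H u -> subspace_pred [set k | H k /\ B u k = 0].
Proof.
have [H0 HB HZ] := sH; move=> Hu; split.
- by split=> //; rewrite innerC inner0l.
- by move=> k l [Hk k0] [Hl l0]; split; [exact: HB|rewrite innerBr// k0 l0 subrr].
- by move=> c k [Hk k0]; split; [exact: HZ|rewrite innerZr// k0 mulr0].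
Qed.

(* Replacing [u] by [-u] does not change the joint law of [(k, u)] when [k] is
   orthogonal to [u]; hence [E (cos k * sin (t u)) = E (sin k * sin (t u)) = 0]
   for all [t], and [u] is the limit of [n sin (u / n)]. *)
Lemma orthogonal_trig u k : H u -> H k -> B u k = 0 ->
  \int[mu]_w (cos (k w) * u w) = 0 /\ \int[mu]_w (sin (k w) * u w) = 0.
Proof.
move=> Hu Hk uk0; have [H0 HB HZ] := sH.
have mu_ := gspace_measurable Hu; have mk := gspace_measurable Hk.
have mc v : measurable_fun setT v -> measurable_fun setT (fun w => cos (v w)).
  by move=> mv; apply: measurableT_comp; [exact: measurable_cos|].
have ms v : measurable_fun setT v -> measurable_fun setT (fun w => sin (v w)).
  by move=> mv; apply: measurableT_comp; [exact: measurable_sin|].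
have ibd v M : measurable_fun setT v -> (forall w, `|v w| <= M) ->
    mu.-integrable setT (EFin \o v) by move=> mv vM; exact: (integrable_bounded_prob mu mv vM).
have c1 x : `|cos x : R| <= 1 by rewrite ler_norml cos_geN1 cos_le1.
have s1 x : `|sin x : R| <= 1 by rewrite ler_norml sin_geN1 sin_le1.
have key t : \int[mu]_w (cos (k w) * sin (t * u w)) = 0 /\
    \int[mu]_w (sin (k w) * sin (t * u w)) = 0.
  have Htu : H (fun w => t * u w) by exact: HZ.
  have Hm : H (fun w => k w - t * u w) by exact: HB.
  have Hp : H (fun w => k w + t * u w) by exact: (subspace_predD sH).
  have [_ _ /(_ 1)[cm sm]] := gspace_gaussian Hm.
  have [_ _ /(_ 1)[cp sp]] := gspace_gaussian Hp.
  have Bpm : B (fun w => k w + t * u w) (fun w => k w + t * u w) =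
      B (fun w => k w - t * u w) (fun w => k w - t * u w).
    apply/eqP; rewrite -subr_eq0 /B -RintegralB//; try exact: gspace_mul.
    rewrite -[X in _ == X](mulr0 (4 * t)) -uk0 /B -RintegralZl//; last exact: gspace_mul.
    by apply/eqP; apply: eq_Rintegral => w _; ring.
  rewrite -Bpm in cm.
  have [mm mp] : measurable_fun setT (fun w => k w - t * u w) /\
      measurable_fun setT (fun w => k w + t * u w).
    by split; exact: gspace_measurable.
  split.
    transitivity (2^-1 * (\int[mu]_w sin (1 * (k w + t * u w)) -
                          \int[mu]_w sin (1 * (k w - t * u w)))).
      rewrite -RintegralB//; last 2 first.
      - by apply: (ibd _ 1) => //; apply: ms; exact: measurable_funM.
      - by apply: (ibd _ 1) => //; apply: ms; exact: measurable_funM.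
      rewrite -RintegralZl//; last first.
        apply: (ibd _ (1 + 1)) => [|w].
          by apply: measurable_funB; apply: ms; exact: measurable_funM.
        by rewrite (le_trans (ler_normB _ _))// lerD.
      by apply: eq_Rintegral => w _; rewrite !mul1r sinD sinB; field.
    by rewrite sm sp subrr mulr0.
  transitivity (2^-1 * (\int[mu]_w cos (1 * (k w - t * u w)) -
                        \int[mu]_w cos (1 * (k w + t * u w)))).
    rewrite -RintegralB//; last 2 first.
    - by apply: (ibd _ 1) => //; apply: mc; exact: measurable_funM.
    - by apply: (ibd _ 1) => //; apply: mc; exact: measurable_funM.
    rewrite -RintegralZl//; last first.
      apply: (ibd _ (1 + 1)) => [|w].
        by apply: measurable_funB; apply: mc; exact: measurable_funM.
      by rewrite (le_trans (ler_normB _ _))// lerD.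
    by apply: eq_Rintegral => w _; rewrite !mul1r cosB cosD; field.
  by rewrite cm cp subrr mulr0.
have lim (g : R -> R) : measurable_fun setT (fun w => g (k w)) ->
    (forall x, `|g x| <= 1) ->
    (forall t, \int[mu]_w (g (k w) * sin (t * u w)) = 0) ->
    \int[mu]_w (g (k w) * u w) = 0.
  move=> mg g1 gt.
  have l1 : (fun n => \int[mu]_w (g (k w) * (n.+1%:R * sin (n.+1%:R^-1 * u w)))) @ \oo
      --> \int[mu]_w (g (k w) * u w).
    apply: (@Rdominated_cvg _ _ _ mu _ _ (fun w => `|u w|)).
    - move=> n; apply: measurable_funM => //; apply: measurable_funM => //.
      by apply: ms; exact: measurable_funM.
    - by move=> w; apply: cvgMr; exact: cvg_sin_scaled.
    - exact/integrable_norm/gspace_integrable.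
    - by move=> n w; rewrite normrM -[leRHS]mul1r ler_pM// sin_scaled_le.
  have E n : \int[mu]_w (g (k w) * (n.+1%:R * sin (n.+1%:R^-1 * u w))) = 0.
    rewrite -[RHS](mulr0 n.+1%:R) -(gt n.+1%:R^-1) -RintegralZl//; last first.
      apply: (ibd _ 1) => [|w]; last by rewrite normrM mulr_ile1.
      by apply: measurable_funM => //; apply: ms; exact: measurable_funM.
    by apply: eq_Rintegral => w _; rewrite mulrCA.
  rewrite (funext E) in l1.
  exact: (cvg_unique (@Rhausdorff R) l1 (@cvg_cst _ _ _ _ _)).
split.
  by apply: (lim (@cos R)) => //; [exact: mc|move=> t; case: (key t)].
by apply: (lim (@sin R)) => //; [exact: ms|move=> t; case: (key t)].
Qed.

(** The signed measure with density [u] is compared with zero: its transforms vanish on the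
    variables orthogonal to [u], hence so does its mass on every event they generate. This is the
    form in which orthogonality acts as independence. *)
Lemma orthogonal_integral0 u (A : set Omega) : H u ->
  sigma_of [set k | H k /\ B u k = 0] A ->
  measurable A /\ \int[mu]_w (\1_A w * u w) = 0.
Proof.
move=> Hu sA; have [V0 VB VZ] := orthogonal_subspace Hu.
have tA := trig_closure_sigma_of V0 VB VZ sA.
have mV k : [set k | H k /\ B u k = 0] k -> measurable_fun setT k.
  by move=> [Hk _]; exact: gspace_measurable.
have mA : measurable A.
  suff : sigma_of [set k | H k /\ B u k = 0] `<=` measurable by apply.
  apply: smallest_sub; first exact: sigma_algebra_measurable.
  by move=> _ [k /mV mk [C mC <-]]; exact: mk.
split=> //.
have i0 : mu.-integrable setT (EFin \o (fun=> 0)) by exact: integrable0.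
have := @trig_closure_unique R _ _ _ _ _ _ mu mu id id u (fun=> 0)
  mV mV (gspace_integrable Hu) i0 _ _ _ tA.
case.
- move=> k [Hk k0]; have [-> _] := orthogonal_trig Hu Hk k0.
  by under eq_Rintegral do rewrite mulr0; rewrite /Rintegral integral0.
- move=> k [Hk k0]; have [_ ->] := orthogonal_trig Hu Hk k0.
  by under eq_Rintegral do rewrite mulr0; rewrite /Rintegral integral0.
move=> _ _ ->.
by under eq_Rintegral do rewrite mulr0; rewrite /Rintegral integral0.
Qed.

Definition proj s u (w : Omega) : R := \sum_(h <- s) B u h / B h h * h w.

Definition resid s u (w : Omega) : R := u w - proj s u w.

(** Residuals are neither normalised nor dropped when degenerate, so the length of the list, and
    with it the number [dim j], is preserved. *)
Fixpoint gram_schmidt s l : seq (Omega -> R) :=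
  if l is e :: l' then
    resid s e :: gram_schmidt (rcons s (resid s e)) l' else [::].

Lemma size_gram_schmidt s l : size (gram_schmidt s l) = size l.
Proof. by elim: l s => //= e l IH s; rewrite IH. Qed.

Lemma proj_subspace (V : set (Omega -> R)) s u : subspace_pred V ->
  {in s, forall h, V h} -> V (proj s u).
Proof. by move=> sV Vs; exact: subspace_pred_sum. Qed.

Lemma resid_subspace (V : set (Omega -> R)) s u : subspace_pred V ->
  {in s, forall h, V h} -> V u -> V (resid s u).
Proof. by move=> sV Vs Vu; have [_ VB _] := sV; apply: VB => //; exact: proj_subspace. Qed.

Lemma gram_schmidt_subspace (V : set (Omega -> R)) s l : subspace_pred V ->
  {in s, forall h, V h} -> {in l, forall h, V h} ->
  {in gram_schmidt s l, forall h, V h}.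
Proof.
move=> sV; elim: l s => [//|e l IH] s Vs Vl /= h.
have Vr : V (resid s e) by apply: resid_subspace => //; apply: Vl; rewrite mem_head.
rewrite in_cons => /orP[/eqP-> //|]; apply: IH.
  by move=> g; rewrite mem_rcons in_cons => /orP[/eqP->|/Vs].
by move=> g gl; apply: Vl; rewrite in_cons gl orbT.
Qed.

(** Each original vector is its residual plus a projection on earlier ones. This carries
    orthogonality from the basis back to the observations. *)
Lemma gram_schmidt_span (V : set (Omega -> R)) s l : subspace_pred V ->
  {in s, forall h, V h} -> {in gram_schmidt s l, forall h, V h} ->
  {in l, forall h, V h}.
Proof.
move=> sV; elim: l s => [//|e l IH] s Vs /= Vl h.
have Vr : V (resid s e) by apply: Vl; rewrite mem_head.
rewrite in_cons => /orP[/eqP->|].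
  rewrite (_ : e = fun w => resid s e w + proj s e w).
    by apply: (subspace_predD sV) => //; exact: proj_subspace.
  by apply/funext => w; rewrite /resid subrK.
apply: IH (rcons s (resid s e)) _ _ h.
  by move=> g; rewrite mem_rcons in_cons => /orP[/eqP->|/Vs].
by move=> g gl; apply: Vl; rewrite in_cons gl orbT.
Qed.

(** Orthogonality is expressed through residuals of arbitrary elements of [H]: this is the property
    of projections that is used, and it is an invariant under adjoining a residual. *)
Definition orthogonal_seq s : Prop :=
  {in s, forall h, H h} /\ forall u, H u -> {in s, forall h, B (resid s u) h = 0}.

Lemma proj_rcons s r u : proj (rcons s r) u = fun w => proj s u w + B u r / B r r * r w.
Proof. by apply/funext => w; rewrite /proj -cats1 big_cat big_seq1. Qed.

Lemma proj_cat s l u w : proj (s ++ l) u w = proj s u w + proj l u w.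
Proof. by rewrite /proj big_cat. Qed.

Section Step.
Variables (s : seq (Omega -> R)) (e : Omega -> R).
Hypothesis os : orthogonal_seq s.
Hypothesis He : H e.
Let r := resid s e.

Let Hs : {in s, forall h, H h}. Proof. by case: os. Qed.
Let Hr : H r. Proof. exact: resid_subspace. Qed.

Let residE u : resid (rcons s r) u = fun w => resid s u w - B u r / B r r * r w.
Proof. by apply/funext => w; rewrite /resid proj_rcons opprD addrA. Qed.

Let Hresid u : H u -> H (resid s u). Proof. by move=> Hu; exact: resid_subspace. Qed.

Let Bur u : H u -> B (resid s u) r = B u r.
Proof.
move=> Hu; rewrite /resid innerBl//; last exact: proj_subspace.
rewrite (_ : B (proj s u) r = 0) ?subr0// innerC.
have sK := orthogonal_subspace Hr.
have : [set k | H k /\ B r k = 0] (proj s u).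
  apply: proj_subspace => // h hs; split; first exact: Hs.
  by have [_ o] := os; exact: o.
by case.
Qed.

(** If [B r r = 0], the quotient is [0] by convention and the right-hand side is [0] by
    [inner_null]. *)
Let coef u : H u -> B u r / B r r * B r r = B u r.
Proof.
move=> Hu; have [r0|r0] := eqVneq (B r r) 0; last by rewrite divfK.
by rewrite r0 mulr0 inner_null.
Qed.

Lemma orthogonal_seq_rcons : orthogonal_seq (rcons s r).
Proof.
have [H0 HB HZ] := sH; split=> [h|u Hu h].
  by rewrite mem_rcons in_cons => /orP[/eqP->|/Hs].
have Hc : H (fun w => B u r / B r r * r w) by exact: HZ.
have Hsu := Hresid Hu.
rewrite mem_rcons in_cons residE => /orP[/eqP->|hs].
  by rewrite innerBl ?innerZl ?(Bur Hu) ?(coef Hu) ?subrr//.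
have Hh := Hs hs; rewrite innerBl ?innerZl//.
have [_ o] := os; rewrite (o u Hu h hs) -[B r h]/(B (resid s e) h) (o e He h hs).
by rewrite mulr0 subrr.
Qed.

Lemma inner_resid_rcons u : H u ->
  B (resid (rcons s r) u) (resid (rcons s r) u) =
  B (resid s u) (resid s u) - B u r ^+ 2 / B r r.
Proof.
move=> Hu; rewrite residE inner_sqr_sub//; last exact: Hresid.
rewrite (Bur Hu) (coef Hu).
set b := B u r; set c := B r r.
have -> : b ^+ 2 / c = b / c * b by rewrite expr2; ring.
ring.
Qed.

End Step.

Lemma orthogonal_seq_cat s l : orthogonal_seq s -> {in l, forall h, H h} ->
  orthogonal_seq (s ++ gram_schmidt s l).
Proof.
elim: l s => [|e l IH] s os Hl /=; first by rewrite cats0.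
have He : H e by apply: Hl; rewrite mem_head.
rewrite -cat_rcons; apply: IH; first exact: orthogonal_seq_rcons.
by move=> h hl; apply: Hl; rewrite in_cons hl orbT.
Qed.

Lemma inner_resid_cat s l u : orthogonal_seq s -> {in l, forall h, H h} -> H u ->
  B (resid (s ++ gram_schmidt s l) u) (resid (s ++ gram_schmidt s l) u) =
  B (resid s u) (resid s u) - \sum_(h <- gram_schmidt s l) B u h ^+ 2 / B h h.
Proof.
move=> os Hl Hu; elim: l s os Hl => [|e l IH] s os Hl /=.
  by rewrite cats0 big_nil subr0.
have He : H e by apply: Hl; rewrite mem_head.
rewrite -cat_rcons IH; last 2 first.
- exact: orthogonal_seq_rcons.
- by move=> h hl; apply: Hl; rewrite in_cons hl orbT.
by rewrite inner_resid_rcons// big_cons opprD addrA.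
Qed.

End GaussianSpace.

Lemma centred_gaussian_ae d (Omega : measurableType d) (R : realType)
    (mu : probability Omega R) (u u' : Omega -> R) v :
  measurable_fun setT u' -> {ae mu, forall w, u' w = u w} ->
  centred_gaussian mu u v -> centred_gaussian mu u' v.
Proof.
move=> mu' uu' [mu_ v0 cu]; split=> // t; have [<- <-] := cu t.
have mt x : measurable_fun setT x -> measurable_fun setT (fun w : Omega => t * x w).
  by move=> mx; exact: measurable_funM.
have cM x : measurable_fun setT x -> measurable_fun setT (fun w : Omega => (cos (t * x w))%:E).
  move=> mx; apply/measurable_EFinP.
  by apply: measurableT_comp; [exact: measurable_cos|exact: mt].
have sM x : measurable_fun setT x -> measurable_fun setT (fun w : Omega => (sin (t * x w))%:E).
  move=> mx; apply/measurable_EFinP.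
  by apply: measurableT_comp; [exact: measurable_sin|exact: mt].
split; rewrite /Rintegral; congr fine; apply: ae_eq_integral => //.
- exact: cM.
- exact: cM.
- by move: uu'; apply: filterS => w + _ => ->.
- exact: sM.
- exact: sM.
- by move: uu'; apply: filterS => w + _ => ->.
Qed.

(** * Testing almost sure equality on a sub-sigma-algebra *)

Section SubSigmaAlgebra.
Context {d : measure_display} {Omega : measurableType d} {R : realType}.
Variable mu : probability Omega R.
Variable G : set (set Omega).
Hypothesis GM : <<s G >> `<=` measurable.

Definition sub_measurable (u : Omega -> R) : Prop :=
  measurable_fun [set: g_sigma_algebraType G] (u : g_sigma_algebraType G -> R).

Lemma sub_measurable_subspace : subspace_pred sub_measurable.
Proof.
split=> [|u v mu_ mv|c u mu_]; first exact: measurable_cst.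
- exact: measurable_funB.
- exact: measurable_funM.
Qed.

Lemma sub_measurable_cst c : sub_measurable (fun=> c).
Proof. exact: measurable_cst. Qed.

(** The event [0 <= u] and its complement belong to the sub-sigma-algebra; testing on both gives
    [|u|] the integral [0]. *)
Lemma sub_measurable_ae0 u : sub_measurable u -> mu.-integrable setT (EFin \o u) ->
  (forall A, <<s G >> A -> \int[mu]_w (\1_A w * u w) = 0) ->
  {ae mu, forall w, u w = 0}.
Proof.
move=> su iu u0.
pose A := [set w | 0 <= u w].
have sA : <<s G >> A.
  have := su measurableT `[0, +oo[%classic (measurable_itv _); rewrite setTI.
  congr (<<s G >> _).
  by apply/seteqP; split=> w; rewrite /A /= in_itv/= andbT.
have sAc : <<s G >> (~` A) by exact: (@measurableC _ (g_sigma_algebraType G)).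
have iA B : <<s G >> B -> mu.-integrable setT (EFin \o (fun w => \1_B w * u w)).
  move=> sB; apply: (integrable_bounded_mul (M := 1) _ _ iu).
    by apply: measurable_indic; exact: GM.
  by move=> w; rewrite indicE; case: (_ \in _); rewrite ?normr1 ?normr0.
have abs0 : \int[mu]_w `|u w| = 0.
  transitivity (\int[mu]_w (\1_A w * u w - \1_(~` A) w * u w)).
    apply: eq_Rintegral => w _; rewrite !indicE in_setC.
    case: (boolP (w \in A)) => [/set_mem|]; rewrite /A/=.
      by move=> uw; rewrite ger0_norm// mul1r mul0r subr0.
    rewrite notin_setE/= => /negP; rewrite -ltNge => uw.
    by rewrite ltr0_norm// mul0r mul1r sub0r.
  by rewrite RintegralB//; [rewrite !u0// subrr|exact: iA..].
have : ae_eq mu setT (EFin \o u) (cst 0%E).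
  apply/(ae_eq_integral_abs mu measurableT (measurable_int _ iu)).
  - rewrite -[LHS]fineK; last first.
      by apply: integrable_fin_num => //; exact: integrable_abse.
    by congr EFin; rewrite -[RHS]abs0 /Rintegral.
by apply: filterS => w /(_ Logic.I) [].
Qed.

End SubSigmaAlgebra.

Lemma cond_exp_dual d (Omega : measurableType d) (R : realType)
    (mu : probability Omega R) (E : completeNormedModType R) (sepE : separable E)
    (F : set (set Omega)) (X Y : Omega -> E) (f : dual E) (A : set Omega) :
  borel_measurable measurable X -> mu.-integrable setT (fun w => `|X w|%:E) ->
  is_cond_exp mu F X Y -> F A -> measurable A ->
  \int[mu]_w (\1_A w * (f (Y w) : R)) = \int[mu]_w (\1_A w * (f (X w) : R)).
Proof.
move=> mX iX [_ iY YX] FA mA.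
have [mY iNY] := bochner_integrable_norm sepE iY.
have key (W : Omega -> E) : borel_measurable measurable W ->
    mu.-integrable setT (fun w => `|W w|%:E) ->
    \int[mu]_w (\1_A w * (f (W w) : R)) = f (bochner mu (fun w => \1_A w *: W w)) :> R.
  move=> mW iW; rewrite (dual_bochner sepE).
  - by apply: eq_Rintegral => w _; rewrite linearZ.
  - apply: (weakly_measurable_borel sepE) => g; under eq_fun do rewrite linearZ.
    by apply: measurable_funM; [exact: measurable_indic|exact: borel_measurable_dual].
  - have nE w : `|(\1_A w : R) *: W w| = \1_A w * `|W w|.
      by rewrite normrZ indicE; case: (_ \in _); rewrite ?normr1 ?normr0.
    under eq_fun do rewrite nE.
    apply: (integrable_bounded_mul (M := 1) (f := \1_A)) iW.
      exact: measurable_indic.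
    by move=> w; rewrite indicE; case: (_ \in _); rewrite ?normr1 ?normr0.
by rewrite !key// YX.
Qed.

(** * Conditional expectation as projection on the observed blocks *)

Section GaussianConditioning.
Context {R : realType} {d : measure_display} {Omega : measurableType d}.
Context {E : completeNormedModType R}.
Variable mu : probability Omega R.
Hypothesis sepE : separable E.
Variable X : Omega -> E.
Hypothesis gaussX : gaussian mu X.
Variable dim : nat -> nat.
Variable e : forall j : nat, 'I_(dim j) -> dual E.

Let mX : borel_measurable measurable X. Proof. by case: gaussX. Qed.
Let iX : mu.-integrable setT (fun w => `|X w|%:E).
Proof. exact: gaussian_integrable_norm. Qed.

Definition centre (f : dual E) (w : Omega) : R := f (X w - bochner mu X).

Local Notation H := (range centre).
Local Notation B := (inner mu).
Local Notation resid := (resid mu).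
Local Notation proj := (proj mu).

Let centreE f w : centre f w = f (X w) - f (bochner mu X).
Proof. by rewrite /centre linearB. Qed.

Lemma centre_gaussian f : exists v, centred_gaussian mu (centre f) v.
Proof.
have [_ /(_ f)/real_gaussian_centred[m [v cv]]] := gaussX.
exists v; rewrite (_ : centre f = fun w => (f (X w) : R) - m)//.
apply/funext => w; rewrite centreE (dual_bochner sepE f mX iX).
congr (_ - _); apply/eqP; rewrite -subr_eq0 -(centred_gaussian_mean cv).
rewrite RintegralB//; [|exact: integrable_dual|exact: finite_measure_integrable_cst].
by rewrite Rintegral_cst// [X in fine X](probability_setT mu) mulr1.
Qed.

Lemma centre_subspace : subspace_pred H.
Proof.
split.
- by have [h h0] := @dual0 R E; exists h => //; apply/funext => w; rewrite /centre h0.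
- move=> _ _ [f _ <-] [g _ <-]; have [h hE] := dual_comb 1 (-1) f g.
  by exists h => //; apply/funext => w; rewrite /centre hE; ring.
- move=> c _ [f _ <-]; have [h hE] := dual_comb c 0 f f.
  by exists h => //; apply/funext => w; rewrite /centre hE; ring.
Qed.

Lemma centre_gspace u : H u -> exists v, centred_gaussian mu u v.
Proof. by move=> [f _ <-]; exact: centre_gaussian. Qed.

Definition obs j : seq (Omega -> R) := [seq centre (e m) | m <- enum 'I_(dim j)].

(** In the successor branch [obs n] is the block of the full index [n], so the basis covers blocks
    [1] to [n] and block [0] never enters. The predecessor in [innovation] follows the same
    convention. *)
Fixpoint obs_basis n : seq (Omega -> R) :=
  if n is n'.+1 then obs_basis n' ++ gram_schmidt mu (obs_basis n') (obs n) else [::].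

Definition innovation j := gram_schmidt mu (obs_basis j.-1) (obs j).

Lemma size_innovation j : size (innovation j) = dim j.
Proof. by rewrite size_gram_schmidt size_map size_enum_ord. Qed.

Let obsH j : {in obs j, forall h, H h}.
Proof. by move=> _ /mapP[m _ ->]; exists (e m). Qed.

Lemma basis_orthogonal n : orthogonal_seq mu H (obs_basis n).
Proof.
elim: n => [|n IH]; first by split.
exact: (orthogonal_seq_cat centre_subspace centre_gspace IH (@obsH n.+1)).
Qed.

Lemma basisH n : {in obs_basis n, forall h, H h}.
Proof. by case: (basis_orthogonal n). Qed.

Lemma innovationH j : {in innovation j, forall h, H h}.
Proof. exact: (gram_schmidt_subspace centre_subspace (@basisH _) (@obsH j)). Qed.

Lemma basis_cat n k : exists s, obs_basis (n + k) = obs_basis n ++ s.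
Proof.
elim: k => [|k [s IH]]; first by exists [::]; rewrite addn0 cats0.
by rewrite addnS /= IH -catA; eexists.
Qed.

Definition resid_var n u := B (resid (obs_basis n) u) (resid (obs_basis n) u).

Lemma resid_varS n u : H u -> resid_var n.+1 u =
  resid_var n u - \sum_(h <- innovation n.+1) B u h ^+ 2 / B h h.
Proof.
by move=> Hu; exact: (inner_resid_cat centre_subspace centre_gspace (basis_orthogonal n)
  (@obsH n.+1) Hu).
Qed.

Lemma resid_var_ge0 n u : 0 <= resid_var n u.
Proof. exact: inner_ge0. Qed.

Lemma residH n u : H u -> H (resid (obs_basis n) u).
Proof. by move=> Hu; exact: (resid_subspace mu centre_subspace (@basisH n) Hu). Qed.

Lemma projH n u : H (proj (obs_basis n) u).
Proof. exact: (proj_subspace mu u centre_subspace (@basisH n)). Qed.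

Lemma resid_basis_orthogonal n u : H u ->
  {in obs_basis n, forall h, B (resid (obs_basis n) u) h = 0}.
Proof. by have [_] := basis_orthogonal n; exact. Qed.

Let K n u := [set k | H k /\ B (resid (obs_basis n) u) k = 0].

Let subK n u : H u -> subspace_pred (K n u).
Proof. by move=> /(residH n) Hr; exact: (orthogonal_subspace centre_subspace centre_gspace Hr). Qed.

(** The residual is orthogonal to the basis by construction. The observations lie in the span of the
    basis, so they belong to the same orthogonal complement. *)
Let obsK n u j : H u -> (1 <= j <= n)%N -> {in obs j, forall h, K n u h}.
Proof.
move=> Hu /andP[j1 jn].
have Kn : {in obs_basis n, forall h, K n u h}.
  by move=> h hn; split; [exact: basisH hn|exact: resid_basis_orthogonal].
have [s sE] := basis_cat j (n - j); rewrite subnKC// in sE.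
have [j' jE] : exists j', j = j'.+1 by exists j.-1; rewrite prednK.
rewrite jE in sE *; rewrite /= -catA in sE.
apply: (@gram_schmidt_span _ _ _ mu _ (obs_basis j') _ (subK n Hu)).
  by move=> h hj; apply: Kn; rewrite sE mem_cat hj.
by move=> h hj; apply: Kn; rewrite sE !mem_cat hj orbT.
Qed.

Lemma resid_proj_inner n u : H u -> B (resid (obs_basis n) u) (proj (obs_basis n) u) = 0.
Proof.
move=> Hu; have : K n u (proj (obs_basis n) u).
  apply: (proj_subspace mu u (subK n Hu)) => h hn.
  by split; [exact: basisH hn|exact: resid_basis_orthogonal].
by case.
Qed.

Lemma resid_varE n u : H u ->
  resid_var n u = B u u - B (proj (obs_basis n) u) (proj (obs_basis n) u).
Proof.
move=> Hu; have Hp := projH n u; have Hr := residH n Hu.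
have rp := resid_proj_inner n Hu.
have bl := innerBl centre_gspace Hu Hp; have br := innerBr centre_gspace Hu Hp.
have : B (resid (obs_basis n) u) (resid (obs_basis n) u) = B (resid (obs_basis n) u) u.
  by rewrite {2}/resid br// rp subr0.
rewrite /resid_var => ->.
move: rp; rewrite /resid !bl// innerC => /eqP; rewrite subr_eq0 => /eqP <-.
by rewrite innerC.
Qed.

Let gens n := \bigcup_(j in [set j | (1 <= j <= n)%N]) \bigcup_(m in [set: 'I_(dim j)])
  preimage_set_system setT (fun w => e m (X w) : R) measurable.

Let sigma_obs_measurable n : sigma_obs X e n `<=` measurable.
Proof.
apply: smallest_sub; first exact: sigma_algebra_measurable.
move=> _ [j _ [m _ [C mC <-]]]; exact: borel_measurable_dual.
Qed.

Let sub_obs n j (m : 'I_(dim j)) : (1 <= j <= n)%N ->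
  sub_measurable (gens n) (fun w => e m (X w) : R).
Proof.
move=> jn _ C mC; rewrite setTI; apply: sub_sigma_algebra.
by exists j => //; exists m => //; exists C => //; rewrite setTI.
Qed.

Let sub_basis n k : (k <= n)%N -> {in obs_basis k, forall h, sub_measurable (gens n) h}.
Proof.
have sM : @subspace_pred R Omega (sub_measurable (gens n)).
  exact: sub_measurable_subspace.
elim: k => [//|k IH] kn h; rewrite mem_cat => /orP[|]; first exact: IH (ltnW kn) h.
move: h; apply: (@gram_schmidt_subspace _ _ _ mu _ (obs_basis k) (obs k.+1) sM (IH (ltnW kn))).
move=> _ /mapP[m _ ->].
rewrite (_ : centre _ = fun w => (e m (X w) : R) - e m (bochner mu X)); last first.
  by apply/funext => w; rewrite centreE.
have [_ MB _] := sM; apply: MB; last exact: sub_measurable_cst.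
exact: sub_obs.
Qed.

Let sigma_obs_sub n u : H u -> sigma_obs X e n `<=` sigma_of (K n u).
Proof.
move=> Hu; apply: smallest_sub; first exact: smallest_sigma_algebra.
move=> _ [j jn [m _ [C mC <-]]]; apply: sub_sigma_algebra.
exists (centre (e m)).
  by apply: (obsK Hu jn); apply/mapP; exists m => //; rewrite mem_enum.
(* [sigma_obs] is generated by uncentred observations, the orthogonal complement contains centred
   ones; translating the Borel set by [a] reconciles them. *)
pose a : R := e m (bochner mu X).
exists ((fun x => x + a) @^-1` C).
  rewrite -[X in measurable X]setTI.
  by apply: (measurable_funD (@measurable_id _ R setT) (@measurable_cst _ _ _ _ setT a)).
by rewrite !setTI; apply/seteqP; split=> w /=; rewrite centreE /a subrK.
Qed.

Section CondExp.
Variables (Xn : Omega -> E) (n : nat).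
Hypothesis condXn : is_cond_exp mu (sigma_obs X e n) X Xn.

Let iXn : borel_measurable measurable Xn /\ mu.-integrable setT (fun w => `|Xn w|%:E).
Proof. by case: condXn => _ /(bochner_integrable_norm sepE). Qed.

(** The difference of the two sides equals [f (Xn) - f (X)] plus the residual of [centre f]. Over an
    observed event the first part integrates to zero by the definition of conditional expectation,
    the second because the residual is orthogonal to the observations. Measurability of the
    difference then makes it vanish almost surely. *)
Lemma cond_exp_proj (f : dual E) : {ae mu, forall w,
  f (Xn w) - f (bochner mu X) = proj (obs_basis n) (centre f) w :> R}.
Proof.
have [mXn iN] := iXn; have [bXn _ _] := condXn.
pose v w : R := (f (Xn w) - f (bochner mu X)) - proj (obs_basis n) (centre f) w.
have Hf : H (centre f) by exists f.
have sM : @subspace_pred R Omega (sub_measurable (gens n)).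
  exact: sub_measurable_subspace.
have [_ MB _] := sM.
have sv : sub_measurable (gens n) v.
  apply: (MB _ _); last by apply: (proj_subspace mu _ sM); exact: sub_basis.
  apply: (MB _ _); last exact: sub_measurable_cst.
  exact: (@borel_measurable_dual _ (g_sigma_algebraType (gens n)) _ _ Xn f bXn).
have ip := gspace_integrable centre_gspace (projH n (centre f)).
have ifX := integrable_dual f mXn iN.
have ic : mu.-integrable setT (EFin \o (fun=> (f (bochner mu X) : R))).
  exact: finite_measure_integrable_cst.
have iv1 : mu.-integrable setT (EFin \o (fun w => (f (Xn w) : R) - f (bochner mu X))).
  exact: (integrableB measurableT ifX ic).
have iv : mu.-integrable setT (EFin \o v) by exact: (integrableB measurableT iv1 ip).
have : {ae mu, forall w, v w = 0}.
  apply: (sub_measurable_ae0 (sigma_obs_measurable (n := n)) sv iv) => A sA.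
  have [mA rA] := orthogonal_integral0 centre_subspace centre_gspace (residH n Hf)
    (sigma_obs_sub Hf sA).
  have mi : measurable_fun setT (\1_A : Omega -> R) by exact: measurable_indic.
  have i1 w : `|\1_A w : R| <= 1.
    by rewrite indicE; case: (_ \in _); rewrite ?normr1 ?normr0.
  have iM h : mu.-integrable setT (EFin \o h) ->
      mu.-integrable setT (EFin \o (fun w => \1_A w * h w)).
    by move=> ih; exact: (integrable_bounded_mul mi i1 ih).
  have ifX' := integrable_dual f mX iX.
  have ir := gspace_integrable centre_gspace (residH n Hf).
  transitivity (\int[mu]_w (\1_A w * (f (Xn w) : R) - \1_A w * (f (X w) : R) +
      \1_A w * resid (obs_basis n) (centre f) w)).
    by apply: eq_Rintegral => w _; rewrite /v /resid centreE; ring.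
  rewrite RintegralD//; [|exact: (integrableB measurableT (iM _ ifX) (iM _ ifX'))|exact: iM].
  rewrite RintegralB//; [|exact: iM|exact: iM].
  rewrite rA addr0 (cond_exp_dual sepE f mX iX condXn sA mA) subrr//.
by apply: filterS => w /eqP; rewrite subr_eq0 => /eqP.
Qed.

Lemma cond_exp_mean : bochner mu Xn = bochner mu X.
Proof.
have [_ _ /(_ setT)] := condXn.
have sT : sigma_obs X e n setT by exact: (@measurableT _ (g_sigma_algebraType (gens n))).
move=> /(_ sT).
have E1 (W : Omega -> E) : (fun w => (\1_[set: Omega] w : R) *: W w) = W.
  by apply/funext => w; rewrite indicE in_setT scale1r.
by rewrite !E1.
Qed.

Let mXnB : borel_measurable measurable (fun w => Xn w - bochner mu X).
Proof.
have [mXn _] := iXn; apply: (weakly_measurable_borel sepE) => f.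
under eq_fun do rewrite linearB.
by apply: measurable_funB => //; exact: borel_measurable_dual.
Qed.

Let mXB : borel_measurable measurable (fun w => X w - bochner mu X).
Proof.
apply: (weakly_measurable_borel sepE) => f; under eq_fun do rewrite linearB.
by apply: measurable_funB => //; exact: borel_measurable_dual.
Qed.

(** Taking [f] under the Bochner integral requires integrability of [f (Z) Z], whose norm is at most
    [C |Z|^2]; this is the use of Fernique's argument for the covariance. *)
Let dual_cov (Z : Omega -> E) (f : dual E) : borel_measurable measurable Z ->
  (forall g : dual E, exists v, centred_gaussian mu (fun w => g (Z w) : R) v) ->
  f (bochner mu (fun w => (f (Z w) : R) *: Z w)) =
  \int[mu]_w ((f (Z w) : R) * f (Z w)) :> R.
Proof.
move=> mZ gZ; have [C fC] := dual_bounded f.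
have mfZ : borel_measurable measurable (fun w => (f (Z w) : R) *: Z w).
  apply: (weakly_measurable_borel sepE) => g; under eq_fun do rewrite linearZ.
  by apply: measurable_funM; exact: borel_measurable_dual.
rewrite (dual_bochner sepE) //; first by apply: eq_Rintegral => w _; rewrite linearZ.
apply: (@le_integrable _ _ _ mu setT measurableT _
  (fun w => C%:E * (`|Z w| ^+ 2)%:E)%E).
- by apply/measurable_EFinP; exact: borel_measurable_norm.
- move=> w _; rewrite /= lee_fin normr_id normrZ.
  by rewrite (le_trans _ (ler_norm _))// expr2 mulrA ler_wpM2r.
- by apply: integrableZl => //; exact: centred_fernique.
Qed.

(** The two terms are the variances of [centre f] and of its projection, so their difference is the
    residual variance by Pythagoras. The operator norm hypothesis thereby becomes a scalar bound. *)
Lemma dual_cov_diff (f : dual E) :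
  f (cov mu X f - cov mu Xn f) = resid_var n (centre f) :> R.
Proof.
have [mXn iN] := iXn.
have Hf : H (centre f) by exists f.
rewrite linearB /cov cond_exp_mean resid_varE//.
rewrite (dual_cov f mXB centre_gaussian).
rewrite (dual_cov f mXnB); last first.
  move=> g; have [v cv] := centre_gspace (projH n (centre g)).
  exists v; apply: centred_gaussian_ae cv.
    by apply: (borel_measurable_dual g mXnB).
  by have := cond_exp_proj g; apply: filterS => w <-; rewrite linearB.
congr (_ - _); rewrite /inner /Rintegral; congr fine; apply: ae_eq_integral => //.
- by apply/measurable_EFinP/measurable_funM; exact: (borel_measurable_dual f mXnB).
- apply/measurable_EFinP/measurable_funM;
    exact: (gspace_measurable centre_gspace (projH n (centre f))).
- have := cond_exp_proj f; apply: filterS => w + _ => <-.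
  by rewrite linearB.
Qed.

Lemma resid_var_le (f : dual E) (c : R) : (dual_norm f <= 1)%E ->
  (opnorm (fun f => cov mu X f - cov mu Xn f)%R <= c%:E)%E ->
  resid_var n (centre f) <= c.
Proof.
move=> f1 cle; rewrite -dual_cov_diff -lee_fin.
apply: le_trans cle; apply: (@le_trans _ _ (`|cov mu X f - cov mu Xn f|)%:E).
  rewrite lee_fin; apply: (le_trans (ler_norm _)); exact: dual_normP.
by apply: ereal_sup_ubound; exists f.
Qed.

Lemma cond_exp_resid (f : dual E) : {ae mu, forall w,
  f (X w - Xn w) = resid (obs_basis n) (centre f) w :> R}.
Proof.
have := cond_exp_proj f; apply: filterS => w h.
by rewrite /resid -h centreE linearB/=; ring.
Qed.

End CondExp.

End GaussianConditioning.

(** * Tail bound *)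

Section RealSeries.
Context {R : realType}.
Implicit Types (u a c v : nat -> R).

Lemma summable_from_shift k m u : (k <= m)%N -> summable_from k u -> summable_from m u.
Proof.
move=> km /cvg_ex[l ul]; apply/cvg_ex.
exists (l - \sum_(k <= j < m) u j).
have : (fun N => \sum_(k <= j < N) u j - \sum_(k <= j < m) u j) @ \oo -->
    l - \sum_(k <= j < m) u j by apply: cvgB => //; exact: cvg_cst.
apply: cvg_trans; apply: near_eq_cvg; near=> N.
rewrite (@big_cat_nat _ _ _ m k N)//=; first by rewrite addrAC subrr add0r.
by near: N; exact: nbhs_infty_ge.
Unshelve. all: by end_near. Qed.

Lemma le_sum_from k u N : summable_from k u -> (forall j, (k <= j)%N -> 0 <= u j) ->
  \sum_(k <= j < N) u j <= sum_from k u.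
Proof.
move=> cu u0; apply: nondecreasing_cvgn_le => //.
apply/nondecreasing_seqP => M.
have [kM|Mk] := leqP k M; first by rewrite big_nat_recr//= lerDl u0.
by rewrite !big_geq// ltnW.
Qed.

(** With the boundary term included, the left side is [a_n v_n] plus the sum of
    [(a_{j+1} - a_j) v_j] for [n <= j < n + k]. All coefficients are nonnegative, so replacing [v]
    by the larger [c] can only increase it. *)
Lemma abel_partial a c v n k : (forall i j, (1 <= i <= j)%N -> a i <= a j) ->
  (forall j, (1 <= j)%N -> 0 < a j) -> (1 <= n)%N ->
  (forall j, (n <= j)%N -> v j <= c j) ->
  \sum_(n.+1 <= j < n.+1 + k) a j * (v j.-1 - v j) + a (n + k)%N * v (n + k)%N <=
  \sum_(n.+1 <= j < n.+1 + k) a j * (c j.-1 - c j) + a (n + k)%N * c (n + k)%N.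
Proof.
move=> amono apos n1 vc; elim: k => [|k IH].
  rewrite !addn0 !big_geq// !add0r ler_wpM2l// ?vc//.
  by rewrite ltW// apos.
have recr u : \sum_(n.+1 <= j < (n + k).+2) u j =
    \sum_(n.+1 <= j < (n + k).+1) u j + u (n + k).+1.
  by rewrite big_nat_recr//= ltnS leq_addr.
rewrite addSn in IH; rewrite !addnS addSn !recr/=.
have a12 : a (n + k)%N <= a (n + k).+1 by apply: amono; rewrite addn_gt0 n1 leqnSn.
have := ler_wpM2r (_ : 0 <= c (n + k)%N - v (n + k)%N) a12.
rewrite subr_ge0 vc ?leq_addr// => /(_ isT).
lra.
Qed.

Lemma abel_bound a c v n N : (forall i j, (1 <= i <= j)%N -> a i <= a j) ->
  (forall j, (1 <= j)%N -> 0 < a j) -> (1 <= n)%N ->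
  (forall j, (n <= j)%N -> 0 <= v j <= c j) ->
  (forall j, v j.+1 <= v j) ->
  summable_from n.+1 (fun j => a j * (c j.-1 - c j)) ->
  (fun j => a j * c j) @ \oo --> (0 : R) ->
  \sum_(n.+1 <= j < N) a j * (v j.-1 - v j) <=
  sum_from n.+1 (fun j => a j * (c j.-1 - c j)).
Proof.
move=> amono apos n1 vc vdec cs ac0.
set S := fun N => \sum_(n.+1 <= j < N) a j * (v j.-1 - v j).
have nd : nondecreasing_seq S.
  apply/nondecreasing_seqP => M; rewrite /S.
  have [kM|Mk] := leqP n.+1 M; last by rewrite !big_geq// ltnW.
  rewrite big_nat_recr//= lerDl mulr_ge0//.
    by rewrite ltW// apos// (leq_trans _ kM).
  by rewrite subr_ge0; case: M kM => [//|M] _ /=.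
have cl : (fun M => \sum_(n.+1 <= j < M.+1) a j * (c j.-1 - c j) + a M * c M) @ \oo -->
    sum_from n.+1 (fun j => a j * (c j.-1 - c j)) + 0.
  apply: cvgD => //.
  by rewrite (cvg_shiftS (fun M => \sum_(n.+1 <= j < M) a j * (c j.-1 - c j))); exact: cs.
rewrite addr0 in cl.
rewrite -(cvg_lim _ cl)//; apply: limr_ge; first by apply/cvg_ex; eexists; exact: cl.
near=> M.
have nM : (n <= M)%N by near: M; exact: nbhs_infty_ge.
have NM : (N <= M)%N by near: M; exact: nbhs_infty_ge.
apply: (@le_trans _ _ (S M.+1)); first by apply: nd; rewrite leqW.
have := abel_partial (M - n) amono apos n1 (fun j nj => (andP (vc j nj)).2).
rewrite addSn subnKC//; apply: le_trans; rewrite lerDl mulr_ge0//.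
  by rewrite ltW// apos// (leq_trans n1).
by case/andP: (vc M nM).
Unshelve. all: by end_near. Qed.

(** The choice [l = |T| / S] balances the two terms and recovers Cauchy-Schwarz. *)
Lemma sqr_le_of_amgm (T S Q : R) : 0 <= S -> 0 <= Q ->
  (forall l, 0 < l -> 2 * `|T| <= l * S + l^-1 * Q) -> T ^+ 2 <= S * Q.
Proof.
move=> S0 Q0 H; rewrite -real_normK ?num_real//.
have [->|T0] := eqVneq `|T| 0; first by rewrite expr0n mulr_ge0.
have {}T0 : 0 < `|T| by rewrite lt_def T0/=.
set t := `|T| in H T0 *.
move: S0; rewrite le_eqVlt => /predU1P[S0|S0].
  (* For [S = 0] this [l] gives [2 t <= t Q / (Q + 1)], which contradicts [t > 0]. *)
  have l0 : 0 < (Q + 1) / t by rewrite divr_gt0// ltr_wpDl.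
  have := H _ l0; rewrite -S0 mulr0 add0r invf_div mulrAC.
  rewrite ler_pdivlMr; last by rewrite ltr_wpDl.
  have := mulr_ge0 (ltW T0) Q0; nra.
have l0 : 0 < t / S by rewrite divr_gt0.
have := H _ l0; rewrite divfK ?gt_eqF// invf_div => h.
have : t <= S / t * Q by lra.
rewrite mulrAC ler_pdivlMr// -expr2//.
Qed.

(** Weighted Cauchy-Schwarz in which [beta i = 0] is allowed: the quotient convention then makes all
    three terms of index [i] vanish. *)
Lemma sum_amgm (I : Type) (s : seq I) (a b beta h : I -> R) :
  (forall i, 0 < a i) -> (forall i, 0 <= beta i) ->
  (\sum_(i <- s) b i / beta i * h i) ^+ 2 <=
  (\sum_(i <- s) a i * (b i ^+ 2 / beta i)) * \sum_(i <- s) h i ^+ 2 / beta i / a i.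
Proof.
move=> a0 beta0; apply: sqr_le_of_amgm.
- by apply: sumr_ge0 => i _; rewrite mulr_ge0 ?(ltW (a0 i))// divr_ge0// sqr_ge0.
- by apply: sumr_ge0 => i _; rewrite !divr_ge0 ?(ltW (a0 i))// sqr_ge0.
move=> l l0; apply: (@le_trans _ _ (2 * \sum_(i <- s) `|b i / beta i * h i|)).
  by rewrite ler_pM2l// ler_norm_sum.
rewrite !mulr_sumr -big_split/=; apply: ler_sum => i _.
have [b0|bn0] := eqVneq (beta i) 0.
  by rewrite b0 invr0 !(mulr0, mul0r) normr0 mulr0 addr0.
have bp : 0 < beta i by rewrite lt_def bn0 beta0.
have la : 0 < l * a i by rewrite mulr_gt0.
have -> : b i / beta i * h i = b i * h i / beta i by ring.
have -> : l * (a i * (b i ^+ 2 / beta i)) + l^-1 * (h i ^+ 2 / beta i / a i) =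
    ((l * a i) * b i ^+ 2 + (l * a i)^-1 * h i ^+ 2) / beta i by rewrite invfM; ring.
rewrite normrM [X in _ * (_ * X)]ger0_norm ?invr_ge0// mulrA ler_pM2r ?invr_gt0//.
rewrite -(ler_pM2l la) mulrDr [X in _ <= _ + X]mulrA divff ?gt_eqF// mul1r normrM.
have := sqr_ge0 (l * a i * `|b i| - `|h i|).
rewrite -(real_normK (num_real (b i))) -(real_normK (num_real (h i))).
lra.
Qed.

End RealSeries.

(** * Exponential tail of a weighted sum *)

Section Tail.
Context {d : measure_display} {Omega : measurableType d} {R : realType}.
Variable mu : probability Omega R.

Lemma markov_bound (f : Omega -> R) (c : R) (A : set Omega) : measurable A ->
  measurable_fun setT f -> (forall w, 0 <= f w) -> 0 <= c ->
  (forall w, A w -> c <= f w) -> (c%:E * mu A <= \int[mu]_w (f w)%:E)%E.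
Proof.
move=> mA mf f0 c0 cf.
rewrite -[X in mu X]setIT -integral_indic// -ge0_integralZl//=.
- apply: ge0_le_integral => //=.
  + by move=> w _; rewrite -EFinM lee_fin mulr_ge0.
  + by apply/measurable_EFinP/measurable_funM => //; exact: measurable_indic.
  + exact/measurable_EFinP.
  + move=> w _; rewrite -EFinM lee_fin indicE.
    by case: (boolP (w \in A)) => [/set_mem/cf|_]; rewrite ?mulr1// mulr0.
- by apply/measurable_EFinP; exact: measurable_indic.
Qed.

(* Jensen's inequality for the weights [1 / a i] replaces independence. *)
Lemma weighted_tail (I : eqType) (s : seq I) (a : I -> R) (q : I -> Omega -> R) (K : R) :
  (forall i, 0 < a i) -> 0 < \sum_(i <- s) (a i)^-1 ->
  {in s, forall i, measurable_fun setT (q i)} ->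
  {in s, forall i, (\int[mu]_w (expR (2 / 5 * q i w))%:E <= (Num.sqrt 5)%:E)%E} ->
  (mu [set w | (K * \sum_(i <- s) (a i)^-1 < \sum_(i <- s) q i w / a i)%R] <=
   (Num.sqrt 5 * expR (- (2 / 5 * K)))%:E)%E.
Proof.
move=> a0; set D := \sum_(i <- s) _ => D0 mq iq.
(* Extension by zero turns measurability on the list into measurability for every index. *)
pose g i w : R := if i \in s then q i w else 0.
have mg i : measurable_fun setT (g i).
  by rewrite /g; case: (boolP (i \in s)) => [si|_]; [exact: mq|exact: measurable_cst].
have mE i : measurable_fun setT (fun w => expR (2 / 5 * g i w)).
  by apply: measurableT_comp => //; exact: measurable_funM.
have gq w : \sum_(i <- s) q i w / a i = \sum_(i <- s) g i w / a i.
  by rewrite [LHS]big_seq [RHS]big_seq; apply: eq_bigr => i si; rewrite /g si.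
have msum : measurable_fun setT (fun w => \sum_(i <- s) g i w / a i).
  by apply: measurable_sum => i; exact: measurable_funM.
set A := [set w | _].
have mA : measurable A.
  rewrite (_ : A = (fun w => \sum_(i <- s) g i w / a i) @^-1` `]K * D, +oo[%classic).
    by rewrite -[X in measurable X]setTI; exact: msum.
  by apply/seteqP; split=> w; rewrite /A/= in_itv/= andbT gq.
pose f w : R := \sum_(i <- s) (a i)^-1 * expR (2 / 5 * g i w).
have mf : measurable_fun setT f.
  by apply: measurable_sum => i; exact: measurable_funM.
have f0 w : 0 <= f w.
  by apply: sumr_ge0 => i _; rewrite mulr_ge0 ?expR_ge0// invr_ge0 ltW.
have fA w : A w -> expR (2 / 5 * K) * D <= f w.
  rewrite /A/= gq => KQ.
  (* Each exponential is bounded below by its tangent at [K]; after weighting, the sum of the linear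
     terms is nonnegative on [A]. *)
  apply: (@le_trans _ _ (\sum_(i <- s) (a i)^-1 *
      (expR (2 / 5 * K) * (1 + 2 / 5 * (g i w - K))))).
    have -> : \sum_(i <- s) (a i)^-1 * (expR (2 / 5 * K) * (1 + 2 / 5 * (g i w - K))) =
        expR (2 / 5 * K) * (D + 2 / 5 * (\sum_(i <- s) g i w / a i - K * D)).
      rewrite mulrDr mulrBr mulrBr /D !mulr_sumr -sumrB -big_split/=.
      by apply: eq_bigr => i _; ring.
    by rewrite ler_pM2l ?expR_gt0// lerDl mulr_ge0// subr_ge0 ltW.
  apply: ler_sum => i _; rewrite ler_pM2l ?invr_gt0//.
  rewrite (_ : 2 / 5 * g i w = 2 / 5 * K + 2 / 5 * (g i w - K)); last by ring.
  by rewrite expRD ler_pM2l ?expR_gt0// expR_ge1Dx.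
have c0 : 0 < expR (2 / 5 * K) * D by rewrite mulr_gt0 ?expR_gt0.
have := markov_bound mA mf f0 (ltW c0) fA.
have -> : (\int[mu]_w (f w)%:E = \sum_(i <- s) ((a i)^-1)%:E *
    \int[mu]_w (expR (2 / 5 * g i w))%:E)%E.
  rewrite /f; under eq_integral do rewrite -sumEFin.
  rewrite ge0_integral_sum//; last 2 first.
  - by move=> i; apply/measurable_EFinP; exact: measurable_funM.
  - by move=> i w _; rewrite lee_fin mulr_ge0 ?expR_ge0// invr_ge0 ltW.
  apply: eq_bigr => i _; under eq_integral do rewrite EFinM.
  rewrite ge0_integralZl//; first exact/measurable_EFinP.
  by rewrite lee_fin invr_ge0 ltW.
move=> h.
have {}h : ((expR (2 / 5 * K) * D)%:E * mu A <= (D * Num.sqrt 5)%:E)%E.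
  apply: (le_trans h); rewrite /D mulr_suml -sumEFin !big_seq.
  apply: lee_sum => i si; rewrite EFinM lee_wpmul2l ?lee_fin ?invr_ge0 ?(ltW (a0 i))//.
  by rewrite /g si; exact: iq.
have muA : mu A = (fine (mu A))%:E by rewrite fineK// fin_num_measure.
move: h; rewrite muA -EFinM !lee_fin => h.
rewrite expRN ler_pdivlMr ?expR_gt0//.
rewrite -(ler_pM2l D0); apply: le_trans h.
by rewrite le_eqVlt; apply/orP; left; apply/eqP; ring.
Qed.

End Tail.

(** * Decomposition into innovation blocks and the tail of the norm *)

Section RankDecomposition.
Context {R : realType} {d : measure_display} {Omega : measurableType d}.
Context {E : completeNormedModType R}.
Variable mu : probability Omega R.
Hypothesis sepE : separable E.
Variable X : Omega -> E.
Hypothesis gaussX : gaussian mu X.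
Variable dim : nat -> nat.
Hypothesis dim_gt0 : forall j, (1 <= j)%N -> (0 < dim j)%N.
Variable e : forall j : nat, 'I_(dim j) -> dual E.
Variable Xn : nat -> Omega -> E.
Hypothesis condXn :
  forall n, (1 <= n)%N -> is_cond_exp mu (sigma_obs X e n) X (Xn n).
Variables a c : nat -> R.
Hypothesis c_decr : forall i j, (1 <= i <= j)%N -> c j <= c i.
Hypothesis cov_le : forall n, (1 <= n)%N ->
  (opnorm (fun f => cov mu X f - cov mu (Xn n) f)%R <= (c n)%:E)%E.
Hypothesis a_incr : forall i j, (1 <= i <= j)%N -> a i <= a j.
Hypothesis a_gt0 : forall j, (1 <= j)%N -> 0 < a j.
Hypothesis sum_dim : summable_from 1 (fun j => (dim j)%:R / a j).
Hypothesis sum_c : summable_from 2 (fun j => a j * (c j.-1 - c j)).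
Hypothesis ac0 : (fun j => a j * c j) @ \oo --> (0 : R).
Variable n : nat.
Hypothesis n1 : (1 <= n)%N.

Local Notation B := (inner mu).
Local Notation H := (range (centre mu X)).
Local Notation basis := (obs_basis mu X e).
Local Notation innov := (innovation mu X e).
Local Notation resid_var := (resid_var mu X e).

Let S := sum_from n.+1 (fun j => a j * (c j.-1 - c j)).
Let D := sum_from n.+1 (fun j => (dim j)%:R / a j).

Let gH := centre_gspace sepE gaussX.
Let sH := centre_subspace mu X.

Let sum_c' : summable_from n.+1 (fun j => a j * (c j.-1 - c j)).
Proof. exact: summable_from_shift sum_c. Qed.

Let sum_dim' : summable_from n.+1 (fun j => (dim j)%:R / a j).
Proof. exact: summable_from_shift sum_dim. Qed.

Lemma c_ge0 j : (1 <= j)%N -> 0 <= c j.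
Proof.
move=> j1; rewrite -lee_fin; apply: le_trans (cov_le j1).
have [h h0] := @dual0 R E.
apply: (@le_trans _ _ (`|cov mu X h - cov mu (Xn j) h|)%:E); first by rewrite lee_fin.
apply: ereal_sup_ubound; exists h => //=.
by apply: dual_norm_le1 => x; rewrite h0 normr0.
Qed.

(** The bound [a j >= a 1 > 0] allows division of [a j * c j]. *)
Lemma c_cvg0 : c @ \oo --> (0 : R).
Proof.
have a1 : 0 < a 1 by exact: a_gt0.
have l0 : (fun j => (a 1)^-1 * `|a j * c j|) @ \oo --> (0 : R).
  rewrite -[X in _ --> X](mulr0 (a 1)^-1) -(@normr0 _ R).
  by apply: cvgMr; exact: cvg_norm.
apply: (@squeeze_cvgr _ _ _ _ (fun=> 0) _ _ _ _ (@cvg_cst _ _ _ _ _) l0).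
near=> j; have j1 : (1 <= j)%N by near: j; exact: nbhs_infty_ge.
have cj := c_ge0 j1; rewrite cj/= ger0_norm; last by rewrite mulr_ge0// ltW// a_gt0.
by rewrite ler_pdivlMl// ler_wpM2r// a_incr// j1.
Unshelve. all: by end_near. Qed.

Let resid_var_bound (f : dual E) j : (dual_norm f <= 1)%E -> (1 <= j)%N ->
  0 <= resid_var j (centre mu X f) <= c j.
Proof.
move=> f1 j1; rewrite resid_var_ge0/=.
exact: (resid_var_le sepE gaussX (condXn j1) f1 (cov_le j1)).
Qed.

(** The value [1] at index [0] makes the weight positive on all pairs; the list [L] only contains
    indices above [n]. *)
Let wa (p : nat * (Omega -> R)) : R := if (1 <= p.1)%N then a p.1 else 1.

Let wa_gt0 p : 0 < wa p.
Proof. by rewrite /wa; case: ifP => [/a_gt0//|_]; exact: ltr01. Qed.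

Let L N := [seq (j, h) | j <- index_iota n.+1 N, h <- innov j].

Let sumL (F : nat * (Omega -> R) -> R) N : \sum_(p <- L N) F p =
  \sum_(n.+1 <= j < N) \sum_(h <- innov j) F (j, h).
Proof. by rewrite big_allpairs_dep. Qed.

Let L_H N : {in L N, forall p, H p.2}.
Proof.
move=> _ /allpairsPdep[j [h [_ hj ->]]] /=.
exact: (innovationH sepE gaussX hj).
Qed.

Let rank_sum N : \sum_(p <- L N) (wa p)^-1 = \sum_(n.+1 <= j < N) (dim j)%:R / a j.
Proof.
rewrite sumL; apply: eq_big_nat => j /andP[nj _].
rewrite /wa /= (leq_trans _ nj)// big_const_seq count_predT size_innovation.
by rewrite iter_addr_0 mulr_natl.
Qed.

Let rank_sum_le N : \sum_(p <- L N) (wa p)^-1 <= D.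
Proof.
rewrite rank_sum; apply: le_sum_from => // j nj.
by rewrite divr_ge0// ltW// a_gt0// (leq_trans _ nj).
Qed.

Let variance_sum (f : dual E) N : (dual_norm f <= 1)%E ->
  \sum_(p <- L N) wa p * (B (centre mu X f) p.2 ^+ 2 / B p.2 p.2) <= S.
Proof.
move=> f1; pose v j := resid_var j (centre mu X f).
have Hf : H (centre mu X f) by exists f.
have vS j : v j.+1 = v j - \sum_(h <- innov j.+1) B (centre mu X f) h ^+ 2 / B h h.
  exact: (resid_varS sepE gaussX).
have -> : \sum_(p <- L N) wa p * (B (centre mu X f) p.2 ^+ 2 / B p.2 p.2) =
    \sum_(n.+1 <= j < N) a j * (v j.-1 - v j).
  rewrite sumL; apply: eq_big_nat => -[//|j] _.
  by rewrite /wa /= vS subKr mulr_sumr.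
apply: abel_bound => //.
- by move=> j nj; apply: resid_var_bound => //; exact: leq_trans nj.
- move=> j; rewrite vS gerBl; apply: sumr_ge0 => h _.
  by rewrite divr_ge0 ?sqr_ge0// inner_ge0.
Qed.

Let proj_basis_add u k w : proj mu (basis (n + k)) u w = proj mu (basis n) u w +
  \sum_(n.+1 <= j < (n + k).+1) \sum_(h <- innov j) B u h / B h h * h w.
Proof.
elim: k => [|k IH]; first by rewrite addn0 big_geq ?addr0.
rewrite addnS big_nat_recr ?ltnS ?leq_addr//= addrA -IH.
exact: proj_cat.
Qed.

(** [L N] stops at block [N - 1], as sums over [n.+1 <= j < N] do, which accounts for the
    predecessor in the basis. *)
Let proj_basis_sum u N w : (n < N)%N -> proj mu (basis N.-1) u w =
  proj mu (basis n) u w + \sum_(p <- L N) B u p.2 / B p.2 p.2 * p.2 w.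
Proof.
case: N => [//|N]; rewrite ltnS => nN /=.
by have := proj_basis_add u (N - n) w; rewrite subnKC// sumL.
Qed.

Let Q N w := \sum_(p <- L N) p.2 w ^+ 2 / B p.2 p.2 / wa p.

Let resid_diff (f : dual E) N w : (dual_norm f <= 1)%E -> (n < N)%N ->
  (resid mu (basis n) (centre mu X f) w - resid mu (basis N.-1) (centre mu X f) w) ^+ 2
  <= S * Q N w.
Proof.
move=> f1 nN; rewrite /resid opprB addrC addrA subrK proj_basis_sum// addrAC subrr add0r.
apply: (le_trans (sum_amgm _ _ _ wa_gt0 _)); first by move=> p; exact: inner_ge0.
apply: ler_wpM2r; last exact: variance_sum.
apply: sumr_ge0 => p _; rewrite !divr_ge0 ?sqr_ge0 ?inner_ge0//.
exact: ltW.
Qed.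

Let innovation_expR N : {in L N, forall p,
  (\int[mu]_w (expR (2 / 5 * (p.2 w ^+ 2 / B p.2 p.2)))%:E <= (Num.sqrt 5)%:E)%E}.
Proof.
move=> p /L_H Hp; have gp := gspace_gaussian gH Hp.
(* A degenerate innovation contributes the constant [expR 0 = 1], which is below [Num.sqrt 5]; for
   the others there is equality. *)
have [b0|b0] := eqVneq (B p.2 p.2) 0.
  under eq_integral do rewrite b0 invr0 mulr0 mulr0 expR0.
  rewrite integral_cst// [X in (_ * X)%E](probability_setT mu) mule1 lee_fin.
  by rewrite -[leLHS]sqrtr1 ler_sqrt// ler1n.
set b := B p.2 p.2 in gp b0 *.
have bp : 0 < b by rewrite lt_def b0 inner_ge0.
have gs : centred_gaussian mu (fun w => (Num.sqrt b)^-1 * p.2 w) 1.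
  have [mp _ cp] := gp; split=> // [|t]; first exact: measurable_funM.
  have [cp1 cp2] := cp (t / Num.sqrt b).
  split.
    rewrite (_ : 1 * t ^+ 2 / 2 = b * (t / Num.sqrt b) ^+ 2 / 2).
      by rewrite -cp1; apply: eq_Rintegral => w _; rewrite mulrA.
    by rewrite expr_div_n sqr_sqrtr ?(ltW bp)//; field.
  by rewrite -[RHS]cp2; apply: eq_Rintegral => w _; rewrite mulrA.
rewrite -(centred_gaussian_expR_sqr gs) le_eqVlt; apply/orP; left; apply/eqP.
apply: eq_integral => w _; congr (expR (_ * _))%:E.
by rewrite exprMn exprVn sqr_sqrtr ?(ltW bp)// mulrC.
Qed.

Let tail_Q N K : (n.+1 < N)%N ->
  (mu [set w | (K * \sum_(p <- L N) (wa p)^-1 < Q N w)%R] <=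
   (Num.sqrt 5 * expR (- (2 / 5 * K)))%:E)%E.
Proof.
move=> nN; apply: weighted_tail => //.
(* As [n.+1 < N], block [n.+1] is present, and its positive dimension makes the total weight
   positive. *)
- rewrite rank_sum big_ltn// ltr_pwDl//.
    by rewrite divr_gt0 ?ltr0n ?dim_gt0// a_gt0.
  rewrite big_nat; apply: sumr_ge0 => j /andP[nj _].
  by rewrite divr_ge0// ltW// a_gt0// (leq_trans _ nj).
- move=> p /L_H Hp; apply: measurable_funM => //; apply: measurable_funX.
  exact: (gspace_measurable gH).
Qed.

Let m_resid (f : dual E) N : measurable_fun setT (resid mu (basis N) (centre mu X f)).
Proof.
by apply: (gspace_measurable gH); apply: (residH sepE gaussX); exists f.
Qed.

Let m_gt (u : Omega -> R) r : measurable_fun setT u -> measurable [set w | r < u w].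
Proof.
move=> mu_; rewrite (_ : mkset _ = u @^-1` `]r, +oo[%classic).
  by rewrite -[X in measurable X]setTI; exact: mu_.
by apply/seteqP; split=> w /=; rewrite in_itv/= andbT.
Qed.

Let m_Q N : measurable_fun setT (Q N).
Proof.
rewrite /Q; under eq_fun do rewrite big_seq.
under eq_fun do rewrite -big_filter.
have HL p : p \in [seq i <- L N | i \in L N] -> H p.2.
  by rewrite mem_filter => /andP[/L_H].
elim: [seq i <- _ | _] HL => [|p s IH] HL.
  by under eq_fun do rewrite big_nil; exact: measurable_cst.
under eq_fun do rewrite big_cons.
apply: measurable_funD; last by apply: IH => q qs; apply: HL; rewrite in_cons qs orbT.
apply: measurable_funM => //; apply: measurable_funM => //; apply: measurable_funX.
by apply: (gspace_measurable gH); apply: HL; rewrite mem_head.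
Qed.

Let tail_resid (f : dual E) N (eps : R) : (dual_norm f <= 1)%E -> (1 <= N)%N -> 0 < eps ->
  (mu [set w | (eps < `|resid mu (basis N) (centre mu X f) w|)%R] <=
   (c N / eps ^+ 2)%:E)%E.
Proof.
move=> f1 N1 e0; pose u := resid mu (basis N) (centre mu X f); set A := [set w | _].
have mA : measurable A by apply: m_gt; apply: measurableT_comp => //; exact: m_resid.
have Hu : H u by apply: (residH sepE gaussX); exists f.
have e2 : 0 < eps ^+ 2 by rewrite exprn_gt0.
have := @markov_bound _ _ _ mu (fun w => u w ^+ 2) (eps ^+ 2) A mA.
have -> : (\int[mu]_w (u w ^+ 2)%:E = (resid_var N (centre mu X f))%:E)%E.
  rewrite -[resid_var N _]/(B u u) /inner /Rintegral fineK.
    by apply: eq_integral => w _; rewrite expr2.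
  by apply: integrable_fin_num => //; exact: (gspace_mul gH Hu Hu).
move=> h.
have {h} : ((eps ^+ 2)%:E * mu A <= (resid_var N (centre mu X f))%:E)%E.
  apply: h => [|w||w Aw]; [|exact: sqr_ge0|exact: ltW|].
    by apply: measurable_funX; exact: m_resid.
  by rewrite -[leRHS]real_normK ?num_real// ler_sqr ?nnegrE ?(ltW e0)// (ltW Aw).
have muA : mu A = (fine (mu A))%:E by rewrite fineK// fin_num_measure.
rewrite muA -EFinM !lee_fin ler_pdivlMr// mulrC => /le_trans; apply.
by have /andP[] := resid_var_bound f1 N1.
Qed.

Section TailBound.
Variable tau : R.

(** The factor [5] turns the exponent [2 / 5 * K] into [2 max(1, tau)], which is at least [1 + tau];
    the surplus [1] pays for [Num.sqrt 5 < expR 1]. *)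
Let K : R := 5 * Num.max 1 tau.
Let r := Num.sqrt (K * S * D).
Let delta : R := Num.sqrt 5 * expR (- (2 / 5 * K)).

Let S_ge0 : 0 <= S.
Proof.
have := le_sum_from n.+1 sum_c'; rewrite big_geq//; apply.
move=> j nj; rewrite mulr_ge0 ?subr_ge0//.
  by rewrite ltW// a_gt0// (leq_trans _ nj).
by case: j nj => [//|j] nj /=; apply: c_decr; rewrite leqnSn (leq_trans n1).
Qed.

Let K_ge0 : 0 <= K. Proof. by rewrite mulr_ge0// le_max ler01. Qed.

(** The event that [Q] is large does not involve [k] and is charged once. Only the residuals at
    level [N] are summed over the [m] functionals, at a cost [m c_N / eps^2] that tends to [0] with
    [m] and [eps] fixed. *)
Let finite_tail (F : nat -> dual E) m (eps : R) : 0 < eps ->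
  (forall k, (dual_norm (F k) <= 1)%E) ->
  (mu (\bigcup_(k in `I_m)
    [set w | (r + eps < resid mu (basis n) (centre mu X (F k)) w)%R]) <= delta%:E)%E.
Proof.
move=> e0 F1; set A := \bigcup_(k in _) _.
have mA : measurable A.
  by apply: fin_bigcup_measurable => // k _; apply: m_gt; exact: m_resid.
have bnd N : (n < N)%N -> (mu A <= (delta + m%:R * (c N / eps ^+ 2))%:E)%E.
  move=> nN.
  pose U k := [set w | eps < `|resid mu (basis N) (centre mu X (F k)) w|].
  pose V := [set w | K * \sum_(p <- L N.+1) (wa p)^-1 < Q N.+1 w].
  have mU k : measurable (U k).
    by apply: m_gt; apply: measurableT_comp => //; exact: m_resid.
  have mV : measurable V by apply: m_gt; exact: m_Q.
  have sub : A `<=` V `|` \big[setU/set0]_(k < m) U k.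
    move=> w [k /= km rw]; have [Vw|nV] := pselect (V w); [by left|right].
    rewrite -bigcup_mkord; exists k => //=; rewrite /U /=.
    have d2 := resid_diff w (F1 k) (ltnW nN : n < N.+1)%N; rewrite /= in d2.
    set x := resid mu (basis n) _ w in rw d2 *.
    set y := resid mu (basis N) _ w in d2 *.
    rewrite ltNge; apply/negP => yeps.
    (* Outside [V] the difference of the two residuals is at most [r], so an excess above [r + eps]
       at level [n] forces the residual at level [N] above [eps]. *)
    have : x - y <= r.
      apply: (le_trans (ler_norm _)); rewrite -sqrtr_sqr ler_wsqrtr//.
      apply: (le_trans d2).
      rewrite -mulrA mulrCA; apply: ler_wpM2l => //.
      move/negP : nV; rewrite /V/= -leNgt => /le_trans; apply.
      by apply: ler_wpM2l => //; exact: rank_sum_le.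
    have := ler_norm y; lra.
  have mUm : measurable (\big[setU/set0]_(k < m) U k) by exact: bigsetU_measurable.
  apply: (le_trans (le_measure mu (mem_set mA) (mem_set (measurableU _ _ mV mUm)) sub)).
  apply: (le_trans (measureU2 _ mV mUm)).
  rewrite EFinD leeD//; first by apply: tail_Q; rewrite ltnS.
  apply: (@le_trans _ _ (\sum_(k < m) mu (U k))%E); first exact: Boole_inequality.
  apply: (@le_trans _ _ (\sum_(k < m) (c N / eps ^+ 2)%:E)%E).
    apply: lee_sum => k _; apply: tail_resid => //.
    exact: leq_trans (ltnW nN).
  rewrite sumEFin lee_fin sumr_const card_ord mulr_natl//.
have muA : mu A = (fine (mu A))%:E by rewrite fineK// fin_num_measure.
rewrite muA lee_fin.
have lim0 : (fun N => delta + m%:R * (c N / eps ^+ 2)) @ \oo --> (delta + m%:R * (0 / eps ^+ 2) : R).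
  by apply: cvgD; [exact: cvg_cst|apply: cvgMr; apply: cvgMl; exact: c_cvg0].
rewrite mul0r mulr0 addr0 in lim0.
rewrite -(cvg_lim _ lim0)//; apply: limr_ge; first by apply/cvg_ex; eexists; exact: lim0.
near=> N; rewrite -lee_fin -muA; apply: bnd.
by near: N; exact: nbhs_infty_gt.
Unshelve. all: by end_near. Qed.

Let delta_lt : delta < expR (- tau).
Proof.
(* Via [sqrt 5 < 9/4 = (3/2)^2] and [3/2 <= expR 2^-1]. The strictness here is the source of the
   strict inequality in the result. *)
have s5 : Num.sqrt 5 < expR 1 :> R.
  have e1 : 9 / 4 <= expR 1 :> R.
    have -> : expR 1 = expR 2^-1 * expR 2^-1 :> R by rewrite -expRD; congr expR; field.
    have := expR_ge1Dx (2^-1 : R) => h.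
    have : (3 / 2) * (3 / 2) <= expR 2^-1 * expR 2^-1 :> R by apply: ler_pM; lra.
    lra.
  apply: lt_le_trans e1.
  rewrite -[ltRHS]ger0_norm// -sqrtr_sqr ltr_sqrt; lra.
rewrite /delta /K.
set M := Num.max 1 tau.
have M1 : 1 <= M by rewrite le_max lexx.
have Mt : tau <= M by rewrite le_max lexx orbT.
have : expR (- (2 / 5 * (5 * M))) <= expR (- tau) * expR (- 1).
  by rewrite -expRD ler_expR; lra.
move=> /(ler_wpM2l (sqrtr_ge0 5)) /le_lt_trans; apply.
rewrite mulrCA gtr_pMr ?expR_gt0// expRN ltr_pdivrMr ?expR_gt0// mul1r//.
Qed.

Lemma norm_tail : ((1 - expR (- tau))%:E < mu [set w | (`|X w - Xn n w| <= r)%R])%E.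
Proof.
have [F [F1 FP]] := norming_sequence sepE.
have F1' k : (dual_norm (F k) <= 1)%E by exact: dual_norm_le1.
(* The number of functionals and the margin are governed by the same [m], so these events increase
   and continuity from below preserves the bound. *)
pose A m := \bigcup_(k in `I_m) [set w |
  (r + m.+1%:R^-1 < resid mu (basis n) (centre mu X (F k)) w)%R].
have mA m : measurable (A m).
  by apply: fin_bigcup_measurable => // k _; apply: m_gt; exact: m_resid.
have muA m : (mu (A m) <= delta%:E)%E.
  by apply: finite_tail => //; rewrite invr_gt0 ltr0n.
have ndA : nondecreasing_seq A.
  apply/nondecreasing_seqP => m; apply/subsetPset => w [k /= km h].
  exists k => /=; first exact: ltnW.
  apply: le_lt_trans h; rewrite lerD2l lef_pV2 ?posrE ?ltr0n// ler_nat//.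
have mUA : measurable (\bigcup_m A m) by exact: bigcupT_measurable.
have UA : (mu (\bigcup_m A m) <= delta%:E)%E.
  have cvA := nondecreasing_cvg_mu mA mUA ndA (mu := mu).
  rewrite -(cvg_lim _ cvA)//; apply: lime_le; first by apply/cvg_ex; eexists; exact: cvA.
  by apply: nearW => m; exact: muA.
have : {ae mu, forall w, forall k, F k (X w - Xn n w) =
    resid mu (basis n) (centre mu X (F k)) w :> R}.
  by apply: ae_foralln => k; exact: (cond_exp_resid sepE gaussX (condXn n1)).
move=> [N [mN N0 subN]].
have mXn : borel_measurable measurable (Xn n).
  by have [_ /(bochner_integrable_norm sepE)[]] := condXn n1.
have mX : borel_measurable measurable X by case: gaussX.
pose Y w := X w - Xn n w.
have mB : measurable [set w | r < `|Y w|].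
  by apply: m_gt; apply: borel_measurable_norm; exact: (borel_measurableB sepE).
have BE : [set w | `|Y w| <= r] = ~` [set w | r < `|Y w|].
  by apply/seteqP; split=> w /=; rewrite leNgt => /negP.
rewrite BE probability_setC//.
have Bdelta : (mu [set w | (r < `|Y w|)%R] <= delta%:E)%E.
  apply: (@le_trans _ _ (mu (\bigcup_m A m `|` N))).
    apply: le_measure; [exact: mem_set|exact: (mem_set (measurableU _ _ mUA mN))|].
    move=> w /= rw; have [Nw|nN] := pselect (N w); [by right|left].
    have eqw k : F k (Y w) = resid mu (basis n) (centre mu X (F k)) w :> R.
      apply: contrapT => ne; apply: nN; apply: subN => /=.
      by move=> H'; apply: ne; exact: H'.
    have [k rk] := FP _ _ rw.
    have e0 : 0 < (F k (Y w) : R) - r by rewrite subr_gt0.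
    have [m0 _ m0P] := near_infty_natSinv_lt (PosNum e0).
    (* Past [m0] the margin is smaller than the excess over [r], and past [k] the functional [F k]
       is included. *)
    exists (maxn m0 k.+1) => //; exists k => /=; first by rewrite leq_maxr.
    have := m0P (maxn m0 k.+1) (leq_maxl _ _); by rewrite /= -eqw ltrBrDl.
  apply: (le_trans (measureU2 _ mUA mN)).
  by rewrite [X in (_ + X)%E](_ : _ = 0%E) ?adde0.
have muB : mu [set w | (r < `|Y w|)%R] = (fine (mu [set w | (r < `|Y w|)%R]))%:E.
  by rewrite fineK// fin_num_measure.
rewrite muB -EFinB lte_fin; move: Bdelta; rewrite muB lee_fin => h.
have := delta_lt; lra.
Qed.

End TailBound.

End RankDecomposition.

Theorem theorem3p1 (R : realType) (d : measure_display)
  (Omega : measurableType d) (mu : probability Omega R)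
  (E : completeNormedModType R) (sepE : separable E)
  (X : Omega -> E) (gaussX : gaussian mu X)
  (dim : nat -> nat) (dim_gt0 : forall j, (1 <= j)%N -> (0 < dim j)%N)
  (e : forall j : nat, 'I_(dim j) -> dual E)
  (Xn : nat -> Omega -> E)
  (condXn : forall n, (1 <= n)%N -> is_cond_exp mu (sigma_obs X e n) X (Xn n))
  (c : nat -> R)
  (c_decr : forall i j, (1 <= i <= j)%N -> c j <= c i)
  (c_l1 : summable_from 1 (fun j => `|c j|))
  (cov_le : forall n, (1 <= n)%N ->
     (opnorm (fun f => cov mu X f - cov mu (Xn n) f)%R <= (c n)%:E)%E) :
  forall a : nat -> R,
    (forall i j, (1 <= i <= j)%N -> a i <= a j) ->
    (forall j, (1 <= j)%N -> 0 < a j) ->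
    summable_from 1 (fun j => (dim j)%:R / a j) ->
    summable_from 2 (fun j => a j * (c j.-1 - c j)) ->
    (fun j => a j * c j) @ \oo --> (0 : R) ->
  forall (n : nat) (tau : R), (1 <= n)%N -> 0 < tau ->
    ((1 - expR (- tau))%:E <
     mu [set w | (`|X w - Xn n w| <=
          Num.sqrt (5 * Num.max 1 tau *
                    sum_from n.+1 (fun j => a j * (c j.-1 - c j)) *
                    sum_from n.+1 (fun j => (dim j)%:R / a j)))%R])%E.
Proof.
move=> a a_incr a_gt0 sum_dim sum_c ac0 n tau n1 tau_gt0.
exact: (norm_tail sepE gaussX dim_gt0 condXn c_decr cov_le a_incr a_gt0 sum_dim
  sum_c ac0 n1).
Qed.
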